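(* Let $(\mathcal M,g)$, $(E_d)$, $F=f^dE_d$ and the SDE $dX(t)=F(X(t))\,dt+\sqrt2\sum_{d=1}^D E_d(X(t))\circ dW_d(t)$ be as in the context, and assume that the SDE satisfies the well-posedness assumption, the existence and uniqueness assumption for the invariant measure $d\mu_\infty=\rho_\infty\,d\mathrm{vol}_{\mathcal M}$, the Poisson-equation assumption and the spectral-gap assumption (all stated in the context). Let $X_{n+1}=\Psi_h(X_n)$ be a consistent, ergodic one-step numerical method satisfying the Talay–Tubaro expansion assumption of the context, with operators $A_j$. Let $p\ge 1$ and assume $$A_j^*\,d\mu_\infty=0\qquad\text{for } j=2,\dots,p .$$ Then the method is of order $p$ for the invariant measure of the SDE. More precisely, there is $h_0>0$ such that for all $\varphi\in C_P^\infty(\mathcal M)$ and all step sizes $h\in(0,h_0]$, the error for the invariant measure satisfies $$e(\varphi,h)=h^p\int_0^\infty\int_{\mathcal M}u(t,x)\,A_{p+1}^*\,d\mu_\infty(x)\,dt+\mathcal O(h^{p+1}),$$ where $u(t,x)=\mathbb E[\varphi(X(t))\mid X(0)=x]$.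
   Context: Setting. $(\mathcal M,g)$ is a smooth, complete, connected $D$-dimensional Riemannian manifold with Riemannian volume $d\mathrm{vol}_{\mathcal M}$ and a global orthonormal frame $E_1,\dots,E_D$. Einstein summation is used. For a fixed $o\in\mathcal M$, $r(x)=d(o,x)$ is the Riemannian distance and $\mathrm{Cut}_o$ is the cut locus of $o$. $E_i[\varphi]$ is the derivative of $\varphi$ along $E_i$. $C_P^\infty(\mathcal M)$ is the set of smooth $\varphi$ such that for all $q\ge0$ and all $d_1,\dots,d_q$ there are $C,K$ with $|E_{d_q}[\dots E_{d_1}[\varphi]\dots]|(x)\le C(1+r(x)^K)$. $\mathfrak X_P(\mathcal M)$ is the set of vector fields $F=f^dE_d$ with $f^d\in C_P^\infty(\mathcal M)$ and $|df^d|$ bounded. For functions $\psi$ on $\mathcal M$, $\|\psi\|_{C^k}$ (resp. the seminorm $|\psi|_{C^k}$) is the supremum over $x\in\mathcal M$ of the absolute values of all frame derivatives $\partial_j\psi(x)$ of order $0\le|j|\le k$ (resp. $1\le |j|\le k$). The SDE is $dX=F(X)dt+\sqrt2\sum_d E_d(X)\circ dW_d$ (Stratonovich, $W_d$ independent Brownian motions), with generator $\mathcal L\varphi=\sum_d\big(f^dE_d[\varphi]+E_d[E_d[\varphi]]\big)$; $u(t,x)=\mathbb E[\varphi(X(t))|X(0)=x]$ solves $\partial_tu=\mathcal Lu$, $u(0,\cdot)=\varphi$. Adjoints $(\cdot)^*$ are taken in $L^2(\mathcal M,d\mathrm{vol}_{\mathcal M})$; for a differential operator $B$, $B^*d\mu_\infty$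 means $(B^*\rho_\infty)\,d\mathrm{vol}_{\mathcal M}$, so that $\int\varphi\,B^*d\mu_\infty=\int B\varphi\,d\mu_\infty$. Well-posedness assumption: the $E_d$ are smooth and bounded, $F\in\mathfrak X_P(\mathcal M)$, and $\mathcal Lr^2\le\nu+\lambda_0 r^2$ on $\mathcal M\setminus\mathrm{Cut}_o$ for some $\lambda_0\in\mathbb R$, $\nu\ge1$. Existence and uniqueness of the invariant measure: there is a unique invariant measure $d\mu_\infty=\rho_\infty\,d\mathrm{vol}_{\mathcal M}$, and it is the unique (probability) solution of $\mathcal L^*d\mu_\infty=0$. Poisson-equation assumption: for every $G\in C_P^\infty(\mathcal M)$ with zero mean on $\mathcal M$ there is a unique $\mu\in C_P^\infty(\mathcal M)$ with $\mathcal L^*\mu=G$ and $\int_{\mathcal M}\mu\,d\mu_\infty=0$. Spectral-gap assumption: there is $\lambda>0$ such that for every $k\ge0$ there is a polynomial $P_k$ with $\|u(t,\cdot)-\int\varphi\,d\mu_\infty\|_{C^k}\le P_k(t)e^{-\lambda t}\|\varphi\|_{C^k}$ for all $t\ge0$, $\varphi\in C_P^\infty(\mathcal M)$. A one-step method is $X_{n+1}=\Psi_h(X_n)$, $X_0\in\mathcal M$, where $\Psi_h$ is a random perturbation of the identity (with fresh independent randomness at each step). Talay–Tubaro expansion assumption: for all $\varphi\in C_P^\infty(\mathcal M)$, every $q\ge1$, and $h$ small enough, $\mathbb E[\varphi(X_1)|X_0=x]=\varphi(x)+\sum_{j=1}^q h^jA_j\varphi(x)+h^{q+1}R_q^h(\varphi,x)$,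 where $A_j$ is a linear differential operator of order $2j$ and $|R_q^h(\varphi,x)|\le C(1+r(x)^\kappa)|\varphi|_{C^{2q+2}}$. The method is consistent if $A_1=\mathcal L$. It is ergodic if it has a unique invariant measure $\rho^h\,d\mathrm{vol}_{\mathcal M}$ such that $\lim_{N\to\infty}\frac1{N+1}\sum_{n=0}^N\varphi(X_n)=\int\varphi\rho^h\,d\mathrm{vol}_{\mathcal M}$ almost surely for all $\varphi\in C_P^\infty(\mathcal M)$ and all $X_0\in\mathcal M$. Error: $e(\varphi,h)=\lim_{N\to\infty}\frac1{N+1}\sum_{n=0}^N\varphi(X_n)-\int_{\mathcal M}\varphi\,d\mu_\infty$. The method is of order $p$ for the invariant measure if there are $h_0>0$ and $C>0$ (depending on $h_0$ and $\varphi$) with $|e(\varphi,h)|\le Ch^p$ for $h\in(0,h_0)$. *)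

(* Defs.v *)
From HB Require Import structures.
From mathcomp Require Import all_boot all_order all_algebra.
From mathcomp Require Import all_classical all_reals all_analysis.

Set Implicit Arguments.
Unset Strict Implicit.
Unset Printing Implicit Defensive.

Import Order.TTheory GRing.Theory Num.Theory.
Import numFieldNormedType.Exports.

Local Open Scope classical_set_scope.
Local Open Scope ring_scope.

(* Equivalent to the existence and continuity on the open set U of all partial
   derivatives of order at most k, in finite dimension. *)
Fixpoint Ck_on (R : realType) (V W : normedModType R) (k : nat) (U : set V)
    (f : V -> W) : Prop :=
  (forall x, U x -> {for x, continuous f}) /\
  if k is k'.+1 then
    forall v, (forall x, U x -> derivable f x v) /\ Ck_on k' U ('D_v f)
  else True.

Definition smooth_on (R : realType) (V W : normedModType R) (U : set V)
  (f : V -> W) : Prop := forall k, Ck_on k U f.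

(* Lebesgue integral over R^n as an iterated integral (Tonelli); only used for
   nonnegative integrands. *)
Fixpoint iterated_integral (R : realType) (n : nat) :
    ('rV[R]_n -> \bar R) -> \bar R :=
  match n with
  | 0 => fun F => F 0
  | n'.+1 => fun F => (\int[lebesgue_measure]_(t in (setT : set R))
      iterated_integral (fun y : 'rV[R]_n' => F (row_mx (t%:M : 'M[R]_1) y)))%E
  end.

(* The atlas is indexed by the points of M: dom x is the domain of a chart
   coord x around x, with inverse point x.  Any smooth atlas contains such a
   family.  The tangent space at x is identified with 'rV_D by means of the
   chart indexed by x, so that a vector field is a map M -> 'rV_D. *)
Record manifold (R : realType) (D : nat) := Manifold {
  carrier :> ptopologicalType;
  dom : carrier -> set carrier;
  coord : carrier -> carrier -> 'rV[R]_D;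
  point : carrier -> 'rV[R]_D -> carrier;
  hausdorff_manifold : hausdorff_space carrier;
  second_countable_manifold : @second_countable carrier;
  dom_open : forall x, open (dom x);
  dom_center : forall x, dom x x;
  coord_open : forall x, open (coord x @` dom x);
  coordK : forall x y, dom x y -> point x (coord x y) = y;
  coord_continuous : forall x y, dom x y -> {for y, continuous (coord x)};
  point_continuous : forall x v,
    (coord x @` dom x) v -> {for v, continuous (point x)};
  transition_smooth : forall x y,
    smooth_on (coord x @` (dom x `&` dom y)) (coord y \o point x)
}.

Section Manifold.
Context (R : realType) (D : nat) (M : manifold R D).

Definition smooth (phi : M -> R) : Prop :=
  forall x, smooth_on (coord x @` dom x) ((phi \o point x) : 'rV[R]_D -> R^o).

Definition compact_support (phi : M -> R) : Prop :=
  compact (closure [set x | phi x != 0]).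

(* the differential of phi at x applied to the tangent vector v *)
Definition dphi (phi : M -> R) (x : M) (v : 'rV[R]_D) : R :=
  'D_v ((phi \o point x) : 'rV[R]_D -> R^o) (coord x x).

Definition vder (V : M -> 'rV[R]_D) (phi : M -> R) : M -> R :=
  fun x => dphi phi x (V x).

Definition smooth_field (V : M -> 'rV[R]_D) : Prop :=
  forall phi, smooth phi -> smooth (vder V phi).

Definition smooth_curve (c : R -> M) : Prop :=
  continuous c /\
  forall x, smooth_on (c @^-1` dom x) ((coord x \o c) : R^o -> 'rV[R]_D).

Definition velocity (c : R -> M) (t : R) : 'rV[R]_D :=
  'D_(1 : R^o) ((coord (c t) \o c) : R^o -> 'rV[R]_D) t.

Definition Borel := g_sigma_algebraType (@open M).

Definition bilin (g : M -> 'M[R]_D) (x : M) (v w : 'rV[R]_D) : R :=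
  (v *m g x *m w^T) 0 0.

Record metric := Metric {
  metric_mx :> M -> 'M[R]_D;
  metric_sym : forall x, (metric_mx x)^T = metric_mx x;
  metric_pos : forall x v, v != 0 -> 0 < bilin metric_mx x v v;
  metric_smooth : forall V W, smooth_field V -> smooth_field W ->
    smooth (fun x => bilin metric_mx x (V x) (W x))
}.

Section Metric.
Variable g : metric.

Definition curve_length (c : R -> M) : R :=
  \int[lebesgue_measure]_(t in `[0, 1])
    Num.sqrt (bilin g (c t) (velocity c t) (velocity c t)).

(* infimum of the lengths of the piecewise smooth curves from x to y, each of
   which is the concatenation of n smooth curves c i from p i to p i.+1 *)
Definition dist (x y : M) : R :=
  inf [set l | exists (n : nat) (p : nat -> M) (c : nat -> R -> M),
    [/\ p 0%N = x, p n = y,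
        forall i, (i < n)%N ->
          [/\ smooth_curve (c i), c i 0 = p i & c i 1 = p i.+1]
      & l = \sum_(i < n) curve_length (c i)]].

Definition metric_complete : Prop :=
  forall s : nat -> M,
    (forall e, 0 < e -> exists N, forall m n, (N <= m)%N -> (N <= n)%N ->
       dist (s m) (s n) < e) ->
    exists l : M, s @ \oo --> l.

(* unit speed geodesics, as the locally distance-realizing curves *)
Definition geodesic_ray (c : R -> M) : Prop :=
  forall t, 0 <= t -> exists2 e, 0 < e & forall s s', 0 <= s -> 0 <= s' ->
    `|s - t| < e -> `|s' - t| < e -> dist (c s) (c s') = `|s - s'|.

(* the points c t0 beyond which some geodesic c issued from o ceases to be
   minimizing *)
Definition cut_locus (o : M) : set M :=
  [set x | exists (c : R -> M) (t0 : R),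
    [/\ geodesic_ray c, c 0 = o, 0 < t0, c t0 = x
      & (forall t, 0 <= t <= t0 -> dist o (c t) = t) /\
        (forall t, t0 < t -> dist o (c t) < t)]].

(* the Gram matrix of the coordinate fields of the chart x, at point x y *)
Definition gram (x : M) (y : 'rV[R]_D) : 'M[R]_D :=
  let z := point x y in
  let del (i : 'I_D) : 'rV[R]_D :=
    'D_(delta_mx 0 i : 'rV[R]_D) (coord z \o point x) y in
  \matrix_(i, j) bilin g z (del i) (del j).

(* These equations determine vol, since M is covered by countably many chart
   domains. *)
Definition riemannian_volume (vol : {measure set Borel -> \bar R}) : Prop :=
  forall (x : M) (A : set Borel), measurable A -> A `<=` dom x ->
    vol A = iterated_integral (fun y =>
      (\1_(coord x @` A) y * Num.sqrt (\det (gram x y)))%:E).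

Definition orthonormal_frame (E : 'I_D -> M -> 'rV[R]_D) : Prop :=
  (forall d, smooth_field (E d)) /\
  (forall i j x, bilin g x (E i x) (E j x) = (i == j)%:R).

Definition bounded_field (V : M -> 'rV[R]_D) : Prop :=
  exists C, forall x, Num.sqrt (bilin g x (V x) (V x)) <= C.

Definition bounded_differential (phi : M -> R) : Prop :=
  exists C, forall x v, `|dphi phi x v| <= C * Num.sqrt (bilin g x v v).

Section Frame.
Variable E : 'I_D -> M -> 'rV[R]_D.

(* E_{d_q}[ ... E_{d_1}[phi] ... ] for s = [:: d_q; ...; d_1] *)
Definition frame_der (s : seq 'I_D) (phi : M -> R) : M -> R :=
  foldr (fun d => vder (E d)) phi s.

Definition frame_sup (a b : nat) (psi : M -> R) : \bar R :=
  ereal_sup [set z | exists (s : seq 'I_D) (x : M),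
    (a <= size s <= b)%N /\ z = `|frame_der s psi x|%:E].

Definition Ck_norm (k : nat) := frame_sup 0 k.
Definition Ck_seminorm (k : nat) := frame_sup 1 k.

Definition CP (o : M) (phi : M -> R) : Prop :=
  smooth phi /\
  forall s, exists (C : R) (K : nat),
    forall x, `|frame_der s phi x| <= C * (1 + dist o x ^+ K).

Definition XP (o : M) (f : 'I_D -> M -> R) : Prop :=
  forall d, CP o (f d) /\ bounded_differential (f d).

Definition drift_der (f : 'I_D -> M -> R) (phi : M -> R) : M -> R :=
  fun x => \sum_d f d x * vder (E d) phi x.

Definition generator (f : 'I_D -> M -> R) (phi : M -> R) : M -> R :=
  fun x => \sum_d (f d x * vder (E d) phi x + vder (E d) (vder (E d) phi) x).

(* linear differential operators of order (at most) m with smooth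
   coefficients, written in the frame *)
Definition diffop (m : nat) (B : (M -> R) -> (M -> R)) : Prop :=
  exists2 b : seq 'I_D -> M -> R, (forall s, smooth (b s)) &
    forall phi, smooth phi -> forall x,
      B phi x = \sum_(k < m.+1) \sum_(s : k.-tuple 'I_D)
                  b s x * frame_der s phi x.

Definition well_posed (f : 'I_D -> M -> R) (o : M) : Prop :=
  [/\ forall d, smooth_field (E d) /\ bounded_field (E d),
      XP o f
    & exists nu lambda0 : R, 1 <= nu /\
        forall x, ~ cut_locus o x ->
          generator f (fun y => dist o y ^+ 2) x <= nu + lambda0 * dist o x ^+ 2].

(* Bs is the formal adjoint of B in L^2(M, vol); it is unique on smooth
   functions. *)
Definition adjoint (vol : {measure set Borel -> \bar R})
    (B Bs : (M -> R) -> (M -> R)) : Prop :=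
  (exists m, diffop m Bs) /\
  forall phi psi, smooth phi -> compact_support phi ->
    smooth psi -> compact_support psi ->
    \int[vol]_x (B phi x * psi x) = \int[vol]_x (phi x * Bs psi x).

End Frame.
End Metric.

Definition density (vol : {measure set Borel -> \bar R})
    (rho : M -> R) (mu : probability Borel R) : Prop :=
  [/\ forall x, 0 <= rho x,
      measurable_fun setT (rho : Borel -> R)
    & forall A : set Borel, measurable A ->
        mu A = (\int[vol]_(x in A) (rho x)%:E)%E].

Definition invariant (K : M -> set Borel -> \bar R) (mu : probability Borel R)
    : Prop :=
  forall A : set Borel, measurable A -> (\int[mu]_x K x A)%E = mu A.

End Manifold.

Section SDE.
Context (R : realType) (D : nat) (M : manifold R D).
Context (d : measure_display) (T : measurableType d) (P : probability T R).

Definition filtration (Fil : R -> set (set T)) : Prop :=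
  (forall t, 0 <= t -> sigma_algebra setT (Fil t) /\ Fil t `<=` measurable) /\
  (forall s t, 0 <= s <= t -> Fil s `<=` Fil t).

(* The last clause states that the increment of the vector W over [s, t] is
   independent of Fil s, with independent N(0, t - s) components; the second
   argument of normal_prob is the standard deviation. *)
Definition brownian_motion (Fil : R -> set (set T)) (W : 'I_D -> R -> T -> R)
    : Prop :=
  [/\ forall i t (B : set R), 0 <= t -> measurable B -> Fil t (W i t @^-1` B),
      {ae P, forall w, forall i, W i 0 w = 0},
      {ae P, forall w, forall i, {within `[0, +oo[, continuous (W i ^~ w)}}
    & forall s t (A : set T) (B : 'I_D -> set R), 0 <= s < t ->
        Fil s A -> (forall i, measurable (B i)) ->
        P (A `&` [set w | forall i, B i (W i t w - W i s w)]) =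
        (P A * \prod_(i < D) normal_prob 0 (Num.sqrt (t - s)) (B i))%E].

(* I is the Stratonovich integral of Y o dW over [0, t]: the limit in
   probability of the trapezoidal sums as the mesh of the partitions tends to 0 *)
Definition stratonovich (Y W : R -> T -> R) (t : R) (I : T -> R) : Prop :=
  measurable_fun setT I /\
  forall e, 0 < e -> exists2 delta, 0 < delta &
    forall (n : nat) (tau : nat -> R), tau 0%N = 0 -> tau n = t ->
      (forall i, (i < n)%N -> tau i <= tau i.+1 <= tau i + delta) ->
      let trapezoidal_sum w := \sum_(i < n)
        (Y (tau i) w + Y (tau i.+1) w) / 2 * (W (tau i.+1) w - W (tau i) w) in
      (P [set w | e < `|trapezoidal_sum w - I w|]%R <= e%:E)%E.

(* X solves dX = F(X) dt + sqrt 2 sum_i E_i(X) o dW_i, X(0) = x, where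
   F = sum_i f_i E_i: the equation on M is tested on all smooth functions. *)
Definition sde_solution (E : 'I_D -> M -> 'rV[R]_D) (f : 'I_D -> M -> R)
    (Fil : R -> set (set T)) (W : 'I_D -> R -> T -> R)
    (x : M) (X : R -> T -> M) : Prop :=
  [/\ forall t (A : set (Borel M)), 0 <= t -> measurable A ->
        Fil t (X t @^-1` A),
      {ae P, forall w, X 0 w = x},
      {ae P, forall w, {within `[0, +oo[, continuous (X ^~ w)}}
    & forall phi, smooth phi -> forall t, 0 <= t ->
      exists2 I : 'I_D -> T -> R,
        forall i, stratonovich (fun s w => vder (E i) phi (X s w)) (W i) t (I i)
      & {ae P, forall w, phi (X t w) = phi (X 0 w)
            + \int[lebesgue_measure]_(s in `[0, t]) drift_der E f phi (X s w)
            + Num.sqrt 2 * \sum_i I i w}].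

Definition semigroup (X : M -> R -> T -> M) (phi : M -> R) (t : R) (x : M) : R :=
  \int[P]_w phi (X x t w).

Definition backward_kolmogorov (g : metric M) (E : 'I_D -> M -> 'rV[R]_D)
    (f : 'I_D -> M -> R) (o : M) (X : M -> R -> T -> M) : Prop :=
  forall phi, CP g E o phi ->
    let u := semigroup X phi in
    [/\ forall t x, 0 <= t -> P.-integrable setT (fun w => (phi (X x t w))%:E),
        forall t, 0 <= t -> smooth (u t),
        forall x, u 0 x = phi x,
        forall x, {within `[0, +oo[, continuous (u ^~ x)}
      & forall x t, 0 < t ->
          is_derive (t : R^o) (1 : R^o) ((u ^~ x) : R^o -> R^o)
            (generator E f (u t) x)].

(* existence and uniqueness of the invariant measure muinf = rho vol; Ls is
   the adjoint of the generator *)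
Definition unique_invariant_measure (g : metric M)
    (E : 'I_D -> M -> 'rV[R]_D) (o : M) (X : M -> R -> T -> M)
    (vol : {measure set (Borel M) -> \bar R}) (Ls : (M -> R) -> (M -> R))
    (rho : M -> R) (muinf : probability (Borel M) R) : Prop :=
  let transition t (x : M) (A : set (Borel M)) := P (X x t @^-1` A) in
  [/\ smooth rho /\ density vol rho muinf,
      forall phi, CP g E o phi -> muinf.-integrable setT (EFin \o phi),
      (forall t, 0 <= t -> invariant (transition t) muinf) /\
      (forall nu : probability (Borel M) R,
        (forall t, 0 <= t -> invariant (transition t) nu) ->
        forall A, measurable A -> nu A = muinf A),
      (forall x, Ls rho x = 0)
    & forall (rho' : M -> R) (nu : probability (Borel M) R),
        smooth rho' -> density vol rho' nu -> (forall x, Ls rho' x = 0) ->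
        rho' = rho].

Definition poisson_solvable (g : metric M)
    (E : 'I_D -> M -> 'rV[R]_D) (o : M)
    (vol : {measure set (Borel M) -> \bar R}) (Ls : (M -> R) -> (M -> R))
    (muinf : probability (Borel M) R) : Prop :=
  forall G, CP g E o G -> vol.-integrable setT (EFin \o G) ->
    \int[vol]_x G x = 0 ->
    exists! mu : M -> R,
      [/\ CP g E o mu, forall x, Ls mu x = G x & \int[muinf]_x mu x = 0].

(* The positivity of Q avoids the convention 0 * +oo = 0 when the norm of phi
   is infinite. *)
Definition spectral_gap (g : metric M)
    (E : 'I_D -> M -> 'rV[R]_D) (o : M) (X : M -> R -> T -> M)
    (muinf : probability (Borel M) R) : Prop :=
  exists2 lambda : R, 0 < lambda & forall k, exists2 Q : {poly R},
    (forall t, 0 <= t -> 0 < Q.[t]) &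
    forall t phi, 0 <= t -> CP g E o phi ->
      (Ck_norm E k (fun x => semigroup X phi t x - \int[muinf]_y phi y)%R
       <= (Q.[t] * expR (- lambda * t))%R%:E * Ck_norm E k phi)%E.

End SDE.

(* One step methods X_{n+1} = Psi h xi_n X_n, where the xi_n are independent
   with values in the noise space S and law N. *)
Section Method.
Context (R : realType) (D : nat) (M : manifold R D).
Context (g : metric M) (E : 'I_D -> M -> 'rV[R]_D) (o : M).
Context (dS : measure_display) (S : measurableType dS) (N : probability S R).
Context (d : measure_display) (T : measurableType d) (P : probability T R).

Definition iid (xi : nat -> T -> S) : Prop :=
  (forall n, measurable_fun setT (xi n)) /\
  forall (n : nat) (A : nat -> set S), (forall i, measurable (A i)) ->
    P [set w | forall i, (i < n)%N -> A i (xi i w)] = (\prod_(i < n) N (A i))%E.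

Definition measurable_method (Psi : R -> S -> M -> M) : Prop :=
  forall h, 0 < h ->
    measurable_fun setT (fun z : S * Borel M => Psi h z.1 z.2 : Borel M).

Fixpoint chain (Psi : R -> S -> M -> M) (xi : nat -> T -> S) (h : R) (x : M)
    (n : nat) (w : T) : M :=
  if n is n'.+1 then Psi h (xi n' w) (chain Psi xi h x n' w) else x.

Definition ergodic_average (Psi : R -> S -> M -> M) (xi : nat -> T -> S)
    (phi : M -> R) (h : R) (x : M) (w : T) (n : nat) : R :=
  n.+1%:R^-1 * \sum_(k < n.+1) phi (chain Psi xi h x k w).

Definition talay_tubaro (Psi : R -> S -> M -> M)
    (A : nat -> (M -> R) -> (M -> R)) : Prop :=
  (forall j, (1 <= j)%N -> diffop E (2 * j)%N (A j)) /\
  forall q, (1 <= q)%N -> exists (C : R) (kappa : nat), 0 < C /\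
    forall phi, CP g E o phi -> exists2 h0 : R, 0 < h0 &
      forall h, 0 < h < h0 -> exists2 rem : M -> R,
        forall x,
          N.-integrable setT (fun s => (phi (Psi h s x))%:E) /\
          \int[N]_s phi (Psi h s x) =
            phi x + \sum_(1 <= j < q.+1) h ^+ j * A j phi x
            + h ^+ q.+1 * rem x
        & forall x, (`|rem x|%R%:E <=
            (C * (1 + dist g o x ^+ kappa))%R%:E *
            Ck_seminorm E (2 * q + 2)%N phi)%E.

Definition consistent (f : 'I_D -> M -> R) (A : nat -> (M -> R) -> (M -> R))
    : Prop :=
  forall phi, smooth phi -> forall x, A 1%N phi x = generator E f phi x.

Definition ergodic (vol : {measure set (Borel M) -> \bar R})
    (Psi : R -> S -> M -> M) (xi : nat -> T -> S) (h : R) : Prop :=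
  let transition (x : M) (B : set (Borel M)) := N [set s | B (Psi h s x)] in
  exists (rhoh : M -> R) (muh : probability (Borel M) R),
    [/\ density vol rhoh muh,
        invariant transition muh,
        forall nu : probability (Borel M) R, invariant transition nu ->
          forall B, measurable B -> nu B = muh B
      & forall phi, CP g E o phi ->
          muh.-integrable setT (EFin \o phi) /\
          forall x, {ae P, forall w,
            ergodic_average Psi xi phi h x w n @[n --> \oo]
              --> \int[muh]_y phi y}].

(* e is the error e(phi, h), an almost sure limit independent of X_0 *)
Definition invariant_error (muinf : probability (Borel M) R)
    (Psi : R -> S -> M -> M) (xi : nat -> T -> S)
    (phi : M -> R) (h e : R) : Prop :=
  forall x, {ae P, forall w,
    ergodic_average Psi xi phi h x w n - \int[muinf]_y phi y @[n --> \oo]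
      --> e}.

Definition invariant_order (muinf : probability (Borel M) R)
    (Psi : R -> S -> M -> M) (xi : nat -> T -> S) (p : nat) : Prop :=
  exists2 h0 : R, 0 < h0 & forall phi, CP g E o phi ->
    exists2 C : R, 0 < C & forall h, 0 < h < h0 ->
      exists2 e, invariant_error muinf Psi xi phi h e & `|e| <= C * h ^+ p.

End Method.

(* Main.v *)
Require Import Defs.
From HB Require Import structures.
From mathcomp Require Import all_boot all_order all_algebra.
From mathcomp Require Import finmap.
From mathcomp Require Import all_classical all_reals all_analysis.
From mathcomp Require Import measurable_realfun ring lra.

Set Implicit Arguments.
Unset Strict Implicit.
Unset Printing Implicit Defensive.

Import Order.TTheory GRing.Theory Num.Theory.
Import numFieldNormedType.Exports.

Local Open Scope classical_set_scope.
Local Open Scope ring_scope.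

Local Notation crd := Defs.coord.
Local Notation pnt := Defs.point.

(* The spectral gap makes V = int_0^oo (u(t) - m) dt, with m the mean of phi
   for the invariant measure, a smooth function with bounded frame derivatives
   which solves L V = m - phi.  If M were not compact, then for a bump phi with
   m > 0 we would have L V = m > 0 outside a compact set; since the drift has
   linear growth, at a maximum of V - eps |ln (1 + r) - a| for a large the drift
   term is at most m / 2, hence some E_i E_i V is bounded below by a constant,
   and because E_i E_i E_i V is bounded, V increases by a fixed amount along the
   field E_i near that point, contradicting maximality.  So r is bounded, and M
   is compact by the Hopf-Rinow theorem; in particular all smooth functions are
   in C_P and have finite C^k norms.
   Integrating the expansion of E[V(X_1)] of order q against the invariant
   measure of the method, the terms V cancel and A_1 V = m - phi, so that the
   error of phi is the sum of the h^(j-1) int A_j V dmu_h for 2 <= j <= q, up to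
   O(h^q).  Replacing mu_h by mu_oo in these integrals costs the error of A_j V,
   and int A_j V dmu_oo = 0 for j <= p, so induction on q gives order p and the
   leading term h^p int A_{p+1} V dmu_oo, which Fubini turns into the stated
   double integral. *)

(** The obstacle is that the spectral gap and the remainder of the expansion are both measured by
    suprema over M, which may be infinite for functions of polynomial growth. Compactness removes
    it, and is forced by applying the gap to a single bump, whose norms are finite whatever M is. In
    the maximum argument the logarithm is dictated by the drift: its slope, of order 1 / (1 + r),
    compensates the growth in 1 + r. As V is bounded, the absolute value confines the maximum to a
    shell around ln (1 + r) = a, which for a large avoids the support of the bump. Since r is not
    smooth and no flow of E_i is constructed, only short chart segments are used, with estimates
    uniform in their starting point. The threshold on h in the expansion depends on the function; it
    is traded for a larger constant, so that one h_0 serves all phi. Finally A_{p+1} kills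
    constants, so that u can be replaced with u - m, which decays in time, before Fubini is
    applied. *)

Lemma cvg_sumr {R : realType} {T : Type} {F : set_system T} {FF : Filter F}
    {W : normedModType R} (I : Type) (r : seq I) (P : pred I)
    (f : I -> T -> W) (l : I -> W) :
  (forall i, f i x @[x --> F] --> l i) ->
  (\sum_(i <- r | P i) f i x) @[x --> F] --> \sum_(i <- r | P i) l i.
Proof.
move=> fl; elim: r => [|i r IH].
  rewrite big_nil (_ : (fun=> _) = cst 0); first exact: cvg_cst.
  by apply/funext => x; rewrite big_nil.
rewrite big_cons (_ : (fun x => _) = (fun x => if P i then
    f i x + \sum_(i <- r | P i) f i x else \sum_(i <- r | P i) f i x)).
  by case: (P i) => //; apply: cvgD.
by apply/funext => x; rewrite big_cons.
Qed.

(** * Calculus of C^k functions on open sets of normed spaces *)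

Section CkGeneral.
Context {R : realType} {V W : normedModType R}.
Implicit Types (f g : V -> W) (U : set V) (k : nat).

Lemma Ck_on_cont k U f x : Ck_on k U f -> U x -> {for x, continuous f}.
Proof. by case: k => [|k] [cf _] Ux; exact: cf. Qed.

Lemma Ck_onSP k U f v : Ck_on k.+1 U f ->
  (forall x, U x -> derivable f x v) /\ Ck_on k U ('D_v f).
Proof. by move=> [_ /(_ v)]. Qed.

Lemma Ck_on_sub k U U' f : U' `<=` U -> Ck_on k U f -> Ck_on k U' f.
Proof.
move=> UU'; elim: k f => [|k IH] f /= [cf df]; split=> //.
- by move=> x /UU'; exact: cf.
- by move=> x /UU'; exact: cf.
- by move=> v; have [dv Cv] := df v; split; [move=> x /UU'; exact: dv|exact: IH].
Qed.

Lemma Ck_onW k U f : Ck_on k.+1 U f -> Ck_on k U f.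
Proof.
elim: k f => [|k IH] f [cf df]; split=> // v.
by have [dv Cv] := df v; split=> //; exact: IH.
Qed.

(** For functions whose formula changes from place to place, as in [smooth_chart_ext] and
    [Ck_on_chart_coef]. *)
Lemma Ck_on_loc k U f :
  (forall x, U x -> exists2 U', U' x & Ck_on k U' f) -> Ck_on k U f.
Proof.
elim: k f => [|k IH] f H; split=> //.
- by move=> x /H[U' U'x Cf]; exact: Ck_on_cont Cf U'x.
- by move=> x /H[U' U'x Cf]; exact: Ck_on_cont Cf U'x.
- move=> v; split.
    by move=> x /H[U' U'x Cf]; have [+ _] := Ck_onSP v Cf; apply.
  by apply: IH => x /H[U' U'x Cf]; exists U' => //; have [] := Ck_onSP v Cf.
Qed.

Lemma eq_nbhs_continuous U f g x : open U -> (forall y, U y -> f y = g y) ->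
  U x -> {for x, continuous f} -> {for x, continuous g}.
Proof.
move=> oU fg Ux; rewrite /prop_for /continuous_at -(fg _ Ux) => cf.
apply: cvg_trans cf; apply: near_eq_cvg.
by apply: filterS (open_nbhs_nbhs (conj oU Ux)) => y /fg.
Qed.

Lemma eq_nbhs_derive U f g x v : open U -> (forall y, U y -> f y = g y) ->
  U x -> 'D_v f x = 'D_v g x.
Proof.
move=> oU fg Ux; apply: near_eq_derive.
by apply: filterS (open_nbhs_nbhs (conj oU Ux)) => y /fg.
Qed.

Lemma Ck_on_eq k U f g : open U -> (forall x, U x -> f x = g x) ->
  Ck_on k U f -> Ck_on k U g.
Proof.
elim: k f g => [|k IH] f g oU fg [cf df].
  by split=> // x Ux; apply: (eq_nbhs_continuous oU fg Ux); exact: cf.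
have cg x : U x -> {for x, continuous g}.
  by move=> Ux; apply: (eq_nbhs_continuous oU fg Ux); exact: cf.
split=> // v; have [dv Cv] := df v; split.
  move=> x Ux; apply: near_eq_derivable (dv x Ux).
  by apply: filterS (open_nbhs_nbhs (conj oU Ux)) => y /fg.
by apply: IH Cv => // x Ux; exact: eq_nbhs_derive Ux.
Qed.

Lemma Ck_on_cst k U (c : W) : Ck_on k U (cst c : V -> W).
Proof.
elim: k c => [|k IH] c; split=> //; try by move=> x _; exact: cst_continuous.
move=> v; split; first by move=> x _; exact: derivable_cst.
have -> : 'D_v (cst c : V -> W) = cst 0 by apply/funext => x; rewrite derive_cst.
exact: IH.
Qed.

Lemma Ck_onD k U f g : open U -> Ck_on k U f -> Ck_on k U g ->
  Ck_on k U (fun x => f x + g x).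
Proof.
move=> oU; elim: k f g => [|k IH] f g [cf df] [cg dg].
  by split=> // x Ux; apply: cvgD; [exact: cf|exact: cg].
split; first by move=> x Ux; apply: cvgD; [exact: cf|exact: cg].
move=> v; have [dfv Cf] := df v; have [dgv Cg] := dg v; split.
  by move=> x Ux; apply: derivableD; [exact: dfv|exact: dgv].
apply: Ck_on_eq (IH _ _ Cf Cg) => // x Ux.
by rewrite deriveD//; [exact: dfv|exact: dgv].
Qed.

Lemma Ck_on_sum k U (I : Type) (r : seq I) (P : pred I) (F : I -> V -> W) :
  open U -> (forall i, Ck_on k U (F i)) ->
  Ck_on k U (fun x => \sum_(i <- r | P i) F i x).
Proof.
move=> oU CF; elim: r => [|i r IH].
  by apply: Ck_on_eq (Ck_on_cst k U 0) => // x _; rewrite big_nil.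
apply: (@Ck_on_eq _ _ (fun x => if P i then F i x + \sum_(i <- r | P i) F i x
  else \sum_(i <- r | P i) F i x)) => //; first by move=> x _; rewrite big_cons.
by case: (P i) => //; exact: Ck_onD.
Qed.

End CkGeneral.

(** Reduces directional derivatives to one variable, where the mean value theorem and the chain rule
    apply. *)
Lemma derive_line {R : realType} {V W : normedModType R} (f : V -> W) x v :
  'D_v f x = 'D_(1 : R) (fun h : R => f (h *: v + x)) 0.
Proof.
rewrite /derive; set g1 := fun h => h^-1 *: _; set g2 := fun h => h^-1 *: _.
suff -> : g1 = g2 by [].
by rewrite funeqE /g1 /g2 => h /=; rewrite addr0 scale0r add0r [_%:A]mulr1.
Qed.

Lemma is_derive_line {R : realType} {V W : normedModType R} (f : V -> W) x v l :
  is_derive x v f l <-> is_derive (0 : R) (1 : R) (fun h : R => f (h *: v + x)) l.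
Proof.
split=> -[df <-]; split.
- exact: (iffLR (derivable1P f x v)) df.
- by rewrite -derive_line.
- exact: (iffRL (derivable1P f x v)) df.
- by rewrite derive_line.
Qed.

Section CkScalar.
Context {R : realType} {V : normedModType R}.
Implicit Types (f g : V -> R^o) (U : set V) (k : nat).

Lemma Ck_onM k U f g : open U -> Ck_on k U f -> Ck_on k U g ->
  Ck_on k U ((fun x => f x * g x) : V -> R^o).
Proof.
move=> oU; elim: k f g => [|k IH] f g Cf Cg.
  split=> // x Ux; apply: cvgM; [exact: Ck_on_cont Cf Ux|exact: Ck_on_cont Cg Ux].
split=> [x Ux|v].
  by apply: cvgM; [exact: Ck_on_cont Cf Ux|exact: Ck_on_cont Cg Ux].
have [dfv Cfv] := Ck_onSP v Cf; have [dgv Cgv] := Ck_onSP v Cg; split.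
  by move=> x Ux; apply: derivableM; [exact: dfv|exact: dgv].
apply: (@Ck_on_eq _ _ _ _ _
  ((fun x => f x * 'D_v g x + g x * 'D_v f x) : V -> R^o)) => //.
  by move=> x Ux; rewrite deriveM//; [exact: dfv|exact: dgv].
by apply: Ck_onD => //; apply: IH => //; exact: Ck_onW.
Qed.

Lemma Ck_onN k U f : open U -> Ck_on k U f -> Ck_on k U ((fun x => - f x) : V -> R^o).
Proof.
move=> oU Cf; apply: (@Ck_on_eq _ _ _ _ _ ((fun x => (cst (-1) x) * f x) : V -> R^o)) => //.
  by move=> x _; rewrite mulN1r.
by apply: Ck_onM => //; exact: Ck_on_cst.
Qed.

Lemma Ck_onV k U f : open U -> (forall x, U x -> f x != 0) -> Ck_on k U f ->
  Ck_on k U ((fun x => (f x)^-1) : V -> R^o).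
Proof.
move=> oU f0; elim: k => [|k IH] Cf.
  by split=> // x Ux; apply: cvgV; [exact: f0|exact: Ck_on_cont Cf Ux].
split=> [x Ux|v].
  by apply: cvgV; [exact: f0|exact: Ck_on_cont Cf Ux].
have [dfv Cfv] := Ck_onSP v Cf; split.
  by move=> x Ux; apply: derivableV; [exact: f0|exact: dfv].
apply: (@Ck_on_eq _ _ _ _ _
  ((fun x => - ((f x)^-1 * (f x)^-1 * 'D_v f x)) : V -> R^o)) => //.
  move=> x Ux; rewrite (@deriveV _ _ f)//; [|exact: f0|exact: dfv].
  by rewrite scaleNr expr2 invfM.
have Cf' := IH (Ck_onW Cf).
by apply: Ck_onN => //; apply: Ck_onM => //; apply: Ck_onM.
Qed.

Lemma Ck_on_prod k U (I : Type) (r : seq I) (P : pred I) (F : I -> V -> R^o) :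
  open U -> (forall i, Ck_on k U (F i)) ->
  Ck_on k U ((fun x => \prod_(i <- r | P i) F i x) : V -> R^o).
Proof.
move=> oU CF; elim: r => [|i r IH].
  by apply: (@Ck_on_eq _ _ _ _ _ (cst 1 : V -> R^o)) => [//|x _|]; [rewrite big_nil|exact: Ck_on_cst].
apply: (@Ck_on_eq _ _ _ _ _ ((fun x => if P i then F i x * \prod_(i <- r | P i) F i x
  else \prod_(i <- r | P i) F i x) : V -> R^o)) => //.
  by move=> x _; rewrite big_cons.
by case: (P i) => //; exact: Ck_onM.
Qed.

Lemma Ck_on_comp1 k U (b : R^o -> R^o) f : open U -> (forall j, Ck_on j setT b) ->
  Ck_on k U f -> Ck_on k U ((b \o f) : V -> R^o).
Proof.
move=> oU; elim: k b => [|k IH] b Cb Cf.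
  split=> // x Ux; apply: continuous_comp; first exact: Ck_on_cont Cf Ux.
  by have := Cb 0%N => /Ck_on_cont; apply.
split=> [x Ux|v].
  apply: continuous_comp; first exact: Ck_on_cont Cf Ux.
  by have := Cb 0%N => /Ck_on_cont; apply.
have [dfv Cfv] := Ck_onSP v Cf.
have db y : derivable b y (1 : R^o) by have [+ _] := Ck_onSP (1 : R^o) (Cb 1%N); apply.
have H x : U x -> is_derive x v (b \o f) ('D_(1 : R^o) b (f x) * 'D_v f x).
  move=> Ux; apply/is_derive_line.
  have df1 := (is_derive_line f x v ('D_v f x)).1 (DeriveDef (dfv _ Ux) erefl).
  apply: (@is_derive1_comp _ (b : R -> R) _ _ _ _ _ df1).
  by rewrite scale0r add0r; split; first exact: db.
split; first by move=> x /H[].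
apply: (@Ck_on_eq _ _ _ _ _ ((fun x => ('D_(1 : R^o) b \o f) x * 'D_v f x) : V -> R^o)) => //.
  by move=> x /H[].
apply: Ck_onM => //; apply: IH; last exact: Ck_onW.
by move=> j; have [] := Ck_onSP (1 : R^o) (Cb j.+1).
Qed.

End CkScalar.

Section CkRow.
Context {R : realType} {V : normedModType R} {n : nat}.
Implicit Types (f : V -> 'rV[R]_n) (U : set V) (k : nat).

Lemma row_continuous_at f x :
  (forall i, {for x, continuous (fun y => f y 0 i)}) -> {for x, continuous f}.
Proof.
move=> cf; apply/cvgrPdist_le => /= e e0.
near=> y.
rewrite /Num.Def.normr/= mx_normrE (bigmax_le _ (ltW e0))//= => -[i j] _.
rewrite !mxE/= (ord1 i); move: j; near: y; apply: filter_forall => /= j.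
by have /cvgrPdist_le := cf j; exact.
Unshelve. all: by end_near. Qed.

Lemma coord_continuous_at f x i :
  {for x, continuous f} -> {for x, continuous (fun y => f y 0 i)}.
Proof.
move=> cf; apply: (@continuous_comp _ _ _ f (fun v : 'rV[R]_n => v 0 i)) => //.
exact: coord_continuous.
Qed.

Lemma Ck_on_coord k U f i : open U -> Ck_on k U f ->
  Ck_on k U ((fun x => f x 0 i) : V -> R^o).
Proof.
move=> oU; elim: k f => [|k IH] f Cf.
  by split=> // x Ux; exact: coord_continuous_at (Ck_on_cont Cf Ux).
split=> [x Ux|v].
  exact: coord_continuous_at (Ck_on_cont Cf Ux).
have [dfv Cfv] := Ck_onSP v Cf; split.
  by move=> x Ux; have /derivable_mxP := dfv x Ux; exact.
apply: Ck_on_eq (IH _ Cfv) => // x Ux.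
by rewrite derive_mx ?mxE//; exact: dfv.
Qed.

Lemma Ck_on_row k U f : open U ->
  (forall i, Ck_on k U ((fun x => f x 0 i) : V -> R^o)) -> Ck_on k U f.
Proof.
move=> oU; elim: k f => [|k IH] f Cf.
  split=> // x Ux; apply: row_continuous_at => i.
  exact: (Ck_on_cont (Cf i) Ux).
split=> [x Ux|v].
  by apply: row_continuous_at => i; exact: (Ck_on_cont (Cf i) Ux).
have dv x : U x -> derivable f x v.
  move=> Ux; apply/derivable_mxP => i j; rewrite (ord1 i).
  by have [+ _] := Ck_onSP v (Cf j); exact.
split=> //; apply: IH => i; have [_ Cv] := Ck_onSP v (Cf i).
apply: Ck_on_eq Cv => // x Ux.
by rewrite derive_mx ?mxE//; exact: dv.
Qed.

End CkRow.

Section CkLine.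
Context {R : realType} {V : normedModType R}.

(** The parametrization [s] is kept general because two are used: affine ones to cut and reverse
    curves, and a sine for the segments in a chart. *)
Lemma Ck_on_line k (U : set V) (f : V -> R^o) (s : R^o -> R^o) (a w : V) :
  open U -> (forall j, Ck_on j setT s) -> Ck_on k U f ->
  Ck_on k [set t | U (a + s t *: w)] ((fun t => f (a + s t *: w)) : R^o -> R^o).
Proof.
move=> oU Cs.
have cs t : {for t, continuous s} by exact: (Ck_on_cont (Cs 0%N)).
have cg : continuous (fun t : R^o => a + s t *: w).
  move=> t; apply: cvgD; first exact: cvg_cst.
  by apply: cvgZr_tmp; exact: cs.
have oU' : open [set t : R^o | U (a + s t *: w)].
  by move/continuousP : cg => /(_ U oU).
elim: k f => [|k IH] f Cf.
  split=> // t Ut; apply: continuous_comp; first exact: cg.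
  exact: (Ck_on_cont Cf).
split=> [t Ut|v].
  by apply: continuous_comp; [exact: cg|exact: (Ck_on_cont Cf)].
have [dfw Cfw] := Ck_onSP w Cf.
have [ds Cds] : (forall t, derivable s t v) /\ forall j, Ck_on j setT ('D_v s).
  split; first by move=> t; have [+ _] := Ck_onSP v (Cs 1%N); apply.
  by move=> j; have [] := Ck_onSP v (Cs j.+1).
have H t : U (a + s t *: w) -> is_derive t v (fun t => f (a + s t *: w))
    ('D_w f (a + s t *: w) * 'D_v s t).
  move=> Ut; apply/is_derive_line.
  have /is_derive_line ds1 := DeriveDef (ds t) (erefl ('D_v s t)).
  have df1 : is_derive (s t : R) (1 : R) (fun r : R => f (a + r *: w))
      ('D_w f (a + s t *: w)).
    apply/is_derive_line.
    have /is_derive_line := DeriveDef (dfw _ Ut) (erefl ('D_w f (a + s t *: w))).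
    congr (is_derive _ _ _ _); apply/funext => h /=.
    by congr (f _); rewrite [h%:A]mulr1 scalerDl addrCA addrC.
  apply: (@is_derive1_comp _ (fun r : R => f (a + r *: w)) _ _ _ _ _ ds1).
  by rewrite scale0r add0r.
split; first by move=> t /H[].
apply: (@Ck_on_eq _ _ _ _ _
  ((fun t => 'D_w f (a + s t *: w) * 'D_v s t) : R^o -> R^o)) => //.
  by move=> t /H[].
apply: (Ck_onM oU' (IH _ Cfw)).
exact: Ck_on_sub (@subsetT _ _) (Cds k).
Qed.

End CkLine.

(** * C^1 functions are differentiable, and the chain rule *)

Section LinForm.
Context {R : realType} {n : nat}.

Definition lin_form (a : 'I_n -> R) (h : 'rV[R]_n) : R^o := \sum_i h 0 i * a i.

Fact lin_form_linear a : linear (lin_form a).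
Proof.
move=> k u v; rewrite /lin_form scaler_sumr -big_split/=.
by apply: eq_bigr => i _; rewrite !mxE mulrDl -mulrA.
Qed.

HB.instance Definition _ a :=
  GRing.isLinear.Build R 'rV[R]_n R^o _ (lin_form a) (lin_form_linear a).

Lemma lin_form_continuous a : continuous (lin_form a).
Proof.
move=> x; rewrite /lin_form; apply: (@cvg_sumr _ _ (nbhs x) (nbhs_filter x) R^o) => i.
by apply: cvgMl; exact: coord_continuous.
Qed.

End LinForm.

Lemma MVT0 {R : realType} (g dg : R -> R) (a : R) :
  (forall c : R, `|c| <= `|a| -> is_derive c (1 : R) g (dg c)) ->
  exists2 c, `|c| <= `|a| & g a - g 0 = dg c * a.
Proof.
move=> H.
have cg (c : R) : `|c| <= `|a| -> {for c, continuous g}.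
  move=> /H[dgc _]; apply: differentiable_continuous.
  by apply/derivable1_diffP.
have [a0|a0] := leP 0 a.
  have [||c cI ->] := @MVT_segment R g dg 0 a a0.
  - move=> x; rewrite in_itv/= => /andP[x0 xa]; apply: H.
    by rewrite !ger0_norm// ltW.
  - apply: derivable_within_continuous => x; rewrite in_itv/= => /andP[x0 xa].
    by have [|] := H x => //; rewrite !ger0_norm// ltW.
  exists c; last by rewrite subr0.
  by move: cI; rewrite in_itv/= => /andP[c0 ca]; rewrite !ger0_norm.
have [||c cI E] := @MVT_segment R g dg a 0 (ltW a0).
- move=> x; rewrite in_itv/= => /andP[xa x0]; apply: H.
  by rewrite !ltr0_norm// lerN2 ltW.
- apply: derivable_within_continuous => x; rewrite in_itv/= => /andP[xa x0].
  by have [|] := H x => //; rewrite ler0_norm// ltr0_norm// lerN2.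
exists c; last by rewrite -[LHS]opprK opprB E sub0r mulrN opprK.
by move: cI; rewrite in_itv/= => /andP[ca c0]; rewrite ler0_norm// ltr0_norm// lerN2.
Qed.

(** The differential is a chosen witness of the first order expansion, so that exhibiting one
    continuous linear candidate is enough. *)
Lemma differentiable_increment {R : realType} {V W : normedModType R}
    (f : V -> W) (df : {linear V -> W}) x : continuous df ->
  (forall e : R, 0 < e ->
    \forall h \near (0 : V), `|f (x + h) - f x - df h| <= e * `|h|) ->
  differentiable f x.
Proof.
move=> dfc H.
have Hdf : f \o shift x = cst (f x) + df +o_ 0 id.
  apply/eqaddoP => e e0; have := H e e0; apply: filterS => h.
  rewrite -[(_ - _) h]/(f (h + x) - (f x + df h)) /=.
  by rewrite opprD addrA (addrC h x).
apply/diffP.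
apply: (@getPex _ (fun (df : {linear V -> W}) => continuous df /\
  forall y, f y = f (lim (nbhs x)) + df (y - lim (nbhs x))
                  +o_(y \near x) (y - lim (nbhs x)))).
exists df; split=> //; apply: eqaddoEx => z.
rewrite lim_id // -[in LHS](subrK x z).
have /(congr1 (fun F => F (z - x))) := Hdf; rewrite /= => ->.
rewrite !fctE; congr (_ + _).
rewrite -(comp_centerK x id) -[X in the_littleo _ _ _ X](comp_centerK x).
by rewrite -[_ (z - x)]/((_ \o (center x)) z) -littleo_center0.
Qed.

Section C1Diff.
Context {R : realType} {n : nat}.
Implicit Types (f : 'rV[R]_n -> R^o) (y h v : 'rV[R]_n).

Lemma C1_increment f (U : set 'rV[R]_n) y (e : R) : open U -> U y ->
  Ck_on 1 U f -> 0 < e ->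
  \forall h \near (0 : 'rV[R]_n), `|f (y + h) - f y
    - \sum_i h 0 i * 'D_(delta_mx 0 i) f y| <= e * `|h|.
Proof.
move=> oU Uy Cf e0.
(* There are [n] coordinate increments, each with error [e' * |h|]; [n.+1] avoids a division by
   0. *)
pose e' := e / n.+1%:R.
have e'0 : 0 < e' by rewrite divr_gt0.
have near_ok : \forall z \near y, U z /\
    forall i : 'I_n, `|'D_(delta_mx 0 i) f y - 'D_(delta_mx 0 i) f z| <= e'.
  near=> z; split.
    by near: z; apply: open_nbhs_nbhs.
  near: z.
  apply: filter_forall => i.
  have [_ Ci] := Ck_onSP (delta_mx 0 i) Cf.
  by have /cvgrPdist_le := Ck_on_cont Ci Uy; exact.
have /nbhs_ballP[d /= d0 Hd] := near_ok.
near=> h.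
have hd : `|h| < d.
  by near: h; exact: (@nbhs0_lt _ 'rV[R]_n).
have ok z : `|z| <= `|h| -> U (y + z) /\
    forall i : 'I_n, `|'D_(delta_mx 0 i) f y - 'D_(delta_mx 0 i) f (y + z)| <= e'.
  move=> zh; apply: Hd; rewrite -ball_normE/= opprD addNKr normrN.
  exact: le_lt_trans zh hd.
(* Truncating [h] to its first [j] coordinates gives a path from [y] to [y + h] along the axes. For
   the sup norm it stays in the ball of radius [|h|], and the mean value theorem applies to each of
   its pieces. *)
pose p j : 'rV[R]_n := \row_(i < n) (if (i < j)%N then h 0 i else 0).
have p0 : p 0%N = 0 by apply/rowP => i; rewrite !mxE.
have pn : p n = h by apply/rowP => i; rewrite !mxE ltn_ord.
have pS (j : 'I_n) : p j.+1 = p j + h 0 j *: delta_mx 0 j.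
  apply/rowP => i; rewrite !mxE/= ltnS leq_eqVlt -val_eqE/=.
  by case: eqVneq => [/val_inj ->|_]; rewrite ?ltnn/= ?mulr1 ?add0r ?mulr0 ?addr0.
have ple (j : 'I_n) (c : R) : `|c| <= `|h 0 j| -> `|p j + c *: delta_mx 0 j| <= `|h|.
  move=> ch; rewrite /Num.Def.normr/= !mx_normrE bigmax_le//.
    by rewrite bigmax_idl le_max lexx.
  move=> [a i] _; rewrite (ord1 a) !mxE/=.
  apply: le_trans (le_bigmax _ (fun ij => `|h ij.1 ij.2|) (0, i)).
  case: eqVneq => [->|_]; rewrite ?ltnn/= ?mulr1 ?add0r// ?mulr0 ?addr0.
  by case: ifP => //; rewrite normr0.
have -> : f (y + h) - f y = \sum_(j < n) (f (y + p j.+1) - f (y + p j)).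
  rewrite -(big_mkord xpredT (fun j => f (y + p j.+1) - f (y + p j))).
  by rewrite telescope_sumr// pn p0 addr0.
rewrite -sumrB (le_trans (ler_norm_sum _ _ _))//.
apply: (@le_trans _ _ (\sum_(i < n) e' * `|h|)); last first.
  rewrite sumr_const card_ord -mulr_natl mulrA ler_wpM2r// /e'.
  by rewrite mulrCA ler_piMr ?(ltW e0)// ler_pdivrMr// mul1r ler_nat.
apply: ler_sum => j _.
have [|c ch] := @MVT0 _ (fun c : R => f (y + (p j + c *: delta_mx 0 j)))
  (fun c : R => 'D_(delta_mx 0 j) f (y + (p j + c *: delta_mx 0 j))) (h 0 j).
  move=> c ch; apply/is_derive_line.
  have [Uz _] := ok _ (ple j c ch).
  have dfz : derivable f (y + (p j + c *: delta_mx 0 j)) (delta_mx 0 j).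
    by have [+ _] := Ck_onSP (delta_mx 0 j) Cf; apply.
  have /is_derive_line := DeriveDef dfz erefl.
  congr (is_derive _ _ _ _); apply/funext => t /=.
  by congr (f _); rewrite [t%:A]mulr1 scalerDl addrCA; congr (_ + _); rewrite addrCA.
rewrite -pS scale0r addr0 => ->.
rewrite mulrC -mulrBr normrM mulrC ler_pM//.
  by rewrite distrC; have [_] := ok _ (ple j c ch); exact.
rewrite /Num.Def.normr/= mx_normrE.
exact: (le_bigmax _ (fun ij => `|h ij.1 ij.2|) (0, j)).
Unshelve. all: by end_near. Qed.

Lemma C1_differentiable f (U : set 'rV[R]_n) y : open U -> U y ->
  Ck_on 1 U f -> differentiable f y.
Proof.
move=> oU Uy Cf.
apply: (@differentiable_increment _ _ R^o f
  (lin_form (fun i => 'D_(delta_mx 0 i) f y))).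
  exact: lin_form_continuous.
by move=> e e0; exact: C1_increment Cf e0.
Qed.

End C1Diff.

Lemma is_derive_diff_comp {R : realType} {V W Z : normedModType R}
    (g : V -> W) (f : W -> Z) x v :
  derivable g x v -> differentiable f (g x) ->
  is_derive x v (f \o g) ('D_('D_v g x) f (g x)).
Proof.
move=> dg df; apply/is_derive_line.
have /is_derive_line[dg1 eg1] := DeriveDef dg (erefl ('D_v g x)).
set g1 := (fun h : R => g (h *: v + x)) in dg1 eg1.
have E : g1 0 = g x by rewrite /g1 scale0r add0r.
have dg1' : differentiable g1 0 by apply/derivable1_diffP.
have -> : (fun h : R => (f \o g) (h *: v + x)) = f \o g1 by [].
have dfg : differentiable (f \o g1) 0.
  by apply: differentiable_comp => //; rewrite E.
split; first by apply/derivable1_diffP.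
rewrite deriveE// diff_comp//=; last by rewrite E.
by rewrite E -deriveE// -deriveE// eg1.
Qed.

(** * Smooth functions of one variable: affine functions, sines and the flat exponential *)

Section OneVariable.
Context {R : realType}.

(** A family that is stable under derivation consists of smooth functions: a single induction treats
    all its members at once. *)
Lemma Ck_on_family (I : Type) (F : I -> R -> R) (d : I -> I) :
  (forall i x, is_derive x (1 : R) (F i) (F (d i) x)) ->
  forall k i (U : set R^o), Ck_on k U (F i : R^o -> R^o).
Proof.
move=> H; have dF i x : differentiable (F i) x.
  by apply/derivable1_diffP; case: (H i x).
elim=> [|k IH] i U; split=> //.
- by move=> x _; exact: differentiable_continuous (dF i x).
- by move=> x _; exact: differentiable_continuous (dF i x).
- move=> v; split; first by move=> x _; exact: diff_derivable (dF i x).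
  have -> : 'D_v (F i : R^o -> R^o) = ((fun x => cst v x * F (d i) x) : R^o -> R^o).
    apply/funext => x; have [_ <-] := H i x.
    rewrite /= (deriveE _ (dF i x)) deriveE//.
    by rewrite -[X in 'd _ _ X = _]mulr1 [LHS]linearZ.
  apply: (@Ck_on_sub _ _ _ _ setT) => //.
  by apply: Ck_onM; [exact: openT|exact: Ck_on_cst|exact: IH].
Qed.

Lemma Ck_on_affine (a b : R) k (U : set R^o) :
  Ck_on k U ((fun t => a + b * t) : R^o -> R^o).
Proof.
pose F (i : nat) : R -> R :=
  if i is i'.+1 then (if i' is _.+1 then cst 0 else cst b) else (fun t => a + b * t).
apply: (@Ck_on_family nat F succn _ k 0%N) => -[|[|i]] x /=.
- have H : is_derive x (1 : R) (cst a + b \*: (id : R -> R)) (0 + b *: 1).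
    exact: is_deriveD.
  by apply: (is_derive_eq H); rewrite add0r [LHS]mulr1.
- exact: is_derive_cst.
- exact: is_derive_cst.
Qed.

Lemma Ck_on_sin (c : R) k (U : set R^o) :
  Ck_on k U ((fun t => sin (c * t)) : R^o -> R^o).
Proof.
(* Each derivation multiplies by [c] and advances the phase by a quarter period. *)
pose F (i : nat) (t : R) := c ^+ i * sin (c * t + i%:R * (pi / 2)).
have -> : (fun t => sin (c * t)) = F 0%N.
  by apply/funext => t; rewrite /F expr0 mul1r mul0r addr0.
apply: (@Ck_on_family nat F succn) => i x.
have H1 : is_derive x (1 : R) (fun t : R => c * t + i%:R * (pi / 2)) c.
  have H : is_derive x (1 : R) (c \*: (id : R -> R) + cst (i%:R * (pi / 2)))
    (c *: 1 + 0) by exact: is_deriveD.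
  by apply: (is_derive_eq H); rewrite addr0 [LHS]mulr1.
have H2 := @is_derive1_comp _ sin (fun t : R => c * t + i%:R * (pi / 2)) _ _ _
  (is_derive_sin _) H1.
have -> : F i.+1 x = c ^+ i *: (cos (c * x + i%:R * (pi / 2)) * c).
  rewrite /F /GRing.scale/= -sinDpihalf exprSr -mulrA; congr (_ * _).
  rewrite mulrC; congr (_ * _); congr (sin _).
  by rewrite -addrA -natr1 mulrDl mul1r.
exact: is_deriveZ.
Qed.

(** The flat function $e^{-1/x}$ times a polynomial in $1/x$: the polynomial factor makes the family
    stable under derivation, as [Ck_on_family] requires. *)
Definition exp_inv (p : {poly R}) (x : R) : R :=
  if 0 < x then p.[x^-1] * expR (- x^-1) else 0.

Lemma poly_exp_bounded (p : {poly R}) :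
  exists2 C, 0 < C & forall y, 0 <= y -> `|p.[y] * expR (- y)| <= C.
Proof.
(* From $y^i \le i!\, e^y$; the summand 1 gives positivity. *)
exists (1 + \sum_(i < size p) `|p`_i| * i`!%:R).
  rewrite ltr_pwDl//; apply: sumr_ge0 => i _; exact: mulr_ge0.
move=> y y0; apply: (@le_trans _ _ (\sum_(i < size p) `|p`_i| * i`!%:R)); last first.
  by rewrite lerDr.
rewrite horner_coef mulr_suml (le_trans (ler_norm_sum _ _ _))//.
apply: ler_sum => i _; rewrite -mulrA normrM ler_wpM2l//.
rewrite ger0_norm; last by rewrite mulr_ge0 ?exprn_ge0 ?expR_ge0.
rewrite expRN ler_pdivrMr ?expR_gt0//.
case: i => -[|i] Hi /=.
  by rewrite fact0 mul1r expr0 -expR0 ler_expR.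
have := expR_ge1Dxn i y0; rewrite -ler_pdivrMl ?ltr0n ?fact_gt0//.
by move=> H; apply: le_trans H; rewrite mulrC lerDr.
Qed.

Lemma is_derive_exp_inv (p : {poly R}) (x : R) :
  is_derive x (1 : R) (exp_inv p) (exp_inv ('X^2 * (p - p^`())) x).
Proof.
have [x0|x0|->] := ltgtP x 0.
- rewrite {2}/exp_inv ltNge (ltW x0)/=.
  apply: (@near_eq_is_derive _ _ _ (cst 0)) => //.
  by apply: filterS (lt_le_nbhsl x0) => y y0; rewrite /exp_inv ltNge y0.
- apply: (@near_eq_is_derive R R R (fun y : R => p.[y^-1] * expR (- y^-1) : R)).
    by apply: filterS (lt_nbhsr x0) => y y0; rewrite /exp_inv y0.
  have x0' : x != 0 by rewrite gt_eqF.
  have H1 : is_derive x (1 : R) (fun y : R => y^-1) (- x ^- 2).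
    have -> : - x ^- 2 = - (x ^- 2) *: (1 : R) by rewrite /GRing.scale/= mulr1.
    exact: is_deriveV.
  have H2 := @is_derive1_comp _ (horner p) (fun y : R => y^-1) _ _ _ (is_derive_poly p _) H1.
  have H3 := @is_derive1_comp _ expR (fun y : R => - y^-1) _ _ _ (is_derive_expR _) (is_deriveN H1).
  have H4 := is_deriveM H2 H3; apply: (is_derive_eq H4) => /=.
  rewrite /exp_inv x0 !hornerE /GRing.scale/=.
  rewrite -exprVn; ring.
- rewrite {2}/exp_inv ltxx.
  (* At 0, bounding ['X^2 * p] instead of [p] shows that the function is $O(h^2)$, so that its
     difference quotient tends to 0. *)
  have [C C0 HC] := poly_exp_bounded ('X^2 * p).
  have bnd h : `|exp_inv p h| <= C * `|h| ^+ 2.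
    rewrite /exp_inv; case: ifPn => [h0|_]; last first.
      by rewrite normr0 mulr_ge0 ?exprn_ge0// ltW.
    have hi0 : 0 <= h^-1 by rewrite invr_ge0 ltW.
    have := HC _ hi0.
    rewrite hornerM hornerXn -mulrA exprVn normrM normfV [ `|h ^+ 2|]ger0_norm ?sqr_ge0//.
    by rewrite ler_pdivrMl ?exprn_gt0// (gtr0_norm h0) [C * _]mulrC.
  have lim0 : h^-1 *: ((exp_inv p \o shift 0) (h *: (1 : R)) - exp_inv p 0) @[h --> 0^'] --> (0 : R).
    apply/cvgrPdist_le => e e0; near=> h.
    rewrite sub0r normrN /= addr0 [h%:A]mulr1 {2}/exp_inv ltxx subr0.
    rewrite normrM normfV ler_pdivrMl ?normr_gt0; last by near: h; exact: nbhs_dnbhs_neq.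
    rewrite (le_trans (bnd h))// expr2 mulrA mulrC ler_wpM2l// -ler_pdivlMl//.
    rewrite mulrC; near: h; apply: dnbhs0_le; exact: divr_gt0.
  split; first by apply/cvg_ex; exists 0.
  exact: cvg_lim lim0.
Unshelve. all: by end_near. Qed.

Definition sbump (x : R) : R := exp_inv 1 x.

Lemma Ck_on_sbump k (U : set R^o) : Ck_on k U (sbump : R^o -> R^o).
Proof.
exact: (@Ck_on_family {poly R} exp_inv (fun p => 'X^2 * (p - p^`()))
  is_derive_exp_inv k 1).
Qed.

Lemma sbump_ge0 x : 0 <= sbump x.
Proof. by rewrite /sbump /exp_inv; case: ifP => // _; rewrite hornerE mul1r expR_ge0. Qed.

Lemma sbump_gt0 x : 0 < x -> 0 < sbump x.
Proof. by move=> x0; rewrite /sbump /exp_inv x0 hornerE mul1r expR_gt0. Qed.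

Lemma sbump_eq0 x : x <= 0 -> sbump x = 0.
Proof. by move=> x0; rewrite /sbump /exp_inv ltNge x0. Qed.

End OneVariable.

(** * Smooth functions, tangent vectors and frames read in charts *)

Section Smooth.
Context {R : realType} {D : nat} {M : manifold R D}.
Implicit Types (phi psi : M -> R) (x y z : M) (v w : 'rV[R]_D).

Definition img x : set 'rV[R]_D := crd x @` dom x.

Lemma open_img x : open (img x).
Proof. exact: coord_open. Qed.

Lemma imgP x p : img x p -> dom x (pnt x p) /\ crd x (pnt x p) = p.
Proof. by move=> [z dz <-]; rewrite coordK. Qed.

Lemma img_coord x z : dom x z -> img x (crd x z).
Proof. by exists z. Qed.

Lemma img_center x : img x (crd x x).
Proof. exact/img_coord/dom_center. Qed.

Lemma pointK x : pnt x (crd x x) = x.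
Proof. exact/coordK/dom_center. Qed.

Lemma continuous_coord x z : dom x z -> {for z, continuous (crd x)}.
Proof. exact: Defs.coord_continuous. Qed.

Lemma continuous_point x p : img x p -> {for p, continuous (pnt x)}.
Proof. exact: Defs.point_continuous. Qed.

Lemma nbhs_dom x z : dom x z -> nbhs z (dom x).
Proof. by move=> dz; apply: open_nbhs_nbhs; split => //; exact: dom_open. Qed.

Lemma nbhs_img x p : img x p -> nbhs p (img x).
Proof. by move=> dz; apply: open_nbhs_nbhs; split => //; exact: open_img. Qed.

Definition overlap x z : set 'rV[R]_D := crd x @` (dom x `&` dom z).

Lemma overlapP x z p : overlap x z p <-> img x p /\ dom z (pnt x p).
Proof.
split; first by move=> [q [dx dz] <-]; rewrite coordK//; split=> //; exact: img_coord.
by move=> [[q dq <-]]; rewrite coordK// => dz; exists q.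
Qed.

Lemma open_point_preimage x (A : set M) : open A ->
  open [set p | img x p /\ A (pnt x p)].
Proof.
move=> oA; rewrite openE => p [ip Ap].
have nA : nbhs p (pnt x @^-1` A).
  by apply: (continuous_point ip); exact: open_nbhs_nbhs.
by apply: filterS2 (nbhs_img ip) nA => q.
Qed.

Lemma open_overlap x z : open (overlap x z).
Proof.
have -> : overlap x z = [set p | img x p /\ dom z (pnt x p)].
  by apply/seteqP; split=> p /overlapP.
exact/open_point_preimage/dom_open.
Qed.

Lemma smoothE phi : smooth phi ->
  forall x k, Ck_on k (img x) ((phi \o pnt x) : 'rV[R]_D -> R^o).
Proof. by move=> sphi x; exact: sphi. Qed.

Lemma smooth_cst (c : R) : smooth (cst c : M -> R).
Proof. by move=> x k; exact: Ck_on_cst. Qed.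

Lemma smoothD phi psi : smooth phi -> smooth psi -> smooth (fun x => phi x + psi x).
Proof.
by move=> s1 s2 x k; apply: Ck_onD; [exact: open_img|exact: s1|exact: s2].
Qed.

Lemma smoothM phi psi : smooth phi -> smooth psi -> smooth (fun x => phi x * psi x).
Proof.
by move=> s1 s2 x k; apply: Ck_onM; [exact: open_img|exact: s1|exact: s2].
Qed.

Lemma smooth_sum (I : Type) (r : seq I) (P : pred I) (F : I -> M -> R) :
  (forall i, smooth (F i)) -> smooth (fun x => \sum_(i <- r | P i) F i x).
Proof.
by move=> sF x k; apply: Ck_on_sum; [exact: open_img|move=> i; exact: sF].
Qed.

Lemma continuous_smooth phi : smooth phi -> continuous phi.
Proof.
move=> sphi x.
have cp := Ck_on_cont (smoothE sphi x 0%N) (img_center x).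
have : {for x, continuous ((phi \o pnt x) \o crd x)}.
  by apply: continuous_comp => //; exact/continuous_coord/dom_center.
rewrite /prop_for /continuous_at /= pointK => H.
apply: cvg_trans H; apply: near_eq_cvg.
by apply: filterS (nbhs_dom (dom_center x)) => z dz; rewrite /= coordK.
Qed.

End Smooth.

Section Chart.
Context {R : realType} {D : nat} {M : manifold R D}.
Implicit Types (phi psi : M -> R) (x y z : M) (p v w : 'rV[R]_D).

Lemma smooth_differentiable phi x p : smooth phi -> img x p ->
  differentiable ((phi \o pnt x) : 'rV[R]_D -> R^o) p.
Proof.
by move=> sphi ip; apply: C1_differentiable (@open_img _ _ _ x) ip (smoothE sphi _ _).
Qed.

(** The tangent space at a point is identified through the chart indexed by that point, so a
    coordinate vector of the chart [x] has to be transported by the transition map. *)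
Definition tvec x p w : 'rV[R]_D := 'D_w (crd (pnt x p) \o pnt x) p.

Lemma transition_derivable x z p w : overlap x z p ->
  derivable (crd z \o pnt x) p w.
Proof.
move=> op; have [+ _] := Ck_onSP w (@transition_smooth _ _ M x z 1%N); exact.
Qed.

Lemma factor_chart phi x z p : overlap x z p ->
  \forall q \near p, (phi \o pnt z \o (crd z \o pnt x)) q = (phi \o pnt x) q.
Proof.
move=> op; have := open_nbhs_nbhs (conj (@open_overlap _ _ _ x z) op).
by apply: filterS => q /overlapP[_ dz] /=; rewrite coordK.
Qed.

Lemma overlap_self x p : img x p -> overlap x (pnt x p) p.
Proof. by move=> ip; apply/overlapP; split=> //; exact: dom_center. Qed.

Lemma derive_chart phi x p w : smooth phi -> img x p ->
  'D_w ((phi \o pnt x) : 'rV[R]_D -> R^o) p = dphi phi (pnt x p) (tvec x p w).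
Proof.
move=> sphi ip; have op := overlap_self ip.
rewrite -(near_eq_derive (W := R^o) w (factor_chart phi op)).
have dd : differentiable ((phi \o pnt (pnt x p)) : 'rV[R]_D -> R^o)
    ((crd (pnt x p) \o pnt x) p).
  by apply: smooth_differentiable => //; exact: img_center.
by have [_ ->] := is_derive_diff_comp (@transition_derivable x _ p w op) dd.
Qed.

Lemma dphi_linear phi z (I : Type) (r : seq I) (a : I -> R) (v : I -> 'rV[R]_D) :
  smooth phi ->
  dphi phi z (\sum_(i <- r) a i *: v i) = \sum_(i <- r) a i * dphi phi z (v i).
Proof.
move=> sphi; have df := smooth_differentiable sphi (img_center z).
rewrite /dphi deriveE// linear_sum/=; apply: eq_bigr => i _.
by rewrite linearZ/= -deriveE.
Qed.

Lemma tvec_linear x p (I : Type) (r : seq I) (a : I -> R) (v : I -> 'rV[R]_D) :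
  img x p ->
  tvec x p (\sum_(i <- r) a i *: v i) = \sum_(i <- r) a i *: tvec x p (v i).
Proof.
move=> ip; have op := overlap_self ip.
have C := @transition_smooth _ _ M x (pnt x p) 1%N.
have dt w : derivable (crd (pnt x p) \o pnt x) p w by exact: (@transition_derivable x _ p w op).
apply/rowP => j; rewrite /tvec derive_mx// mxE summxE.
have df : differentiable
    ((fun q => (crd (pnt x p) \o pnt x) q 0 j) : 'rV[R]_D -> R^o) p.
  apply: C1_differentiable (@open_overlap _ _ _ x (pnt x p)) op _.
  by apply: Ck_on_coord C; exact: open_overlap.
rewrite deriveE// linear_sum/=; apply: eq_bigr => i _.
by rewrite linearZ/= -deriveE// derive_mx// !mxE.
Qed.

Lemma tvec_center x w : tvec x (crd x x) w = w.
Proof.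
rewrite /tvec pointK.
have H : \forall q \near crd x x, (crd x \o pnt x) q = id q.
  by apply: filterS (nbhs_img (img_center x)) => q /imgP[_].
by rewrite (near_eq_derive w H) derive_id.
Qed.

Lemma eq_near_vder (V : M -> 'rV[R]_D) phi psi x :
  (\forall z \near x, phi z = psi z) -> vder V phi x = vder V psi x.
Proof.
move=> H; rewrite /vder /dphi; apply: (@near_eq_derive _ _ R^o).
have := @continuous_point _ _ M x _ (img_center x).
by rewrite /prop_for /continuous_at pointK => /(_ _ H).
Qed.

Lemma vder_cst (V : M -> 'rV[R]_D) (c : R) x : vder V (cst c) x = 0.
Proof. by rewrite /vder /dphi (_ : _ \o _ = cst c)// derive_cst. Qed.

Lemma vderD (V : M -> 'rV[R]_D) phi psi x : smooth phi -> smooth psi ->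
  vder V (fun z => phi z + psi z) x = vder V phi x + vder V psi x.
Proof.
move=> s1 s2; rewrite /vder /dphi.
by rewrite -deriveD//; apply: diff_derivable; apply: smooth_differentiable => //;
  exact: img_center.
Qed.

Lemma smooth_frame_der (E : 'I_D -> M -> 'rV[R]_D) s phi :
  (forall d, smooth_field (E d)) -> smooth phi -> smooth (frame_der E s phi).
Proof. by move=> sE sphi; elim: s => //= d s IH; exact: sE. Qed.

Lemma frame_derD (E : 'I_D -> M -> 'rV[R]_D) s phi psi :
  (forall d, smooth_field (E d)) -> smooth phi -> smooth psi ->
  frame_der E s (fun z => phi z + psi z) =
  (fun z => frame_der E s phi z + frame_der E s psi z).
Proof.
move=> sE s1 s2; elim: s => //= d s ->; apply/funext => x.
by rewrite vderD//; exact: smooth_frame_der.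
Qed.

Lemma frame_der_cst (E : 'I_D -> M -> 'rV[R]_D) s (c : R) :
  frame_der E s (cst c) = if s is [::] then cst c else cst 0.
Proof.
elim: s => //= d s ->; apply/funext => x.
by case: s => [|? ?]; rewrite vder_cst.
Qed.

End Chart.

Section Frame.
Context {R : realType} {D : nat} {M : manifold R D}.
Variables (g : metric M) (E : 'I_D -> M -> 'rV[R]_D).
Hypothesis EF : orthonormal_frame g E.
Implicit Types (phi psi : M -> R) (x y z : M) (p v w : 'rV[R]_D).

Lemma smooth_field_frame d : smooth_field (E d).
Proof. by have [sE _] := EF; exact: sE. Qed.

Definition frame_mx z : 'M[R]_D := \matrix_(i, j) E i z 0 j.

Lemma frame_mx_row z i : row i (frame_mx z) = E i z.
Proof. by apply/rowP => j; rewrite !mxE. Qed.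

Lemma frame_mx_orth z : frame_mx z *m g z *m (frame_mx z)^T = 1%:M.
Proof.
apply/matrixP => i j; rewrite [RHS]mxE.
have [_ /(_ i j z) <-] := EF; rewrite /bilin.
rewrite -(frame_mx_row z i) -(frame_mx_row z j) -row_mul !mxE.
by apply: eq_bigr => k _; rewrite !mxE.
Qed.

Lemma frame_mx_unit z : frame_mx z \in unitmx.
Proof.
have := frame_mx_orth z; rewrite -mulmxA => /mulmx1_unit[]//.
Qed.

Definition fcoord z v : 'rV[R]_D := v *m invmx (frame_mx z).

Lemma fcoordK z v : v = \sum_i fcoord z v 0 i *: E i z.
Proof.
rewrite -[LHS](mulmxKV (frame_mx_unit z)) -/(fcoord z v) mulmx_sum_row.
by apply: eq_bigr => i _; rewrite frame_mx_row.
Qed.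

Lemma fcoord_frame z i : fcoord z (E i z) = delta_mx 0 i.
Proof.
by rewrite /fcoord -frame_mx_row -row_mul mulmxV ?frame_mx_unit// row1.
Qed.

Lemma bilin_fcoord z v : bilin g z v v = \sum_i fcoord z v 0 i ^+ 2.
Proof.
set a := fcoord z v; have -> : v = a *m frame_mx z.
  by rewrite /a mulmxKV// frame_mx_unit.
rewrite /bilin trmx_mul !mulmxA -(mulmxA a) -(mulmxA a) frame_mx_orth mulmx1.
rewrite mxE; apply: eq_bigr => i _; rewrite [X in _ * X]mxE expr2 //.
Qed.

Lemma dphi_frame phi z v : smooth phi ->
  dphi phi z v = \sum_i fcoord z v 0 i * vder (E i) phi z.
Proof. by move=> sphi; rewrite {1}(fcoordK z v) dphi_linear. Qed.

(** The link between partial derivatives in a chart and frame derivatives; its regularity in [p] is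
    [Ck_on_chart_coef]. *)
Definition chart_coef x p w : 'rV[R]_D := fcoord (pnt x p) (tvec x p w).

Lemma derive_chart_frame phi x p w : smooth phi -> img x p ->
  'D_w ((phi \o pnt x) : 'rV[R]_D -> R^o) p =
  \sum_i chart_coef x p w 0 i * vder (E i) phi (pnt x p).
Proof. by move=> sphi ip; rewrite derive_chart// dphi_frame. Qed.

Lemma chart_coef_linear x p (I : Type) (r : seq I) (a : I -> R)
    (v : I -> 'rV[R]_D) : img x p ->
  chart_coef x p (\sum_(i <- r) a i *: v i) = \sum_(i <- r) a i *: chart_coef x p (v i).
Proof.
move=> ip; rewrite /chart_coef tvec_linear// /fcoord mulmx_suml.
by apply: eq_bigr => i _; rewrite scalemxAl.
Qed.

Lemma chart_coef_center x i : chart_coef x (crd x x) (E i x) = delta_mx 0 i.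
Proof. by rewrite /chart_coef tvec_center pointK fcoord_frame. Qed.

End Frame.

(** * Bump functions and cut-off coordinates on M *)

Section Ext.
Context {R : realType} {D : nat} {M : manifold R D}.
Implicit Types (phi psi : M -> R) (x y z : M) (p v w : 'rV[R]_D).

Definition cball (c : 'rV[R]_D) (r : R) : set 'rV[R]_D := [set p | `|p - c| <= r].

Lemma cball_compact c r : compact (cball c r).
Proof.
apply: bounded_closed_compact.
  exists (`|c| + r); split; first exact: num_real.
  move=> b cb p /= pr; apply: le_trans (ltW cb).
  by rewrite -(subrK c p) addrC (le_trans (ler_normD _ _))// lerD2l.
have -> : cball c r = (fun p => `|p - c|) @^-1` [set t | t <= r] by [].
apply: closed_comp; last exact: closed_le.
move=> p _; apply: (@continuous_comp _ _ _ (fun p => p - c) Num.norm).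
  by apply: continuousB; [exact: cvg_id|exact: cst_continuous].
exact: norm_continuous.
Qed.

Lemma nbhs_cball (c : 'rV[R]_D) (A : set 'rV[R]_D) : nbhs c A ->
  exists2 r, 0 < r & cball c r `<=` A.
Proof.
move=> /nbhs_ballP[r /= r0 rA]; exists (r / 2); first by rewrite divr_gt0.
move=> p pr; apply: rA; rewrite -ball_normE/= distrC (le_lt_trans pr)//.
by rewrite ltr_pdivrMr// ltr_pMr// ltr1n.
Qed.

Definition chart_ext x (f : 'rV[R]_D -> R) : M -> R :=
  fun z => if z \in dom x then f (crd x z) else 0.

Lemma chart_extE x f z : dom x z -> chart_ext x f z = f (crd x z).
Proof. by move=> dz; rewrite /chart_ext mem_set. Qed.

Definition chart_ball x r : set M := pnt x @` cball (crd x x) r.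

Lemma chart_ball_compact x r : cball (crd x x) r `<=` img x ->
  compact (chart_ball x r).
Proof.
move=> rx; apply: continuous_compact; last exact: cball_compact.
apply: continuous_in_subspaceT => p /set_mem /rx; exact: continuous_point.
Qed.

Lemma chart_ball_closed x r : cball (crd x x) r `<=` img x -> closed (chart_ball x r).
Proof.
move=> rx; apply: compact_closed; last exact: chart_ball_compact.
exact: hausdorff_manifold.
Qed.

Lemma chart_ext_out x f r z : cball (crd x x) r `<=` img x ->
  (forall p, ~ cball (crd x x) r p -> f p = 0) ->
  ~ chart_ball x r z -> chart_ext x f z = 0.
Proof.
move=> rx f0 nz; rewrite /chart_ext; case: ifPn => // /set_mem dz.
by apply: f0 => rz; apply: nz; exists (crd x z) => //; exact: coordK.
Qed.

(** Near a point of the chart domain the function is [f] in coordinates; elsewhere it vanishes near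
    the point, because the compact ball is closed in the Hausdorff space M. The regularity of [f] is
    asked as stability under composition with C^k maps, here transition maps; the bumps below
    satisfy it coordinate by coordinate. *)
Lemma smooth_chart_ext x (f : 'rV[R]_D -> R) r :
  (forall k (U : set 'rV[R]_D) (t : 'rV[R]_D -> 'rV[R]_D), open U ->
     Ck_on k U t -> Ck_on k U ((f \o t) : 'rV[R]_D -> R^o)) ->
  cball (crd x x) r `<=` img x ->
  (forall p, ~ cball (crd x x) r p -> f p = 0) ->
  smooth (chart_ext x f).
Proof.
move=> Cf rx f0 y k; apply: Ck_on_loc => p ip.
have [dx|ndx] := pselect (dom x (pnt y p)).
  exists (overlap y x); first exact/overlapP.
  apply: (@Ck_on_eq _ _ _ _ _ (f \o (crd x \o pnt y) : 'rV[R]_D -> R^o)).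
  - exact: open_overlap.
  - by move=> q /overlapP[_ dq] /=; rewrite chart_extE.
  - by apply: Cf; [exact: open_overlap|exact: transition_smooth].
have oK : open (~` chart_ball x r).
  by rewrite openC; exact: chart_ball_closed.
exists [set q | img y q /\ ~ chart_ball x r (pnt y q)].
  split=> // -[q /rx iq qp]; apply: ndx; rewrite -qp.
  by have [] := imgP iq.
apply: (@Ck_on_eq _ _ _ _ _ (cst 0 : 'rV[R]_D -> R^o)).
- exact: open_point_preimage oK.
- by move=> q [_ nq] /=; rewrite (chart_ext_out rx f0).
- exact: Ck_on_cst.
Qed.

(** Norms on row vectors are sup norms, so a product over the coordinates is supported in a ball. *)
Definition box_bump (c : 'rV[R]_D) (r : R) (p : 'rV[R]_D) : R :=
  \prod_(k < D) (sbump (r - (p 0 k - c 0 k)) * sbump (r + (p 0 k - c 0 k))).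

Lemma Ck_on_box_bump c r k (U : set 'rV[R]_D) (t : 'rV[R]_D -> 'rV[R]_D) :
  open U -> Ck_on k U t -> Ck_on k U ((box_bump c r \o t) : 'rV[R]_D -> R^o).
Proof.
move=> oU Ct; apply: Ck_on_prod => // i.
have Ci := Ck_on_coord i oU Ct.
have Caff (a b : R) : Ck_on k U ((fun p => sbump (a + b * t p 0 i)) : 'rV[R]_D -> R^o).
  apply: (@Ck_on_comp1 _ _ _ _ (sbump : R^o -> R^o)) => //.
    by move=> j; exact: Ck_on_sbump.
  apply: (@Ck_on_comp1 _ _ _ _ ((fun s => a + b * s) : R^o -> R^o)) => //.
  by move=> j; exact: Ck_on_affine.
apply: (@Ck_on_eq _ _ _ _ _ ((fun p => sbump ((r + c 0 i) + (-1) * t p 0 i) *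
   sbump ((r - c 0 i) + 1 * t p 0 i)) : 'rV[R]_D -> R^o)) => //.
  move=> p _; congr (sbump _ * sbump _); rewrite ?mulN1r ?mul1r ?opprB.
    by rewrite addrA.
  by rewrite addrAC addrA.
by apply: Ck_onM.
Qed.

Lemma box_bump_ge0 c r p : 0 <= box_bump c r p.
Proof. by apply: prodr_ge0 => k _; rewrite mulr_ge0// sbump_ge0. Qed.

Lemma box_bump_center c r : 0 < r -> 0 < box_bump c r c.
Proof.
move=> r0; apply: prodr_gt0 => k _.
by rewrite subrr subr0 addr0 mulr_gt0// sbump_gt0.
Qed.

Lemma box_bump_out c r p : 0 < r -> ~ cball c r p -> box_bump c r p = 0.
Proof.
move=> r0 /negP; rewrite -ltNge => rp.
have [k rk] : exists k, r < `|p 0 k - c 0 k|.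
  apply: contrapT => /forallNP H; move: rp; apply/negP; rewrite -leNgt.
  rewrite /Num.Def.normr/= mx_normrE bigmax_le// ?ltW// => -[i k] _.
  by rewrite (ord1 i) !mxE leNgt; apply/negP; exact: H.
rewrite /box_bump (bigD1 k)//=.
have [h|h] := leP 0 (p 0 k - c 0 k).
  by rewrite [sbump (r - _)]sbump_eq0 ?mul0r// subr_le0 ltW// -(ger0_norm h).
rewrite [X in _ * X * _]sbump_eq0 ?mulr0 ?mul0r//.
by move: rk; rewrite (ltr0_norm h) => rk; lra.
Qed.

(** A coordinate of the chart made global. At the center its differential is a positive multiple of
    the coordinate form, so these functions separate tangent vectors. *)
Definition coord_bump (c : 'rV[R]_D) (r : R) (l : 'I_D) (p : 'rV[R]_D) : R :=
  (p 0 l - c 0 l) * box_bump c r p.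

Lemma Ck_on_coord_bump c r l k (U : set 'rV[R]_D) (t : 'rV[R]_D -> 'rV[R]_D) :
  open U -> Ck_on k U t -> Ck_on k U ((coord_bump c r l \o t) : 'rV[R]_D -> R^o).
Proof.
move=> oU Ct; apply: Ck_onM => //; last exact: Ck_on_box_bump.
apply: (@Ck_onD _ _ R^o) => //; [exact: Ck_on_coord|exact: Ck_on_cst].
Qed.

Lemma coord_bump_out c r l p : 0 < r -> ~ cball c r p -> coord_bump c r l p = 0.
Proof. by move=> r0 rp; rewrite /coord_bump box_bump_out// mulr0. Qed.

Lemma smooth_box_bump x r : 0 < r -> cball (crd x x) r `<=` img x ->
  smooth (chart_ext x (box_bump (crd x x) r)).
Proof.
move=> r0 rx; apply: smooth_chart_ext rx _; last by move=> p; exact: box_bump_out.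
by move=> k U t; exact: Ck_on_box_bump.
Qed.

Lemma smooth_coord_bump x r l : 0 < r -> cball (crd x x) r `<=` img x ->
  smooth (chart_ext x (coord_bump (crd x x) r l)).
Proof.
move=> r0 rx; apply: smooth_chart_ext rx _; last by move=> p; exact: coord_bump_out.
by move=> k U t; exact: Ck_on_coord_bump.
Qed.

Lemma chart_ext_near x f :
  \forall p \near crd x x, (chart_ext x f \o pnt x) p = f p.
Proof.
apply: filterS (nbhs_img (img_center x)) => p /imgP[dp pK].
by rewrite /= chart_extE// pK.
Qed.

Lemma derive_mx_coord n (c v : 'rV[R]_n) l :
  is_derive c v ((fun q => q 0 l) : 'rV[R]_n -> R^o) (v 0 l).
Proof.
have H : derivable (id : 'rV[R]_n -> 'rV[R]_n) c v by exact: derivable_id.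
split; first by have /derivable_mxP := H; exact.
by have := derive_mx H; rewrite derive_id => /rowP/(_ l); rewrite mxE => <-.
Qed.

Lemma dphi_coord_bump x r l v : cball (crd x x) r `<=` img x ->
  dphi (chart_ext x (coord_bump (crd x x) r l)) x v =
  v 0 l * box_bump (crd x x) r (crd x x).
Proof.
move=> rx; rewrite /dphi (near_eq_derive (W := R^o) v (chart_ext_near x _)).
have db : derivable (box_bump (crd x x) r : 'rV[R]_D -> R^o) (crd x x) v.
  have C : Ck_on 1 setT (box_bump (crd x x) r : 'rV[R]_D -> R^o).
    apply: (@Ck_on_box_bump _ _ _ _ id) => //; first exact: openT.
    split=> [p _|w]; first exact: cvg_id.
    split=> [p _|]; first exact: derivable_id.
    have -> : 'D_w (id : 'rV[R]_D -> 'rV[R]_D) = cst w.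
      by apply/funext => p; rewrite derive_id.
    exact: Ck_on_cst.
  by have [+ _] := Ck_onSP v C; apply.
have [dl El] := derive_mx_coord (crd x x) v l.
have dl' : derivable ((fun p => p 0 l - crd x x 0 l) : 'rV[R]_D -> R^o) (crd x x) v.
  by apply: derivableB => //; exact: derivable_cst.
rewrite /coord_bump (deriveM dl' db) subrr scale0r add0r.
rewrite (_ : 'D_v _ _ = v 0 l) 1?mulrC//.
by rewrite deriveB// ?derive_cst ?subr0//; exact: derivable_cst.
Qed.

End Ext.

(** * Regularity of the frame coefficients of coordinate vectors *)

Section CkDet.
Context {R : realType} {V : normedModType R}.

Lemma Ck_on_det n k (U : set V) (A : V -> 'M[R]_n) : open U ->
  (forall i j, Ck_on k U ((fun p => A p i j) : V -> R^o)) ->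
  Ck_on k U ((fun p => \det (A p)) : V -> R^o).
Proof.
move=> oU CA; apply: (@Ck_on_sum _ _ R^o) => // s.
apply: Ck_onM => //; first exact: Ck_on_cst.
by apply: Ck_on_prod.
Qed.

Lemma Ck_on_invmx n k (U : set V) (A : V -> 'M[R]_n) i j : open U ->
  (forall p, U p -> A p \in unitmx) ->
  (forall i j, Ck_on k U ((fun p => A p i j) : V -> R^o)) ->
  Ck_on k U ((fun p => invmx (A p) i j) : V -> R^o).
Proof.
move=> oU uA CA.
apply: (@Ck_on_eq _ _ _ _ _ ((fun p => (\det (A p))^-1 *
   ((-1) ^+ (j + i) * \det (row' j (col' i (A p))))) : V -> R^o)) => //.
  by move=> p Up; rewrite /invmx uA// !mxE.
apply: Ck_onM => //.
  apply: Ck_onV => //; last exact: Ck_on_det.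
  by move=> p /uA; rewrite unitmxE unitfE.
apply: Ck_onM => //; first exact: Ck_on_cst.
apply: Ck_on_det => // a b.
by apply: Ck_on_eq (CA (lift j a) (lift i b)) => // p _; rewrite !mxE.
Qed.

End CkDet.

Section ChartCoef.
Context {R : realType} {D : nat} {M : manifold R D}.
Variables (g : metric M) (E : 'I_D -> M -> 'rV[R]_D).
Hypothesis EF : orthonormal_frame g E.
Implicit Types (phi psi : M -> R) (x y z : M) (p v w : 'rV[R]_D).

(** Smoothness of the fields [E i] is only known through their action on smooth functions. Applied
    to cut-off coordinates [f l] centered at [z0] they give a matrix [G] of smooth functions, which
    at [z0] is a positive multiple of the frame matrix and is hence invertible nearby. The
    derivatives of the [f l] along [w] are the unknown row times [G], and Cramer's formula solves
    this system smoothly. *)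
Lemma Ck_on_chart_coef k x w j :
  Ck_on k (img x) ((fun p => chart_coef E x p w 0 j) : 'rV[R]_D -> R^o).
Proof.
apply: Ck_on_loc => p0 ip0; set z0 := pnt x p0.
have [r r0 rx] := nbhs_cball (nbhs_img (img_center z0)).
pose f l := chart_ext z0 (coord_bump (crd z0 z0) r l).
have sf l : smooth (f l) by exact: smooth_coord_bump.
pose G (q : M) : 'M[R]_D := \matrix_(i, l) vder (E i) (f l) q.
have sG i l : smooth (fun q => G q i l).
  move=> y k'; apply: Ck_on_eq (smooth_field_frame EF i (sf l) y k').
    exact: open_img.
  by move=> p _ /=; rewrite mxE.
have Gz0 : G z0 = box_bump (crd z0 z0) r (crd z0 z0) *: frame_mx E z0.
  by apply/matrixP => i l; rewrite !mxE /vder dphi_coord_bump// mulrC.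
have sdet : smooth (fun q => \det (G q)).
  move=> y k'; apply: (Ck_on_det (A := G \o pnt y)); first exact: open_img.
  by move=> i l; exact: sG.
pose A : set M := [set q | \det (G q) != 0].
have oA : open A.
  have -> : A = (fun q => \det (G q)) @^-1` [set t | t != 0] by [].
  apply: open_comp; last exact: open_neq.
  by move=> q _; exact: continuous_smooth.
exists [set q | img x q /\ A (pnt x q)].
  split=> //; rewrite /A/= -/z0 Gz0 detZ mulf_neq0// ?expf_neq0//.
    by rewrite gt_eqF// box_bump_center.
  by have := frame_mx_unit EF z0; rewrite unitmxE unitfE.
have oU := open_point_preimage (x := x) oA.
have uG p : img x p /\ A (pnt x p) -> G (pnt x p) \in unitmx.
  by move=> [_ Ap]; rewrite unitmxE unitfE.
have subU : [set q | img x q /\ A (pnt x q)] `<=` img x by move=> q [].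
apply: (@Ck_on_eq _ _ _ _ _ ((fun p => \sum_l
    'D_w ((f l \o pnt x) : 'rV[R]_D -> R^o) p * invmx (G (pnt x p)) l j)
    : 'rV[R]_D -> R^o)) => //.
  move=> p Up; have ip := subU _ Up.
  have E1 : (\row_l 'D_w ((f l \o pnt x) : 'rV[R]_D -> R^o) p) =
      chart_coef E x p w *m G (pnt x p).
    apply/rowP => l; rewrite !mxE (derive_chart_frame EF)//.
    by apply: eq_bigr => i _; congr (_ * _); rewrite mxE.
  rewrite -[chart_coef E x p w](mulmxK (uG _ Up)) -E1 mxE.
  by apply: eq_bigr => l _; rewrite mxE.
apply: (@Ck_on_sum _ _ R^o) => // l; apply: Ck_onM => //.
  by have [_] := Ck_onSP w (smoothE (sf l) x k.+1); exact: Ck_on_sub.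
apply: Ck_on_invmx => // i l'.
exact: Ck_on_sub (smoothE (sG i l') x k).
Qed.

Lemma continuous_chart_coef x w j p : img x p ->
  {for p, continuous (fun p => chart_coef E x p w 0 j)}.
Proof. exact: Ck_on_cont (Ck_on_chart_coef 0 x w j). Qed.

End ChartCoef.

Section Support.
Context {R : realType} {D : nat} {M : manifold R D}.
Variable (E : 'I_D -> M -> 'rV[R]_D).
Hypothesis sE : forall d, smooth_field (E d).
Implicit Types (phi psi : M -> R) (x y z : M).

Lemma vder_out V phi (K : set M) z : closed K -> (forall z, ~ K z -> phi z = 0) ->
  ~ K z -> vder V phi z = 0.
Proof.
move=> cK phi0 nK; rewrite -(vder_cst V 0 z); apply: eq_near_vder.
have : nbhs z (~` K) by apply: open_nbhs_nbhs; split => //; rewrite openC.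
by apply: filterS => q nq; rewrite phi0.
Qed.

Lemma frame_der_out phi (K : set M) s z : closed K ->
  (forall z, ~ K z -> phi z = 0) -> ~ K z -> frame_der E s phi z = 0.
Proof.
move=> cK phi0; elim: s z => [|d s IH] z /=; first exact: phi0.
exact: vder_out.
Qed.

Lemma bounded_compact_support phi (K : set M) : compact K -> continuous phi ->
  (forall z, ~ K z -> phi z = 0) -> exists2 C, 0 < C & forall z, `|phi z| <= C.
Proof.
move=> cK cphi phi0.
have [Kn|] := pselect (K !=set0); last first.
  move=> Kn; exists 1 => // z; rewrite phi0 ?normr0// => Kz; apply: Kn.
  by exists z.
have cn : {within K, continuous (fun z => `|phi z|)}.
  apply: continuous_subspaceT => z.
  by apply: continuous_comp; [exact: cphi|exact: norm_continuous].
have [c Kc H] := compact_EVT_max Kn cK cn.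
exists (`|phi c| + 1) => [|z]; first by rewrite ltr_wpDl.
have [Kz|nKz] := pselect (K z); first by rewrite (le_trans (H z (mem_set Kz)))// lerDl.
by rewrite phi0// normr0 addr_ge0.
Qed.

Lemma bounded_frame_der phi (K : set M) s : compact K -> closed K -> smooth phi ->
  (forall z, ~ K z -> phi z = 0) ->
  exists2 C, 0 < C & forall z, `|frame_der E s phi z| <= C.
Proof.
move=> cK clK sphi phi0; apply: (bounded_compact_support cK).
  by apply: continuous_smooth; exact: smooth_frame_der.
by move=> z; exact: frame_der_out.
Qed.

End Support.

(** * Smooth curves, their arc length and piecewise smooth paths *)

Section Primitive.
Context {R : realType}.
Local Notation mu := (@lebesgue_measure R).

Lemma is_derive_continuous (A : R -> R) (t l : R) :
  is_derive t (1 : R) A l -> {for t, continuous A}.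
Proof.
by move=> [d _]; apply: differentiable_continuous; apply/derivable1_diffP.
Qed.

Lemma ex_primitive (F : R -> R) : continuous F ->
  exists A : R -> R, forall t : R, 0 <= t <= 1 -> is_derive t (1 : R) A (F t).
Proof.
(* Starting at -1, and integrating on [[-1, 2]], makes the points of [[0, 1]] interior, so that the
   derivatives at 0 and 1 are two-sided. *)
move=> cF; exists (fun x => \int[mu]_(t in `[-1, x]) F t) => t /andP[t0 t1].
have iF : mu.-integrable `[-1, 2] (EFin \o F).
  apply: continuous_compact_integrable; first exact: segment_compact.
  exact: continuous_subspaceT.
have t2 : t < 2 by lra.
have tN1 : -1 < t by lra.
have [d1 d2] := continuous_FTC1_closed t2 iF tN1 (cF t).
by split => //; rewrite -derive1E.
Qed.

Lemma Rintegral_primitive (F A : R -> R) (a b : R) : a <= b ->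
  {within `[a, b], continuous F} -> {within `[a, b], continuous A} ->
  (forall t : R, a < t < b -> is_derive t (1 : R) A (F t)) ->
  \int[mu]_(t in `[a, b]) F t = A b - A a.
Proof.
rewrite le_eqVlt => /predU1P[->|ab] cF cA dA.
  by rewrite set_itv1 Rintegral_set1 subrr.
rewrite /Rintegral (@continuous_FTC2 _ F A)//.
- have [cA1 cAl cAr] := (continuous_within_itvP _ ab).1 cA.
  by split => // t; rewrite in_itv/= => /dA[].
- by move=> t; rewrite in_itv/= => /dA[_ <-]; rewrite derive1E.
Qed.

Lemma Rintegral01_primitive (F A : R -> R) : continuous F ->
  (forall t : R, 0 <= t <= 1 -> is_derive t (1 : R) A (F t)) ->
  \int[mu]_(t in `[0, 1]) F t = A 1 - A 0.
Proof.
move=> cF dA; apply: Rintegral_primitive => //.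
- exact: continuous_subspaceT.
- apply: derivable_within_continuous => t; rewrite in_itv/= => /dA[]//.
- by move=> t /andP[t0 t1]; apply: dA; rewrite !ltW.
Qed.

Lemma Rintegral01_affine (F A : R -> R) (a b : R) : continuous F -> 0 <= b ->
  0 <= a -> a + b <= 1 ->
  (forall t : R, 0 <= t <= 1 -> is_derive t (1 : R) A (F t)) ->
  \int[mu]_(t in `[0, 1]) (b * F (a + b * t)) = A (a + b) - A a.
Proof.
move=> cF b0 a0 ab1 dA.
have caff : continuous (fun t : R => a + b * t).
  move=> t; apply: cvgD; first exact: cvg_cst.
  by apply: cvgMl_tmp; exact: cvg_id.
have := @Rintegral01_primitive (fun t => b * F (a + b * t)) (fun t => A (a + b * t)).
rewrite mulr1 mulr0 addr0; apply.
- move=> t; apply: cvgMl_tmp.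
  by apply: (@continuous_comp _ _ _ (fun t : R => a + b * t) F); [exact: caff|exact: cF].
- move=> t /andP[t0 t1].
  have H1 : is_derive t (1 : R) (fun t : R => a + b * t) b.
    have H : is_derive t (1 : R) (cst a + b \*: (id : R -> R)) (0 + b *: 1).
      exact: is_deriveD.
    by apply: (is_derive_eq H); rewrite add0r [LHS]mulr1.
  have H2 : is_derive (a + b * t) (1 : R) A (F (a + b * t)).
    apply: dA; rewrite addr_ge0 ?mulr_ge0//= (le_trans _ ab1)// lerD2l.
    by rewrite ler_piMr.
  apply: (is_derive_eq (@is_derive1_comp _ A (fun t : R => a + b * t) _ _ _ H2 H1)).
  by rewrite mulrC.
Qed.

Lemma Rintegral01_reverse (F A : R -> R) : continuous F ->
  (forall t : R, 0 <= t <= 1 -> is_derive t (1 : R) A (F t)) ->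
  \int[mu]_(t in `[0, 1]) F (1 + (-1) * t) = A 1 - A 0.
Proof.
move=> cF dA.
have caff : continuous (fun t : R => 1 + (-1) * t).
  move=> t; apply: cvgD; first exact: cvg_cst.
  by apply: cvgMl_tmp; exact: cvg_id.
have := @Rintegral01_primitive (fun t => F (1 + (-1) * t)) (fun t => - A (1 + (-1) * t)).
rewrite mulr1 subrr mulr0 addr0 opprK addrC; apply.
- move=> t.
  by apply: (@continuous_comp _ _ _ (fun t : R => 1 + (-1) * t) F); [exact: caff|exact: cF].
- move=> t /andP[t0 t1].
  have H1 : is_derive t (1 : R) (fun t : R => 1 + (-1) * t) (-1).
    have H : is_derive t (1 : R) (cst 1 + (-1) \*: (id : R -> R)) (0 + (-1) *: 1).
      exact: is_deriveD.
    by apply: (is_derive_eq H); rewrite add0r [LHS]mulr1.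
  have H2 : is_derive (1 + (-1) * t) (1 : R) A (F (1 + (-1) * t)).
    by apply: dA; apply/andP; split; lra.
  have H3 := @is_derive1_comp _ A (fun t : R => 1 + (-1) * t) _ _ _ H2 H1.
  by apply: (is_derive_eq (is_deriveN H3)); rewrite mulrN1 opprK.
Qed.

End Primitive.

Section Curve.
Context {R : realType} {D : nat} {M : manifold R D}.
Variables (g : metric M) (E : 'I_D -> M -> 'rV[R]_D).
Hypothesis EF : orthonormal_frame g E.
Implicit Types (phi psi : M -> R) (x y z : M) (p v w : 'rV[R]_D) (c : R -> M).

Lemma curve_chart_derivable c x t : smooth_curve c -> dom x (c t) ->
  derivable ((crd x \o c) : R^o -> 'rV[R]_D) t (1 : R^o).
Proof.
by move=> [_ /(_ x 1%N) C] dx; have [+ _] := Ck_onSP (1 : R^o) C; apply.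
Qed.

Lemma near_curve_dom c x t : smooth_curve c -> dom x (c t) ->
  \forall s \near t, dom x (c s).
Proof. by move=> [cc _] dx; apply: cc; exact: nbhs_dom. Qed.

Definition fvel c t : 'rV[R]_D := fcoord E (c t) (velocity c t).

Lemma is_derive_curve phi c t : smooth phi -> smooth_curve c ->
  is_derive (t : R) (1 : R) (phi \o c) (\sum_i fvel c t 0 i * vder (E i) phi (c t)).
Proof.
move=> sphi sc; set z := c t.
rewrite -(dphi_frame EF)//.
apply: (@near_eq_is_derive R R R ((phi \o pnt z) \o (crd z \o c))).
  by apply: filterS (near_curve_dom sc (dom_center z)) => s ds /=; rewrite coordK.
have dc := curve_chart_derivable sc (dom_center z).
have df : differentiable ((phi \o pnt z) : 'rV[R]_D -> R^o) ((crd z \o c) t).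
  by apply: smooth_differentiable => //; exact: img_center.
exact: (is_derive_diff_comp dc df).
Qed.

(** The velocity is defined in the chart of the moving point [c t]. In a fixed chart it becomes a
    function whose continuity in [t] can be proved. *)
Lemma fvel_chart c x t : smooth_curve c -> dom x (c t) ->
  fvel c t = chart_coef E x (crd x (c t))
    ('D_(1 : R^o) ((crd x \o c) : R^o -> 'rV[R]_D) t).
Proof.
move=> sc dx; rewrite /chart_coef coordK// /fvel; congr (fcoord E _ _).
set z := c t; set p := crd x z.
have ip : img x p by exact: img_coord.
have pz : pnt x p = z by exact: coordK.
have op : overlap x z p by apply/overlapP; split=> //; rewrite pz; exact: dom_center.
have dc := curve_chart_derivable sc dx.
have dz := curve_chart_derivable sc (dom_center z).
rewrite /tvec pz /velocity -/z.
apply/rowP => j; rewrite derive_mx//.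
rewrite derive_mx; last exact: transition_derivable.
rewrite !mxE.
have df : differentiable ((fun q => (crd z \o pnt x) q 0 j) : 'rV[R]_D -> R^o)
    ((crd x \o c) t).
  apply: C1_differentiable (@open_overlap _ _ _ x z) op _.
  apply: Ck_on_coord; [exact: open_overlap|exact: transition_smooth].
have [_ <-] := is_derive_diff_comp dc df.
apply: (@near_eq_derive R R R).
by apply: filterS (near_curve_dom sc dx) => s ds /=; rewrite coordK.
Qed.

Lemma continuous_fvel c j : smooth_curve c -> continuous (fun t => fvel c t 0 j).
Proof.
move=> sc t0; set x := c t0.
pose w t := 'D_(1 : R^o) ((crd x \o c) : R^o -> 'rV[R]_D) t.
have cw : {for t0, continuous w}.
  have [_ /(_ x 1%N) C] := sc; have [_ C0] := Ck_onSP (1 : R^o) C.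
  by apply: (Ck_on_cont C0); exact: dom_center.
have cp : {for t0, continuous (crd x \o c)}.
  apply: continuous_comp; first by have [cc _] := sc; exact: cc.
  exact/continuous_coord/dom_center.
pose G t := \sum_l w t 0 l * chart_coef E x (crd x (c t)) (delta_mx 0 l) 0 j.
have cG : {for t0, continuous G}.
  apply: (@cvg_sumr _ _ (nbhs t0) (nbhs_filter t0) R^o) => l.
  have cwl : {for t0, continuous (fun t => w t 0 l)} by exact: coord_continuous_at.
  apply: cvgM; first exact: cwl.
  apply: (@continuous_comp _ _ _ (crd x \o c)
    (fun p => chart_coef E x p (delta_mx 0 l) 0 j)) => //.
  exact/(continuous_chart_coef EF)/img_center.
have H : \forall t \near t0, fvel c t 0 j = G t.
  apply: filterS (near_curve_dom sc (dom_center x)) => t dt.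
  rewrite (fvel_chart sc dt) {1}(row_sum_delta ('D_1 (crd x \o c) t)).
  rewrite chart_coef_linear ?summxE//; last exact: img_coord.
  by apply: eq_bigr => l _; rewrite mxE.
rewrite /continuous_at (nbhs_singleton H).
apply: cvg_trans cG; apply: near_eq_cvg.
by apply: filterS H => t ->.
Qed.

Definition speed c t : R := Num.sqrt (bilin g (c t) (velocity c t) (velocity c t)).

Lemma speedE c t : speed c t = Num.sqrt (\sum_i fvel c t 0 i ^+ 2).
Proof. by rewrite /speed (bilin_fcoord EF). Qed.

Lemma continuous_speed c : smooth_curve c -> continuous (speed c).
Proof.
move=> sc t.
have -> : speed c = (fun t => Num.sqrt (\sum_i fvel c t 0 i ^+ 2)).
  by apply/funext => s; exact: speedE.
apply: (@continuous_comp _ _ _ (fun t => \sum_i fvel c t 0 i ^+ 2) Num.sqrt).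
  apply: (@cvg_sumr _ _ (nbhs t) (nbhs_filter t) R^o) => i.
  by rewrite expr2; apply: cvgM; exact: continuous_fvel.
exact: sqrt_continuous.
Qed.

Lemma fcoord_le z v i : `|fcoord E z v 0 i| <= Num.sqrt (bilin g z v v).
Proof.
rewrite (bilin_fcoord EF) -sqrtr_sqr ler_wsqrtr// (bigD1 i)//= lerDl.
by apply: sumr_ge0 => k _; exact: sqr_ge0.
Qed.

End Curve.

Lemma derive_scale1 {R : realType} {W : normedModType R} (f : R -> W) (s b : R) :
  derivable f s 1 -> 'D_b f s = b *: 'D_1 f s.
Proof.
move=> /derivable1_diffP df; rewrite !deriveE//.
transitivity ('d f s (b *: (1 : R))); first by rewrite [b *: _]mulr1.
by rewrite linearZ.
Qed.

Lemma sum_rcons {R : realType} {T : Type} (len : T -> R) n (cs : nat -> T) c :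
  \sum_(i < n.+1) len (if (i < n)%N then cs i else c) = \sum_(i < n) len (cs i) + len c.
Proof.
rewrite big_ord_recr/= ltnn; congr (_ + _).
by apply: eq_bigr => i _; rewrite ltn_ord.
Qed.

Section Path.
Context {R : realType} {D : nat} {M : manifold R D}.
Variables (g : metric M) (E : 'I_D -> M -> 'rV[R]_D).
Hypothesis EF : orthonormal_frame g E.
Implicit Types (phi psi : M -> R) (x y z : M) (p v w : 'rV[R]_D) (c : R -> M).

Local Notation speed := (speed g).
Local Notation fvel := (fvel E).

Lemma curve_length_primitive c (A : R -> R) : smooth_curve c ->
  (forall t : R, 0 <= t <= 1 -> is_derive t (1 : R) A (speed c t)) ->
  curve_length g c = A 1 - A 0.
Proof.
by move=> sc dA; apply: Rintegral01_primitive => //; exact: (continuous_speed EF).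
Qed.

Lemma ex_speed_primitive c : smooth_curve c ->
  exists A : R -> R, forall t : R, 0 <= t <= 1 -> is_derive t (1 : R) A (speed c t).
Proof. by move=> sc; apply: ex_primitive; exact: (continuous_speed EF). Qed.

Lemma curve_length_ge0 c : 0 <= curve_length g c.
Proof. by apply: Rintegral_ge0 => t _; exact: sqrtr_ge0. Qed.

Lemma smooth_curve_affine c a b : smooth_curve c ->
  smooth_curve (fun t => c (a + b * t)).
Proof.
move=> [cc Cc].
have ca : continuous (fun t : R => a + b * t).
  move=> t; apply: cvgD; first exact: cvg_cst.
  by apply: cvgMl_tmp; exact: cvg_id.
split.
  by move=> t; apply: (@continuous_comp _ _ _ (fun t : R => a + b * t) c);
    [exact: ca|exact: cc].
move=> x k.
have oU : open (c @^-1` dom x).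
  by apply: open_comp => [t _|]; [exact: cc|exact: dom_open].
apply: Ck_on_row.
  by apply: (open_comp (f := fun t : R => a + b * t)) oU => t _; exact: ca.
move=> i.
have Ci := Ck_on_coord i oU (Cc x k).
have Cl j : Ck_on j setT ((fun t => 0 + b * t) : R^o -> R^o) by exact: Ck_on_affine.
have := @Ck_on_line R R^o k _ _ ((fun t => 0 + b * t) : R^o -> R^o) (a : R^o) (1 : R^o)
  oU Cl Ci.
have E1 : (fun t : R => a + b * t) = (fun t : R => a + (0 + b * t) *: (1 : R^o)).
  by apply/funext => t; rewrite add0r /GRing.scale/= mulr1.
have -> : (fun t : R^o => (crd x \o (fun t => c (a + b * t))) t 0 i) =
   (fun t : R^o => (crd x \o c) (a + (0 + b * t) *: (1 : R^o)) 0 i).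
  by apply/funext => t /=; rewrite -[in RHS](congr1 (fun h => h t) E1).
by apply: Ck_on_sub => t /=; rewrite -(congr1 (fun h => h t) E1).
Qed.

Lemma velocity_affine c a b t : smooth_curve c ->
  velocity (fun t => c (a + b * t)) t = b *: velocity c (a + b * t).
Proof.
move=> sc; rewrite /velocity; set z := c (a + b * t).
have H : is_derive t (1 : R) (fun t : R => a + b * t) b.
  have H : is_derive t (1 : R) (cst a + b \*: (id : R -> R)) (0 + b *: 1).
    exact: is_deriveD.
  by apply: (is_derive_eq H); rewrite add0r [LHS]mulr1.
have dz := curve_chart_derivable sc (dom_center z).
have fz : differentiable ((crd z \o c) : R -> 'rV[R]_D) (a + b * t).
  exact/derivable1_diffP.
have [dl El] := H.
have [_] := is_derive_diff_comp dl fz.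
by rewrite El => E1; exact: etrans E1 (derive_scale1 b dz).
Qed.

Lemma speed_affine c a b t : smooth_curve c ->
  speed (fun t => c (a + b * t)) t = `|b| * speed c (a + b * t).
Proof.
move=> sc; rewrite /speed velocity_affine//.
rewrite /bilin -scalemxAl -scalemxAl linearZ/= -scalemxAr !mxE mulrA -expr2.
by rewrite sqrtrM ?sqr_ge0// sqrtr_sqr.
Qed.

Lemma curve_length_affine c (A : R -> R) a b : smooth_curve c ->
  0 <= a -> 0 <= b -> a + b <= 1 ->
  (forall t : R, 0 <= t <= 1 -> is_derive t (1 : R) A (speed c t)) ->
  curve_length g (fun t => c (a + b * t)) = A (a + b) - A a.
Proof.
move=> sc a0 b0 ab dA; rewrite -(Rintegral01_affine (continuous_speed EF sc) b0 a0 ab dA).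
apply: eq_Rintegral => t _; rewrite -/(Defs.velocity _ _) -/(speed _ t).
by rewrite -[LHS]/(speed (fun t => c (a + b * t)) t) speed_affine// ger0_norm.
Qed.

Lemma curve_length_reverse c : smooth_curve c ->
  curve_length g (fun t => c (1 + (-1) * t)) = curve_length g c.
Proof.
move=> sc; have [A dA] := ex_speed_primitive sc.
rewrite (curve_length_primitive sc dA).
rewrite -(Rintegral01_reverse (continuous_speed EF sc) dA).
apply: eq_Rintegral => t _.
by rewrite -[LHS]/(speed (fun t => c (1 + (-1) * t)) t) speed_affine// normrN1 mul1r.
Qed.

(** [dist g x y] is by conversion the infimum of this relation. *)
Definition path_len x y (l : R) : Prop :=
  exists (n : nat) (p : nat -> M) (c : nat -> R -> M),
    [/\ p 0%N = x, p n = y,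
        forall i, (i < n)%N ->
          [/\ smooth_curve (c i), c i 0 = p i & c i 1 = p i.+1]
      & l = \sum_(i < n) curve_length g (c i)].

Lemma path_len0 x : path_len x x 0.
Proof. by exists 0%N, (fun=> x), (fun=> fun=> x); split=> //; rewrite big_ord0. Qed.

Lemma path_len_rcons x y l c : path_len x y l -> smooth_curve c -> c 0 = y ->
  path_len x (c 1) (l + curve_length g c).
Proof.
move=> [n [p [cs [p0 pn H ->]]]] sc c0.
exists n.+1, (fun i => if (i <= n)%N then p i else c 1),
  (fun i => if (i < n)%N then cs i else c); split=> //.
- by rewrite ltnn.
- move=> i; rewrite ltnS leq_eqVlt => /predU1P[->|lin].
    by rewrite ltnn eqxx pn.
  by rewrite lin orbT; have [] := H i lin.
- exact/esym/sum_rcons.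
Qed.

(** Induction by appending a last curve: facts on paths are reduced to one smooth curve. *)
Lemma path_len_ind (Q : M -> M -> R -> Prop) :
  (forall x, Q x x 0) ->
  (forall x y l c, Q x y l -> smooth_curve c -> c 0 = y ->
     Q x (c 1) (l + curve_length g c)) ->
  forall x y l, path_len x y l -> Q x y l.
Proof.
move=> Q0 QS x y l [n [p [c [<- <- H ->]]]] {x y l}.
elim: n H => [|n IH] H; first by rewrite big_ord0.
rewrite big_ord_recr/=; have [sc c0 <-] := H n (leqnn _).
by apply: QS => //; rewrite c0; apply: IH => i lin; apply: H; rewrite ltnW.
Qed.

Lemma path_len_curve c : smooth_curve c -> path_len (c 0) (c 1) (curve_length g c).
Proof.
by move=> sc; rewrite -[curve_length g c]add0r; apply: path_len_rcons => //;
  exact: path_len0.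
Qed.

Lemma path_len_cat x y z a b : path_len x y a -> path_len y z b -> path_len x z (a + b).
Proof.
move=> H1 H2; move: y z b H2 x a H1; apply: path_len_ind.
  by move=> x y a; rewrite addr0.
by move=> y y' l c IH sc c0 x a /IH; rewrite addrA => /path_len_rcons; apply.
Qed.

Lemma path_len_rev x y l : path_len x y l -> path_len y x l.
Proof.
move: x y l; apply: path_len_ind; first exact: path_len0.
move=> x y l c IH sc c0; rewrite addrC; apply: path_len_cat IH.
have := path_len_curve (smooth_curve_affine 1 (-1) sc).
by rewrite curve_length_reverse// mulr0 addr0 mulr1 subrr c0.
Qed.

Lemma path_len_ge0 x y l : path_len x y l -> 0 <= l.
Proof.
by move=> [n [p [c [_ _ _ ->]]]]; apply: sumr_ge0 => i _; exact: curve_length_ge0.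
Qed.

(** The given path is repeated in the conclusion because the induction needs it for the part that is
    already built. *)
Lemma path_len_split x z l : path_len x z l -> path_len x z l /\
  forall a, 0 <= a <= l -> exists y, path_len x y a /\ path_len y z (l - a).
Proof.
move: x z l; apply: path_len_ind.
  move=> x; split; first exact: path_len0.
  move=> a /andP[a0 a1]; have -> : a = 0 by apply/eqP; rewrite eq_le a0 a1.
  by exists x; rewrite subrr; split; exact: path_len0.
move=> x y l c [lxy IH] sc c0; split; first exact: path_len_rcons lxy sc c0.
move=> a /andP[a0 al].
have [al'|/ltW la] := leP a l.
  have [|y' [H1 H2]] := IH a; first by rewrite a0.
  by exists y'; split=> //; rewrite addrAC; exact: path_len_rcons H2 sc c0.
have [A dA] := ex_speed_primitive sc.
have lc := curve_length_primitive sc dA.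
have cA : {within `[0, 1], continuous A}.
  by apply: derivable_within_continuous => t; rewrite in_itv/= => /dA[].
(* The cut falls in the last curve, at the point where the arc length [A] has grown by [a - l]. *)
have [|s] := @IVT R A 0 1 (A 0 + (a - l)) ler01 cA.
  have A01 : A 0 <= A 1 by rewrite -subr_ge0 -lc curve_length_ge0.
  rewrite min_l// max_r// lerDl subr_ge0 la/= -lerBrDl -lc.
  by rewrite lerBlDl.
rewrite in_itv/= => /andP[s0 s1] As.
have s1' : 0 <= 1 - s by rewrite subr_ge0.
exists (c s); split.
  have e0 : 0 + s * 0 = 0 by ring.
  have e1 : 0 + s * 1 = s by ring.
  have := path_len_rcons lxy (smooth_curve_affine 0 s sc).
  rewrite e0 e1 (curve_length_affine sc (lexx 0) s0 _ dA) add0r// As addrAC subrr add0r.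
  by rewrite addrC subrK; apply.
have e0 : s + (1 - s) * 0 = s by ring.
have e1 : s + (1 - s) * 1 = 1 by ring.
have e2 : s + (1 - s) = 1 by ring.
have := path_len_curve (smooth_curve_affine s (1 - s) sc).
rewrite e0 e1 (curve_length_affine sc s0 s1' _ dA) e2// As => H.
have -> : l + curve_length g c - a = A 1 - (A 0 + (a - l)) by rewrite lc; ring.
exact: H.
Qed.

(** With [A] the arc length, [C * A - e * phi] has a nonnegative derivative along a curve for both
    signs [e], so it does not decrease between the end points. *)
Lemma lipschitz_path_len phi (C : R) : smooth phi -> 0 <= C ->
  (forall z v, `|dphi phi z v| <= C * Num.sqrt (bilin g z v v)) ->
  forall x y l, path_len x y l -> `|phi y - phi x| <= C * l.
Proof.
move=> sphi C0 Hphi; apply: path_len_ind; first by move=> x; rewrite subrr normr0 mulr0.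
move=> x y l c IH sc c0.
have [A dA] := ex_speed_primitive sc.
suff H : `|phi (c 1) - phi y| <= C * curve_length g c.
  by rewrite -(subrK (phi y) (phi (c 1))) -addrA (le_trans (ler_normD _ _))//
    mulrDr [leRHS]addrC lerD.
rewrite (curve_length_primitive sc dA) -c0.
have key (e : R) : `|e| = 1 -> e * (phi (c 1) - phi (c 0)) <= C * (A 1 - A 0).
  move=> e1; rewrite -subr_ge0.
  pose h t := C * A t - e * phi (c t).
  have dh (t : R) : 0 <= t <= 1 -> is_derive t (1 : R) h
      (C * speed c t - e * dphi phi (c t) (velocity c t)).
    move=> t01; have H1 := is_derive_curve EF t sphi sc.
    rewrite -(dphi_frame EF)// in H1.
    have H2 := dA t t01.
    have H : is_derive t (1 : R) (C \*: A - e \*: (phi \o c))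
      (C *: speed c t - e *: dphi phi (c t) (velocity c t)).
      by apply: is_deriveB.
    exact: H.
  have [||t t01] := @MVT_segment R h
      (fun t => C * speed c t - e * dphi phi (c t) (velocity c t)) 0 1 ler01.
  - by move=> t; rewrite in_itv/= => /andP[t0 t1]; apply: dh; rewrite !ltW.
  - by apply: derivable_within_continuous => t; rewrite in_itv/= => /dh[].
  rewrite subr0 mulr1 /h => E1.
  have -> : C * (A 1 - A 0) - e * (phi (c 1) - phi (c 0)) =
    C * A 1 - e * phi (c 1) - (C * A 0 - e * phi (c 0)) by ring.
  rewrite E1 subr_ge0 (le_trans (ler_norm _))// normrM e1 mul1r.
  exact: Hphi.
rewrite ler_norml; apply/andP; split.
  by rewrite lerNl -mulN1r; apply: key; rewrite normrN1.
by rewrite -[leLHS]mul1r; apply: key; rewrite normr1.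
Qed.

End Path.

Section Segment.
Context {R : realType} {D : nat} {M : manifold R D}.
Variables (g : metric M) (E : 'I_D -> M -> 'rV[R]_D).
Hypothesis EF : orthonormal_frame g E.
Implicit Types (phi psi : M -> R) (x y z : M) (p v w : 'rV[R]_D) (c : R -> M).

(* The sine keeps the curve, which has to be defined on the whole line, inside
   the chart. *)
Definition chart_segment x p w (t : R) : M := pnt x (p + sin (pi / 2 * t) *: w).

Definition seg_in x p w := forall s : R, `|s| <= 1 -> img x (p + s *: w).

Lemma norm_sin_le1 (t : R) : `|sin t| <= 1.
Proof. by rewrite ler_norml sin_geN1 sin_le1. Qed.

Lemma smooth_chart_segment x p w : seg_in x p w -> smooth_curve (chart_segment x p w).
Proof.
move=> Hw.
have ct : continuous (fun t : R => p + sin (pi / 2 * t) *: w).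
  move=> t; apply: cvgD; first exact: cvg_cst.
  apply: cvgZr_tmp.
  by have := Ck_on_cont (Ck_on_sin (pi / 2) 0 setT) (I : setT t).
have it t : img x (p + sin (pi / 2 * t) *: w) by apply: Hw; exact: norm_sin_le1.
have cc : continuous (chart_segment x p w).
  move=> t; apply: (@continuous_comp _ _ _ (fun t : R => p + sin (pi / 2 * t) *: w) (pnt x)).
    exact: ct.
  exact: continuous_point (it t).
split=> // y k.
have oU : open (chart_segment x p w @^-1` dom y).
  by apply: open_comp => [t _|]; [exact: cc|exact: dom_open].
apply: Ck_on_row => // i.
have Ci := Ck_on_coord i (@open_overlap _ _ _ x y) (@transition_smooth _ _ M x y k).
have Cs j : Ck_on j setT ((fun t => sin (pi / 2 * t)) : R^o -> R^o).
  exact: Ck_on_sin.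
have := Ck_on_line p w (@open_overlap _ _ _ x y) Cs Ci.
by apply: Ck_on_sub => t /= dt; apply/overlapP.
Qed.

Lemma fvel_chart_segment x p w t : seg_in x p w ->
  fvel E (chart_segment x p w) t =
  (pi / 2 * cos (pi / 2 * t)) *: chart_coef E x (p + sin (pi / 2 * t) *: w) w.
Proof.
move=> Hw; have sc := smooth_chart_segment Hw.
have it s : img x (p + sin (pi / 2 * s) *: w) by apply: Hw; exact: norm_sin_le1.
have [dx xK] := imgP (it t).
rewrite (fvel_chart _ sc dx) xK.
have -> : 'D_(1 : R^o) ((crd x \o chart_segment x p w) : R^o -> 'rV[R]_D) t =
    (pi / 2 * cos (pi / 2 * t)) *: w.
  have -> : crd x \o chart_segment x p w = (fun t : R => p + sin (pi / 2 * t) *: w).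
    by apply/funext => s /=; have [_ ->] := imgP (it s).
  have H1 : is_derive t (1 : R) (fun t : R => pi / 2 * t) (pi / 2).
    have H : is_derive t (1 : R) ((pi / 2) \*: (id : R -> R)) ((pi / 2) *: 1).
      exact: is_deriveZ.
    by apply: (is_derive_eq H); rewrite [LHS]mulr1.
  have H2 := @is_derive1_comp _ sin (fun t : R => pi / 2 * t) _ _ _ (is_derive_sin _) H1.
  apply/rowP => j; rewrite derive_mx; last first.
    apply/derivable_mxP => i l; under eq_fun do rewrite !mxE.
    apply: derivableD; first exact: derivable_cst.
    apply: derivableM; last exact: derivable_cst.
    by case: H2.
  rewrite [LHS]mxE.
  have Ef : (fun s : R => (p + sin (pi / 2 * s) *: w) 0 j) =
      (cst (p 0 j) + (w 0 j) \*: (sin \o (fun t : R => pi / 2 * t))) :> (R -> R).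
    by apply/funext => s; rewrite !mxE mulrC.
  rewrite [X in derive X]Ef.
  have E1 : is_derive t (1 : R) (cst (p 0 j) + (w 0 j) \*: (sin \o (fun t : R => pi / 2 * t)))
      (0 + w 0 j *: (cos (pi / 2 * t) * (pi / 2))).
    exact: is_deriveD.
  rewrite add0r in E1; apply: (etrans (@derive_val _ _ _ _ _ _ _ E1)).
  rewrite mxE /GRing.scale/=; ring.
have H := chart_coef_linear E (I := unit) [:: tt] (fun=> pi / 2 * cos (pi / 2 * t)) (fun=> w) (it t).
by rewrite !big_seq1 in H.
Qed.

Lemma length_chart_segment x p w (B : R) : seg_in x p w -> 0 <= B ->
  (forall s : R, `|s| <= 1 ->
     Num.sqrt (\sum_i chart_coef E x (p + s *: w) w 0 i ^+ 2) <= B) ->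
  path_len g (pnt x p) (pnt x (p + w)) (curve_length g (chart_segment x p w)) /\
  curve_length g (chart_segment x p w) <= 2 * B.
Proof.
move=> Hw B0 HB; have sc := smooth_chart_segment Hw; split.
  have := path_len_curve g sc.
  by rewrite /chart_segment mulr0 sin0 scale0r addr0 mulr1 sin_pihalf scale1r.
(* The factor 2 bounds the derivative [pi / 2 * cos (pi / 2 * t)] of the sine parametrization. *)
have sB t : speed g (chart_segment x p w) t <= 2 * B.
  rewrite (speedE EF) fvel_chart_segment//.
  under eq_bigr do rewrite mxE exprMn.
  rewrite -mulr_sumr sqrtrM ?sqr_ge0// sqrtr_sqr ler_pM//; last first.
    by apply: HB; exact: norm_sin_le1.
  rewrite normrM -[leRHS]mulr1 ler_pM//; last first.
    by rewrite ler_norml cos_geN1 cos_le1.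
  rewrite ger0_norm ?divr_ge0 ?pi_ge0//.
  exact: ltW (pihalf_lt2 R).
apply: (@le_trans _ _ (\int[lebesgue_measure]_(t in `[0, 1]) (2 * B))).
  apply: le_Rintegral => //.
  - apply: continuous_compact_integrable; first exact: segment_compact.
    by apply: continuous_subspaceT; exact: (continuous_speed EF).
  - apply: continuous_compact_integrable; first exact: segment_compact.
    by apply: continuous_subspaceT => t; exact: cvg_cst.
  - by move=> t _; exact: sB.
have -> : \int[lebesgue_measure]_(t in `[0, 1]) (2 * B) = 2 * B.
  have m01 : fine (lebesgue_measure (`[0, 1]%classic : set R)) = 1.
    by rewrite lebesgue_measure_itv/= lte_fin ltr01 oppr0 adde0.
  by rewrite Rintegral_cst// m01 mulr1.
by [].
Qed.

End Segment.

Lemma sqrt_sum_sqr_le {R : realType} (n : nat) (a : 'I_n -> R) (m : R) : 0 <= m ->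
  (forall i, `|a i| <= m) -> Num.sqrt (\sum_i a i ^+ 2) <= n%:R * m.
Proof.
move=> m0 H.
have -> : n%:R * m = Num.sqrt ((n%:R * m) ^+ 2) by rewrite sqrtr_sqr ger0_norm// mulr_ge0.
rewrite ler_wsqrtr// exprMn.
apply: (@le_trans _ _ (\sum_(i < n) m ^+ 2)).
  by apply: ler_sum => i _; rewrite -real_normK ?num_real// lerXn2r ?nnegrE.
rewrite sumr_const card_ord -[leLHS]mulr_natl ler_wpM2r ?sqr_ge0//.
by rewrite -natrX ler_nat; case: n {a H} => // n; rewrite expnS expn1 leq_pmulr.
Qed.

Lemma ler_sum_term {R : realType} {I : finType} (F : I -> R) i :
  (forall i, 0 <= F i) -> F i <= \sum_i F i.
Proof. by move=> F0; rewrite (bigD1 i)//= lerDl sumr_ge0. Qed.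

(** * The Riemannian distance and its topology *)

Section Dist.
Context {R : realType} {D : nat} {M : manifold R D}.
Variables (g : metric M) (E : 'I_D -> M -> 'rV[R]_D).
Hypothesis EF : orthonormal_frame g E.
Hypothesis MC : connected [set: M].
Implicit Types (phi psi : M -> R) (x y z : M) (p v w : 'rV[R]_D) (c : R -> M).

Local Notation path_len := (path_len g).
Local Notation dist := (dist g).

Lemma near_path_len x (e : R) : 0 < e ->
  \forall y \near x, exists2 l, l < e & path_len x y l.
Proof.
move=> e0; set c := crd x x.
pose C : R := 1 + \sum_l \sum_j `|chart_coef E x c (delta_mx 0 l) 0 j|.
have C0 : 0 < C by rewrite ltr_pwDl// sumr_ge0// => l _; exact: sumr_ge0.
have nC : \forall p \near c, img x p /\
    forall lj : 'I_D * 'I_D, `|chart_coef E x p (delta_mx 0 lj.1) 0 lj.2| <= C.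
  near=> p; split; first by near: p; exact/nbhs_img/img_center.
  near: p; apply: filter_forall => -[l j] /=.
  have cf := continuous_chart_coef EF (w := delta_mx 0 l) (j := j) (img_center x).
  have H : `|chart_coef E x c (delta_mx 0 l) 0 j| < C.
    apply: (@le_lt_trans _ _ (\sum_l \sum_j `|chart_coef E x c (delta_mx 0 l) 0 j|)).
      apply: le_trans (ler_sum_term l _); last by move=> k; exact: sumr_ge0.
      exact: (@ler_sum_term _ _ (fun j => `|chart_coef E x c (delta_mx 0 l) 0 j|)).
    by rewrite ltrDr.
  have cn : {for c, continuous (fun p => `|chart_coef E x p (delta_mx 0 l) 0 j|)}.
    apply: (@continuous_comp _ _ _ (fun p => chart_coef E x p (delta_mx 0 l) 0 j) Num.norm) => //.
    exact: norm_continuous.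
  by apply: filterS (cvgr_lt _ cn _ H) => p /ltW.
have [r r0 rx] := nbhs_cball nC.
(* Each frame component of [w] is a sum of [D] terms at most [C * |w|], and the Euclidean norm of
   the [D] components costs another factor [D]. *)
pose K : R := D%:R * (D%:R * C).
have K0 : 0 <= K by rewrite !mulr_ge0// ltW.
have seg w : `|w| <= r -> exists2 l, l <= 2 * (K * `|w|) & path_len x (pnt x (c + w)) l.
  move=> wr.
  have sw (s : R) : `|s| <= 1 -> cball c r (c + s *: w).
    move=> s1; rewrite /cball/= addrAC subrr add0r normrZ.
    by rewrite (le_trans _ wr)// ler_piMl.
  have Hw : seg_in x c w by move=> s /sw/rx[].
  have Kw : 0 <= K * `|w| by rewrite mulr_ge0.
  have [s s1|H1 H2] := length_chart_segment EF Hw Kw; last first.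
    by rewrite pointK in H1; exists (curve_length g (chart_segment x c w)).
  have [ip Hp] := rx _ (sw s s1).
  rewrite /K -mulrA; apply: sqrt_sum_sqr_le; first by rewrite !mulr_ge0// ltW.
  move=> j; rewrite [X in chart_coef _ _ _ X](row_sum_delta w) chart_coef_linear// summxE.
  rewrite (le_trans (ler_norm_sum _ _ _))//.
  apply: (@le_trans _ _ (\sum_(l < D) C * `|w|)); last first.
    by rewrite sumr_const card_ord -[leLHS]mulr_natl mulrA.
  apply: ler_sum => l _; rewrite mxE normrM mulrC ler_pM//; first exact: (Hp (l, j)).
  rewrite /Num.Def.normr/= mx_normrE.
  exact: (le_bigmax _ (fun ij => `|w ij.1 ij.2|) (0, l)).
near=> y.
have dy : dom x y by near: y; exact/nbhs_dom/dom_center.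
have yr : `|crd x y - c| < Num.min r (e / (2 * K + 1)).
  near: y.
  have cc : {for x, continuous (fun y => `|crd x y - c|)}.
    apply: (@continuous_comp _ _ _ (fun y => crd x y - c) Num.norm).
      apply: continuousB; last exact: cst_continuous.
      exact/continuous_coord/dom_center.
    exact: norm_continuous.
  have := cvgr_lt _ cc; rewrite /= subrr normr0; apply.
  by rewrite lt_min r0 divr_gt0// ltr_wpDl// mulr_ge0.
move: yr; rewrite lt_min => /andP[yr ye].
have [l le pl] := seg _ (ltW yr).
exists l; last by move: pl; rewrite addrC subrK coordK.
apply: (le_lt_trans le); rewrite ltr_pdivlMr in ye; last first.
  by rewrite ltr_wpDl// mulr_ge0.
apply: le_lt_trans ye; rewrite mulrA mulrC ler_wpM2l// lerDl//.
Unshelve. all: by end_near. Qed.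

(** Unlike in [near_path_len], the constant does not depend on [x]: a frame vector has length 1 at
    the center of the chart, hence at most 2 nearby, and [length_chart_segment] doubles it. The
    maximum argument relies on this uniformity. *)
Lemma near_path_len_frame x i (sg : R) : `|sg| = 1 ->
  \forall s \near (0 : R), exists2 l, l <= 4 * `|s| &
    path_len x (pnt x (crd x x + s *: (sg *: E i x))) l.
Proof.
move=> sg1; set c := crd x x; set e := E i x.
pose N p : R := Num.sqrt (\sum_j chart_coef E x p e 0 j ^+ 2).
have cN : {for c, continuous N}.
  apply: (@continuous_comp _ _ _ (fun p => \sum_j chart_coef E x p e 0 j ^+ 2) Num.sqrt).
    apply: (@cvg_sumr _ _ (nbhs c) (nbhs_filter c) R^o) => j.
    by rewrite expr2; apply: cvgM; exact/(continuous_chart_coef EF)/img_center.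
  exact: sqrt_continuous.
have Nc : N c = 1.
  rewrite /N /e (chart_coef_center EF) (bigD1 i)//= big1 ?addr0; last first.
    by move=> j ji; rewrite mxE (negPf ji) andbF expr0n.
  by rewrite mxE !eqxx expr1n sqrtr1.
have nN : \forall p \near c, img x p /\ N p <= 2.
  near=> p; split; first by near: p; exact/nbhs_img/img_center.
  apply: ltW; near: p; apply: (cvgr_lt _ cN); rewrite Nc; lra.
have [r r0 rx] := nbhs_cball nN.
near=> s.
have sr : `|s *: (sg *: e)| <= r.
  rewrite !normrZ sg1 mul1r (le_trans (_ : _ <= `|s| * (`|e| + 1)))//.
    by rewrite ler_wpM2l// lerDl.
  rewrite -ler_pdivlMr ?ltr_wpDl//; near: s; apply: (@nbhs0_le _ R).
  by rewrite divr_gt0// ltr_wpDl.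
have sw (t : R) : `|t| <= 1 -> cball c r (c + t *: (s *: (sg *: e))).
  move=> t1; rewrite /cball/= addrAC subrr add0r normrZ.
  by rewrite (le_trans _ sr)// ler_piMl.
have Hw : seg_in x c (s *: (sg *: e)) by move=> t /sw/rx[].
have s2 : 0 <= 2 * `|s| by rewrite mulr_ge0.
have [t t1|H1 H2] := length_chart_segment EF Hw s2; last first.
  rewrite pointK in H1; eexists; last exact: H1.
  by rewrite (le_trans H2)// mulrA -natrM.
have [ip Np] := rx _ (sw t t1).
have -> : chart_coef E x (c + t *: (s *: (sg *: e))) (s *: (sg *: e)) =
    (s * sg) *: chart_coef E x (c + t *: (s *: (sg *: e))) e.
  have H := chart_coef_linear E (I := unit) [:: tt] (fun=> s * sg) (fun=> e) ip.
  by rewrite !big_seq1 -scalerA in H.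
under eq_bigr do rewrite mxE exprMn.
rewrite -mulr_sumr sqrtrM ?sqr_ge0// sqrtr_sqr normrM sg1 mulr1 mulrC ler_wpM2r//.
Unshelve. all: by end_near. Qed.

Lemma path_connected x y : exists l, path_len x y l.
Proof.
pose S := [set y | exists l, path_len x y l].
suff : S y by [].
suff -> : S = [set: M] by [].
apply: MC.
- by exists x, 0; exact: path_len0.
- exists S; last by rewrite setTI.
  rewrite openE => z [l Hl]; have := @near_path_len z 1 ltr01.
  by apply: filterS => w [l' _ Hw]; exists (l + l'); exact: path_len_cat Hl Hw.
- exists S; last by rewrite setTI.
  rewrite -openC openE => z nz; have := @near_path_len z 1 ltr01.
  apply: filterS => w [l' _ Hw] [l Hl]; apply: nz; exists (l + l').
  by apply: path_len_cat Hl _; exact: (path_len_rev EF).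
Qed.

Lemma dist_has_inf x y : has_inf [set l | path_len x y l].
Proof.
split; first by have [l Hl] := path_connected x y; exists l.
by exists 0 => l /path_len_ge0.
Qed.

Lemma dist_le x y l : path_len x y l -> dist x y <= l.
Proof. by move=> H; apply: ge_inf => //; have [] := dist_has_inf x y. Qed.

Lemma dist_ltP x y a : dist x y < a -> exists2 l, l < a & path_len x y l.
Proof.
move=> H; have [l Hl la] := inf_lt (proj1 (dist_has_inf x y)) H.
by exists l.
Qed.

Lemma dist_ge0 x y : 0 <= dist x y.
Proof.
apply: lb_le_inf; first by have [] := dist_has_inf x y.
by move=> l /path_len_ge0.
Qed.

Lemma distxx x : dist x x = 0.
Proof. by apply/eqP; rewrite eq_le dist_ge0 andbT; apply: dist_le; exact: path_len0. Qed.

Lemma dist_sym x y : dist x y = dist y x.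
Proof.
have half a b : dist b a <= dist a b.
  apply/ler_addgt0Pl => e e0.
  have [|l le Hl] := @dist_ltP a b (e + dist a b); first by rewrite ltrDr.
  by apply: le_trans (dist_le (path_len_rev EF Hl)) (ltW le).
by apply/eqP; rewrite eq_le !half.
Qed.

Lemma dist_tri x y z : dist x z <= dist x y + dist y z.
Proof.
apply/ler_addgt0Pl => e e0.
have e2 : 0 < e / 2 by rewrite divr_gt0.
have [|a ale Ha] := @dist_ltP x y (dist x y + e / 2); first by rewrite ltrDl.
have [|b ble Hb] := @dist_ltP y z (dist y z + e / 2); first by rewrite ltrDl.
apply: le_trans (dist_le (path_len_cat Ha Hb)) _.
by rewrite [e]splitr; lra.
Qed.

Lemma dist_near x (e : R) : 0 < e -> \forall y \near x, dist x y < e.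
Proof.
move=> e0; apply: filterS (near_path_len x e0) => y [l le Hl].
exact: le_lt_trans (dist_le Hl) le.
Qed.

Lemma dist_lipschitz x y z : `|dist x y - dist x z| <= dist y z.
Proof.
rewrite ler_norml; have := dist_tri x y z; have := dist_tri x z y.
rewrite (dist_sym z y) => H1 H2; apply/andP; split; lra.
Qed.

Lemma dist_continuous x : continuous (dist x).
Proof.
move=> y; apply/cvgrPdist_lt => e e0.
apply: filterS (dist_near y e0) => z; exact: le_lt_trans (dist_lipschitz _ _ _).
Qed.

Lemma dphi_bound phi K z v : smooth phi -> (forall i, `|vder (E i) phi z| <= K) ->
  `|dphi phi z v| <= (D%:R * K) * Num.sqrt (bilin g z v v).
Proof.
move=> sphi HK; rewrite (dphi_frame EF)// (le_trans (ler_norm_sum _ _ _))//.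
apply: (@le_trans _ _ (\sum_(i < D) K * Num.sqrt (bilin g z v v))).
  by apply: ler_sum => i _; rewrite normrM mulrC ler_pM//; exact: (fcoord_le EF).
by rewrite sumr_const card_ord -[leLHS]mulr_natl mulrA.
Qed.

Lemma lipschitz_dist phi C : smooth phi -> 0 <= C ->
  (forall z v, `|dphi phi z v| <= C * Num.sqrt (bilin g z v v)) ->
  forall x y, `|phi y - phi x| <= C * dist x y.
Proof.
move=> sphi C0 H x y; apply/ler_addgt0Pl => e e0.
have C1 : 0 < C + 1 by rewrite ltr_wpDl.
have [|l le Hl] := @dist_ltP x y (dist x y + e / (C + 1)).
  by rewrite ltrDl divr_gt0.
rewrite (le_trans (lipschitz_path_len EF sphi C0 H Hl))//.
rewrite (le_trans (ler_wpM2l C0 (ltW le)))// mulrDr addrC lerD2r.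
by rewrite mulrCA ler_piMr ?(ltW e0)// ler_pdivrMr// mul1r lerDl.
Qed.

(** Together with [dist_near], this says that the distance induces the topology. A bump supported in
    [U] has bounded frame derivatives, hence is Lipschitz for the distance: leaving [U] costs at
    least its value at [x] divided by the Lipschitz constant. *)
Lemma dist_sep x (U : set M) : nbhs x U ->
  exists2 e, 0 < e & forall y, dist x y < e -> U y.
Proof.
move=> nU; set c := crd x x.
have cp : {for c, continuous (pnt x)} by exact/continuous_point/img_center.
have nU' : \forall p \near c, img x p /\ U (pnt x p).
  apply: filterI; first exact/nbhs_img/img_center.
  by move: cp; rewrite /prop_for /continuous_at pointK => /(_ _ nU).
have [r r0 rx] := nbhs_cball nU'.
have rx' : cball c r `<=` img x by move=> p /rx[].
pose phi := chart_ext x (box_bump c r).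
have sphi : smooth phi by exact: smooth_box_bump.
have out z : ~ chart_ball x r z -> phi z = 0.
  by apply: chart_ext_out => // p; exact: box_bump_out.
have HK i : exists2 C, 0 < C & forall z, `|vder (E i) phi z| <= C.
  apply: (@bounded_frame_der _ _ _ E (smooth_field_frame EF) phi (chart_ball x r) [:: i]) => //.
  - exact: chart_ball_compact.
  - exact: chart_ball_closed.
have HK2 i : exists C, 0 < C /\ forall z, `|vder (E i) phi z| <= C.
  by have [C C0 HC] := HK i; exists C.
have [K HK'] := choice HK2.
pose C := D%:R * \sum_i K i.
have sK0 : 0 <= \sum_i K i by apply: sumr_ge0 => i _; have [/ltW] := HK' i.
have C0 : 0 <= C by rewrite mulr_ge0.
have L := @lipschitz_dist phi C sphi C0 _ x.
have phix : 0 < phi x by rewrite /phi chart_extE ?box_bump_center//; exact: dom_center.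
exists (phi x / (C + 1)); first by rewrite divr_gt0// ltr_wpDl.
move=> y; rewrite ltr_pdivlMr ?ltr_wpDl// => dxy.
apply: contrapT => nUy.
have phiy : phi y = 0.
  by apply: out => -[p /rx[_ Up] py]; apply: nUy; rewrite -py.
have : `|phi y - phi x| <= C * dist x y.
  apply: L => z v; apply: dphi_bound => // i.
  have [_ /(_ z) Hi] := HK' i; rewrite (le_trans Hi)//.
  by apply: ler_sum_term => j; have [/ltW] := HK' j.
rewrite phiy sub0r normrN gtr0_norm// leNgt => /negP; apply.
apply: le_lt_trans dxy; rewrite mulrC ler_wpM2l ?dist_ge0// lerDl//.
Qed.

Lemma dist_split x z (a b : R) : 0 < a -> 0 < b -> dist x z < a + b ->
  exists y, dist x y < a /\ dist y z < b.
Proof.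
move=> a0 b0 /dist_ltP[l lab Hl].
have [la|al] := ltP l a.
  by exists z; rewrite distxx; split=> //; exact: le_lt_trans (dist_le Hl) la.
have l0 := path_len_ge0 Hl.
(* The midpoint of [l - b] and [a], which are in this order because [l < a + b], brought back to 0
   if it is negative. *)
pose a' := Num.max 0 ((l - b + a) / 2).
have a'a : a' < a.
  by rewrite /a' gt_max a0/=; lra.
have a'l : 0 <= a' <= l.
  by rewrite /a' le_max lexx/= ge_max l0/=; lra.
have lb : l - a' < b.
  have : (l - b + a) / 2 <= a' by rewrite /a' le_max lexx orbT.
  lra.
have [_ /(_ a' a'l)[y [H1 H2]]] := path_len_split EF Hl.
by exists y; split; [exact: le_lt_trans (dist_le H1) a'a|exact: le_lt_trans (dist_le H2) lb].
Qed.

Lemma dist_line x i (sg : R) : `|sg| = 1 ->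
  \forall s \near (0 : R), dist x (pnt x (crd x x + s *: (sg *: E i x))) <= 4 * `|s|.
Proof.
move=> /(near_path_len_frame x i); apply: filterS => s [l ls Hl].
exact: le_trans (dist_le Hl) ls.
Qed.

End Dist.

(** * Hopf-Rinow: closed balls of a complete manifold are compact *)

Section HopfRinow.
Context {R : realType} {D : nat} {M : manifold R D}.
Variables (g : metric M) (E : 'I_D -> M -> 'rV[R]_D).
Hypothesis EF : orthonormal_frame g E.
Hypothesis MC : connected [set: M].
Hypothesis gC : metric_complete g.
Implicit Types (x y z : M).

Local Notation dist := (dist g).

Definition dball x (r : R) : set M := [set y | dist x y <= r].

Lemma dball_closed x r : closed (dball x r).
Proof.
have -> : dball x r = dist x @^-1` [set t | t <= r] by [].
by apply: closed_comp; [move=> y _; exact: (dist_continuous EF MC)|exact: closed_le].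
Qed.

Lemma sub_compact_dball x r (K : set M) : compact K -> dball x r `<=` K ->
  compact (dball x r).
Proof. by move=> cK; apply: subclosed_compact => //; exact: dball_closed. Qed.

Lemma dball_compact_small x : exists2 r, 0 < r & compact (dball x r).
Proof.
have [r r0 rx] := nbhs_cball (nbhs_img (img_center x)).
have nK : nbhs x (chart_ball x r).
  have cx : {for x, continuous (fun y => `|crd x y - crd x x|)}.
    apply: (@continuous_comp _ _ _ (fun y => crd x y - crd x x) Num.norm).
      apply: continuousB; last exact: cst_continuous.
      exact/continuous_coord/dom_center.
    exact: norm_continuous.
  have H : `|crd x x - crd x x| < r by rewrite subrr normr0.
  apply: filterS2 (nbhs_dom (dom_center x)) (cvgr_lt _ cx _ H) => y dy yr.
  by exists (crd x y); [exact: ltW|exact: coordK].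
have [e e0 He] := dist_sep EF MC nK.
exists (e / 2); first by rewrite divr_gt0.
apply: (@sub_compact_dball _ _ (chart_ball x r)); first exact: chart_ball_compact.
move=> y /= ye; apply: He; apply: le_lt_trans ye _.
by rewrite ltr_pdivrMr// ltr_pMr// ltr1n.
Qed.

(* Iterated, this yields centers converging to a point without compact balls. *)
Lemma noncompact_dball_step x r : 0 < r -> ~ compact (dball x r) ->
  exists y, dist x y <= r / 2 /\ ~ compact (dball y (3 / 4 * r)).
Proof.
move=> r0 nc; have [cK|nK] := pselect (compact (dball x (r / 2))); last first.
  exists x; rewrite (distxx EF MC) divr_ge0 ?(ltW r0)//; split=> // cK; apply: nK.
  apply: sub_compact_dball cK _ => y /= /le_trans; apply.
  by rewrite mulrC ler_wpM2r ?(ltW r0)//; lra.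
apply: contrapT => /forallNP H; apply: nc.
have Hc y : dist x y <= r / 2 -> compact (dball y (3 / 4 * r)).
  by move=> xy; apply: contrapT => nc; apply: (H y).
have r8 : 0 < r / 8 by rewrite divr_gt0.
have cK' : cover_compact (dball x (r / 2)) by rewrite -compact_cover.
have [||D' HD' cov] := cK' M (dball x (r / 2))
  (fun y => [set z | dist y z < r / 8]).
- move=> y _; have -> : [set z | dist y z < r / 8] = dist y @^-1` [set t | t < r / 8] by [].
  by apply: open_comp; [move=> z _; exact: (dist_continuous EF MC)|exact: open_lt].
- by move=> y xy; exists y => //=; rewrite (distxx EF MC).
have cU : compact (\bigcup_(y in [set y | (y \in D') && (y \in D')]) dball y (3 / 4 * r)).
  rewrite (bigcup_seq_cond (enum_fset D')); apply: bigsetU_compact => y yD.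
  by apply: Hc; have /set_mem := HD' _ yD.
apply: (sub_compact_dball cU).
move=> z /= xz.
(* [r / 2 + 5 / 8 * r] exceeds [r], so an intermediate point [w] exists; a center at distance less
   than [r / 8] from [w] then gives [r / 8 + 5 / 8 * r = 3 / 4 * r]. *)
have [|||w [xw wz]] := @dist_split _ _ _ _ _ EF MC x z (r / 2) (5 / 8 * r).
- by rewrite divr_gt0.
- by rewrite mulr_gt0.
- by apply: le_lt_trans xz _; lra.
have [y /= yD yw] := cov w (ltW xw).
exists y; first by rewrite /= yD.
apply: le_trans (dist_tri EF MC y w z) _.
move: yw wz => /= yw wz; lra.
Qed.

Lemma dball_compact x r : compact (dball x r).
Proof.
apply: contrapT => nc.
have r0 : 0 < r.
  rewrite ltNge; apply/negP => r0; apply: nc.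
  have [e e0 ce] := dball_compact_small x; apply: sub_compact_dball ce _ => y /= yr.
  exact: le_trans yr (le_trans r0 (ltW e0)).
have step (q : M * R) : exists y, 0 < q.2 -> ~ compact (dball q.1 q.2) ->
    dist q.1 y <= q.2 / 2 /\ ~ compact (dball y (3 / 4 * q.2)).
  have [q0|q0] := pselect (0 < q.2 /\ ~ compact (dball q.1 q.2)).
    have [y Hy] := noncompact_dball_step q0.1 q0.2; by exists y.
  by exists q.1 => q1 q2; exfalso; apply: q0.
have [F HF] := choice step.
pose rn n : R := (3 / 4) ^+ n * r.
pose sq := fix sq n : M := if n is n'.+1 then F (sq n', rn n') else x.
have rn0 n : 0 < rn n by rewrite mulr_gt0// exprn_gt0//; lra.
have rnS n : rn n.+1 = 3 / 4 * rn n by rewrite /rn exprS mulrA.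
have ncn n : ~ compact (dball (sq n) (rn n)).
  elim: n => [|n IH]; first by rewrite /rn expr0 mul1r.
  by rewrite rnS; have [] := HF (sq n, rn n) (rn0 n) IH.
have dn n : dist (sq n) (sq n.+1) <= rn n / 2.
  by have [] := HF (sq n, rn n) (rn0 n) (ncn n).
(* Telescoping: as [rn n.+1 = 3 / 4 * rn n], the bound [rn n / 2] on one step equals
   [2 * (rn n - rn n.+1)]. *)
have dmn m k : dist (sq m) (sq (m + k)%N) <= 2 * (rn m - rn (m + k)%N).
  elim: k => [|k IH]; first by rewrite addn0 (distxx EF MC) subrr mulr0.
  rewrite addnS; apply: le_trans (dist_tri EF MC _ (sq (m + k)%N) _) _.
  have := dn (m + k)%N; have := rnS (m + k)%N; move: IH; lra.
have dmn' m n : (m <= n)%N -> dist (sq m) (sq n) <= 2 * rn m.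
  move=> /subnKC <-; apply: le_trans (dmn _ _) _.
  by rewrite ler_wpM2l// gerBl ltW.
have rn_cvg : rn n @[n --> \oo] --> (0 : R).
  rewrite -[X in _ --> X](mul0r r); apply: cvgMr_tmp.
  by apply: cvg_expr; rewrite ger0_norm; lra.
have rn_small (e : R) : 0 < e -> exists n, rn n < e.
  move=> e0; have /cvgrPdist_lt /(_ e e0) [n _ /(_ n (leqnn n))] := rn_cvg.
  by rewrite /= sub0r normrN gtr0_norm//; exists n.
have rn_mono m n : (m <= n)%N -> rn n <= rn m.
  move=> mn; rewrite /rn ler_wpM2r ?(ltW r0)//.
  by rewrite ler_wiXn2l//; lra.
have [l Hl] : exists l : M, sq @ \oo --> l.
  apply: gC => e e0; have [N HN] := rn_small (e / 4) (divr_gt0 e0 (ltr0Sn _ _)).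
  exists N => m n Nm Nn.
  have := dist_tri EF MC (sq m) (sq N) (sq n).
  rewrite (dist_sym EF MC (sq m) (sq N)); have := dmn' _ _ Nm; have := dmn' _ _ Nn.
  by move=> ? ? /le_lt_trans; apply; lra.
have [e e0 ce] := dball_compact_small l.
have e2 : 0 < e / 2 by rewrite divr_gt0.
have [N _ HN] := Hl _ (dist_near EF MC l e2).
have [N' HN'] := rn_small _ e2.
have [n Nn N'n] : exists2 n, (N <= n)%N & (N' <= n)%N.
  by exists (maxn N N'); rewrite ?leq_maxl ?leq_maxr.
apply: (ncn n); apply: sub_compact_dball ce _ => y ny.
have h1 : dist l (sq n) < e / 2 := HN n Nn.
have h2 := rn_mono _ _ N'n.
have ny' : dist (sq n) y <= rn n := ny.
apply: le_trans (dist_tri EF MC l (sq n) y) _; lra.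
Qed.

End HopfRinow.

(** * Integrals over the half line of exponentially decaying functions *)

Section ExpDecay.
Context {R : realType}.
Local Notation leb := (@lebesgue_measure R).
Variables (m : R).
Hypothesis m0 : 0 < m.

Definition expd (t : R) : R := expR (- m * t).

Lemma expd_gt0 t : 0 < expd t. Proof. exact: expR_gt0. Qed.

Lemma continuous_expd : continuous expd.
Proof.
move=> t; apply: (@continuous_comp _ _ _ (fun t : R => - m * t) expR).
  by apply: cvgMl_tmp; exact: cvg_id.
exact: continuous_expR.
Qed.

Lemma is_derive_expd (t : R) : is_derive t (1 : R) (fun t : R => - (m^-1 * expd t)) (expd t).
Proof.
have H1 : is_derive t (1 : R) (fun t : R => - m * t) (- m).
  have H : is_derive t (1 : R) ((- m) \*: (id : R -> R)) ((- m) *: 1) by exact: is_deriveZ.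
  by apply: (is_derive_eq H); rewrite [LHS]mulr1.
have H2 := @is_derive1_comp _ expR (fun t : R => - m * t) _ _ _ (is_derive_expR _) H1.
have H3 : is_derive t (1 : R) (m^-1 \*: (expR \o (fun t : R => - m * t)))
  (m^-1 *: (expR (- m * t) * - m)) by exact: is_deriveZ.
apply: (is_derive_eq (is_deriveN H3)).
by rewrite /GRing.scale/= mulrN mulrN opprK mulrCA mulVf ?mulr1// gt_eqF.
Qed.

Lemma expd_small (x K : R) : (forall T, 0 < T -> x <= K * expd T) -> x <= 0.
Proof.
move=> H; rewrite leNgt; apply/negP => x0.
have K0 : 0 < K.
  have := H 1 ltr01; move=> /(lt_le_trans x0); by rewrite pmulr_lgt0// expd_gt0.
(* For this [T], the inequality $e^{mT} \ge 1 + mT$ gives $x e^{mT} \ge x + K > K$. *)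
pose T := K / (m * x).
have T0 : 0 < T by rewrite divr_gt0// mulr_gt0.
have := H T T0; rewrite /expd mulNr expRN ler_pdivlMr ?expR_gt0//.
apply/negP; rewrite -ltNge.
have := expR_ge1Dx (m * T); rewrite -(ler_pM2l x0).
apply: lt_le_trans; rewrite mulrDr mulr1 /T invfM.
have -> : x * (m * (K * (m^-1 / x))) = (x / x) * (m / m) * K by ring.
by rewrite !divff ?gt_eqF// !mul1r ltrDr.
Qed.

Lemma expd_cvg0 : (- (m^-1 * expd t)) @[t --> +oo] --> (0 : R).
Proof.
apply/cvgrPdist_le => e e0; near=> t.
rewrite sub0r opprK ger0_norm; last by apply: mulr_ge0; [rewrite invr_ge0 ltW|exact: ltW (expd_gt0 t)].
rewrite ler_pdivrMl// /expd mulNr expRN -[leLHS]mul1r ler_pdivrMr ?expR_gt0//.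
apply: (@le_trans _ _ (m * e * (1 + m * t))); last first.
  by rewrite ler_pM2l ?mulr_gt0// expR_ge1Dx.
have : (m * e)^-1 / m <= t by near: t; apply: nbhs_pinfty_ge; exact: num_real.
rewrite ler_pdivrMr// => H.
have : 1 <= (t * m) * (m * e) by rewrite -ler_pdivrMr ?mulr_gt0// mul1r.
have : 0 < m * e by rewrite mulr_gt0.
by lra.
Unshelve. all: by end_near. Qed.

Lemma integral_expd T : (\int[leb]_(t in `[T, +oo[) (expd t)%:E = (m^-1 * expd T)%:E)%E.
Proof.
rewrite (@ge0_continuous_FTC2y _ expd (fun t => - (m^-1 * expd t)) T 0).
- by rewrite -EFinB opprK add0r.
- by move=> x _; rewrite ltW// expd_gt0.
- by apply: continuous_subspaceT; exact: continuous_expd.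
- exact: expd_cvg0.
- by move=> x _; case: (is_derive_expd x).
- apply: cvg_at_right_filter; exact: (is_derive_continuous (is_derive_expd T)).
- by move=> x _; have [_ <-] := is_derive_expd x; rewrite derive1E.
Qed.

Lemma integrable_expd (C T : R) : leb.-integrable `[T, +oo[ (EFin \o (fun t => C * expd t)).
Proof.
have -> : EFin \o (fun t => C * expd t) = (fun t => C%:E * (expd t)%:E)%E.
  by apply/funext => t /=; rewrite EFinM.
apply: integrableZl => //; apply/integrableP; split.
  apply/measurable_EFinP; apply: measurable_funTS.
  by apply: continuous_measurable_fun; exact: continuous_expd.
under eq_integral do rewrite /= ger0_norm ?(ltW (expd_gt0 _))//.
by rewrite integral_expd ltry.
Qed.

Lemma integrable_decay (f : R -> R) (C : R) : measurable_fun (`[0, +oo[%classic : set R) f ->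
  (forall t, 0 <= t -> `|f t| <= C * expd t) ->
  leb.-integrable `[0, +oo[ (EFin \o f).
Proof.
move=> mf Hf; apply: le_integrable (integrable_expd C 0) => //.
  exact/measurable_EFinP.
move=> t /=; rewrite in_itv/= andbT => t0.
by rewrite lee_fin (le_trans (Hf t t0))// ler_norm.
Qed.

Lemma Rintegral_decay_le (f : R -> R) (C T : R) : 0 <= T -> measurable_fun (`[0, +oo[%classic : set R) f ->
  (forall t, 0 <= t -> `|f t| <= C * expd t) ->
  `|\int[leb]_(t in `[T, +oo[) f t| <= C / m * expd T.
Proof.
move=> T0 mf Hf; have If := integrable_decay mf Hf.
have sT : `[T, +oo[ `<=` `[0, +oo[.
  by move=> t /=; rewrite !in_itv/= !andbT; exact: le_trans.
have If' : leb.-integrable `[T, +oo[ (EFin \o f) by exact: integrableS If.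
apply: le_trans (le_normr_Rintegral _ If') _ => //.
apply: (@le_trans _ _ (\int[leb]_(t in `[T, +oo[) (C * expd t))).
  apply: le_Rintegral => //.
  - exact: integrable_norm.
  - exact: integrable_expd.
  - by move=> t /sT /=; rewrite in_itv/= andbT; exact: Hf.
rewrite RintegralZl//; last first.
  have := integrable_expd 1 T; congr (_.-integrable _ _).
  by apply/funext => t /=; rewrite mul1r.
by rewrite /Rintegral integral_expd/= mulrA.
Qed.

(** The fundamental theorem on [[0, T]] leaves the value [G T] and the tail of the integral. Both
    are bounded by multiples of [expd m T], for every [T], so that the difference of the two sides
    vanishes by [expd_small]. *)
Lemma Rintegral_derive_decay (G h : R -> R) (C : R) : 0 <= C ->
  {within `[0, +oo[, continuous h} -> {within `[0, +oo[, continuous G} ->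
  (forall t : R, 0 < t -> is_derive t (1 : R) G (h t)) ->
  (forall t, 0 <= t -> `|h t| <= C * expd t) ->
  (forall t, 0 <= t -> `|G t| <= C * expd t) ->
  \int[leb]_(t in `[0, +oo[) h t = - G 0.
Proof.
move=> C0 ch cG dG Hh HG.
have mh : measurable_fun (`[0, +oo[%classic : set R) h.
  by apply: subspace_continuous_measurable_fun.
have Ih := integrable_decay mh Hh.
apply/eqP; rewrite -subr_eq0 opprK -normr_le0.
apply: (@expd_small _ (C + C / m)) => T T0.
have sT : `[0, T] `<=` `[0, +oo[.
  by move=> t /=; rewrite !in_itv/= andbT => /andP[].
have E1 : \int[leb]_(t in `[0, T]) h t = G T - G 0.
  apply: Rintegral_primitive; first exact: ltW.
  - exact: continuous_subspaceW ch.
  - exact: continuous_subspaceW cG.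
  - by move=> t /andP[t0 _]; exact: dG.
have E2 := @Rintegral_itvB _ h (BLeft 0) +oo%O T Ih.
rewrite E1 Rintegral_itv_obnd_cbnd in E2; last first.
  apply: integrableS Ih => // t /=; rewrite !in_itv/= !andbT => Tt.
  by rewrite ltW// (lt_trans T0).
have -> : \int[leb]_(t in `[0, +oo[) h t + G 0 = G T + \int[leb]_(t in `[T, +oo[) h t.
  by rewrite -E2 ?bnd_simp ?ltW//; ring.
rewrite (le_trans (ler_normD _ _))// mulrDl lerD//; first exact/HG/ltW.
by apply: Rintegral_decay_le => //; exact: ltW.
Qed.

End ExpDecay.

Lemma poly_exp_decay {R : realType} (Q : {poly R}) (lambda : R) : 0 < lambda ->
  exists2 C, 0 <= C & forall t, 0 <= t ->
    Q.[t] * expR (- lambda * t) <= C * expd (lambda / 2) t.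
Proof.
move=> l0; have l20 : 0 < lambda / 2 by rewrite divr_gt0.
(* Half of the rate pays for the polynomial: in the variable [lambda / 2 * t] it is again a
   polynomial, bounded against the exponential. *)
have [C C0 HC] := poly_exp_bounded (Q \Po ((lambda / 2)^-1 *: 'X)).
exists C; first exact: ltW.
move=> t t0; have := HC (lambda / 2 * t) (mulr_ge0 (ltW l20) t0).
rewrite horner_comp hornerZ hornerX mulKf ?gt_eqF// => H.
have -> : - lambda * t = - (lambda / 2 * t) + - (lambda / 2) * t by field.
rewrite expRD mulrA ler_wpM2r ?expR_ge0//.
by apply: le_trans H; exact: ler_norm.
Qed.

(** * Integrals of bounded functions and invariant measures of random maps *)

Section BoundedIntegral.
Context {R : realType} {d : measure_display} {T : measurableType d}.
Variable mu : probability T R.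

Lemma integrable_bounded (f : T -> R) (C : R) : measurable_fun setT f ->
  (forall x, `|f x| <= C) -> mu.-integrable setT (EFin \o f).
Proof.
move=> mf fC; apply: (le_integrable _ _ _ (g := EFin \o cst C)) => //.
- exact/measurable_EFinP.
- by move=> x _ /=; rewrite lee_fin (le_trans (fC x))// ler_norm.
by apply: finite_measure_integrable_cst.
Qed.

Lemma Rintegral_bounded (f : T -> R) (C : R) : measurable_fun setT f ->
  (forall x, `|f x| <= C) -> `|\int[mu]_x f x| <= C.
Proof.
move=> mf fC; have fi := integrable_bounded mf fC.
rewrite (le_trans (le_normr_Rintegral _ fi))//.
have -> : C = \int[mu]_x cst C x.
  have e : C * fine (mu setT) = C by rewrite probability_setT mulr1.
  by rewrite Rintegral_cst//; exact: esym e.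
apply: le_Rintegral => //; first exact: integrable_norm fi.
exact: finite_measure_integrable_cst.
Qed.

End BoundedIntegral.

(** Invariance is stated on sets. It says that the image of the product of [N] and [mu] by [F] is
    [mu]; the change of variables and Fubini then extend it to bounded functions. *)
Lemma Rintegral_invariant {R : realType} {dS dY : measure_display}
    {S : measurableType dS} {Y : measurableType dY}
    (N : probability S R) (mu : probability Y R) (F : S * Y -> Y) (phi : Y -> R) (C : R) :
  measurable_fun setT F ->
  (forall A, measurable A -> (\int[mu]_x N [set s | A (F (s, x))])%E = mu A) ->
  measurable_fun setT phi -> (forall x, `|phi x| <= C) ->
  mu.-integrable setT (EFin \o (fun x => \int[N]_s phi (F (s, x)))) /\
  \int[mu]_x \int[N]_s phi (F (s, x)) = \int[mu]_x phi x.
Proof.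
move=> mF inv mphi bphi.
have mpF : measurable_fun setT (phi \o F) by exact: measurableT_comp.
have mG : measurable_fun setT (EFin \o (phi \o F)) by exact/measurable_EFinP.
have iG : (N \x mu)%E.-integrable setT (EFin \o (phi \o F)).
  have NT : (N \x mu)%E setT = 1%E.
    transitivity (N setT * mu setT)%E; last by rewrite !probability_setT mule1.
    by rewrite -setXTT product_measure1E.
  apply: (le_integrable _ _ _ (g := EFin \o cst C)) => //.
    by move=> x _ /=; rewrite lee_fin (le_trans (bphi _))// ler_norm.
  apply/integrableP; split; first by apply/measurable_EFinP; exact: measurable_cst.
  have -> : (fun z : S * Y => `|(EFin \o cst C) z|%E) = cst (`|C|%:E) by [].
  by rewrite integral_cst// [X in (_ * X)%E]NT mule1 ltry.
have GE x : fubini_G N (EFin \o (phi \o F)) x = (\int[N]_s phi (F (s, x)))%:E.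
  rewrite /fubini_G /Rintegral fineK//; apply: integrable_fin_num => //.
  apply: (@integrable_bounded _ _ _ N (fun s => phi (F (s, x))) C) => //.
  by apply: (measurableT_comp mpF); exact: pair2_measurable.
have iG2 : mu.-integrable setT (EFin \o (fun x => \int[N]_s phi (F (s, x)))).
  apply: (@integrable_bounded _ _ _ _ _ C).
    apply/measurable_EFinP; rewrite (_ : EFin \o _ = fubini_G N (EFin \o (phi \o F))).
      exact: measurable_fubini_G iG.
    by apply/funext => x; rewrite GE.
  move=> x; apply: Rintegral_bounded => //.
  by apply: (measurableT_comp mpF); exact: pair2_measurable.
split=> //.
rewrite /Rintegral; congr fine.
have -> : (\int[mu]_x (\int[N]_s phi (F (s, x)))%:E = \int[mu]_x fubini_G N (EFin \o (phi \o F)) x)%E.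
  by apply: eq_integral => x _; rewrite GE.
rewrite (integral21_prod_meas1 iG).
have key (A : set Y) : measurable A -> pushforward (N \x mu)%E F A = mu A.
  move=> mA; transitivity ((N \x^ mu)%E (F @^-1` A)).
    rewrite /pushforward; apply: product_measure_unique; last by rewrite -[X in measurable X]setTI; exact: mF.
    by move=> B C' mB mC'/=; rewrite product_measure2E.
  rewrite -(inv A mA) /product_measure2/=; apply: eq_integral => x _; congr (N _).
  by apply/seteqP; split => s /=; rewrite /ysection/= inE.
have mE : measurable_fun setT (EFin \o phi) by exact/measurable_EFinP.
have := integral_pushforward mF mE iG measurableT; rewrite preimage_setT => <-.
by apply: eq_measure_integral => A mA _; exact: key.
Qed.

Lemma Rintegral_lincomb {R : realType} {d : measure_display} {T : measurableType d}
    (mu : {measure set T -> \bar R}) (D : set T) (I : Type) (r : seq I) (a : I -> R)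
    (F : I -> T -> R) : measurable D ->
  (forall i, mu.-integrable D (EFin \o F i)) ->
  mu.-integrable D (EFin \o (fun x => \sum_(i <- r) a i * F i x)) /\
  \int[mu]_(x in D) \sum_(i <- r) a i * F i x = \sum_(i <- r) a i * \int[mu]_(x in D) F i x.
Proof.
move=> mD iF; elim: r => [|i r [IH1 IH2]].
  have -> : (fun x => \sum_(i <- [::]) a i * F i x) = cst 0.
    by apply/funext => x; rewrite big_nil.
  by rewrite big_nil; split; [exact: integrable0|rewrite Rintegral_cst// mul0r].
have -> : (fun x => \sum_(j <- i :: r) a j * F j x) =
  (fun x => a i * F i x + \sum_(j <- r) a j * F j x).
  by apply/funext => x; rewrite big_cons.
have J1 : mu.-integrable D (EFin \o (fun x => a i * F i x)).
  rewrite (_ : EFin \o _ = (fun x => (a i)%:E * (F i x)%:E)%E).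
    by apply: integrableZl => //; exact: iF.
  by apply/funext => x /=; rewrite EFinM.
split.
  rewrite (_ : EFin \o _ = (EFin \o (fun x => a i * F i x)) \+
      (EFin \o (fun x => \sum_(j <- r) a j * F j x))).
    exact: integrableD.
  by apply/funext => x /=; rewrite EFinD.
by rewrite RintegralD// IH2 RintegralZl ?big_cons//; exact: iF.
Qed.

(** * Differentiation under the integral sign and the potential V *)

Section Equidiff.
Context {R : realType} {D : nat} {M : manifold R D}.
Variables (g : metric M) (E : 'I_D -> M -> 'rV[R]_D).
Hypothesis EF : orthonormal_frame g E.
Hypothesis MC : connected [set: M].
Implicit Types (phi psi : M -> R) (x y z : M) (p v w : 'rV[R]_D).

Lemma lipschitz_vder psi B y z : smooth psi -> 0 <= B ->
  (forall i z, `|vder (E i) psi z| <= B) ->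
  `|psi z - psi y| <= D%:R * B * dist g y z.
Proof.
move=> spsi B0 HB; apply: (lipschitz_dist EF MC) => //; first exact: mulr_ge0.
by move=> q v; apply: (dphi_bound EF).
Qed.

(* The neighborhood does not depend on [psi]: this is what allows to differentiate
   under the integral sign. *)
Lemma equidifferentiable x p0 w (e : R) : img x p0 -> 0 < e ->
  \forall s \near (0 : R), forall psi B, smooth psi -> 0 <= B ->
    (forall i z, `|vder (E i) psi z| <= B) ->
    (forall i j z, `|vder (E j) (vder (E i) psi) z| <= B) ->
    `|psi (pnt x (p0 + s *: w)) - psi (pnt x p0)
      - s * 'D_w ((psi \o pnt x) : 'rV[R]_D -> R^o) p0| <= e * B * `|s|.
Proof.
move=> ip e0.
pose S : R := \sum_j `|chart_coef E x p0 w 0 j|.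
have S0 : 0 <= S by exact: sumr_ge0.
(* By the mean value theorem the error is the variation of the derivative along [w]. Its part due to
   the chart coefficients gives [D], its part due to the frame derivatives of [psi] gives [D * S],
   and 1 ensures positivity. *)
pose K : R := D%:R + D%:R * S + 1.
have K0 : 0 < K by rewrite ltr_wpDl// addr_ge0// mulr_ge0.
pose e' := e / K.
have e'0 : 0 < e' by rewrite divr_gt0.
have nd : \forall p \near p0, dist g (pnt x p0) (pnt x p) <= e'.
  have cp : pnt x p @[p --> p0] --> pnt x p0 := continuous_point ip.
  apply: (@filterS _ (nbhs p0) (nbhs_filter p0) _ _ _ (cp _ (dist_near EF MC (pnt x p0) e'0))).
  by move=> q /= /ltW.
have np : \forall p \near p0, img x p /\ (dist g (pnt x p0) (pnt x p) <= e' /\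
    forall j : 'I_D, `|chart_coef E x p0 w 0 j - chart_coef E x p w 0 j| <= e').
  near=> p; split; first by near: p; exact: nbhs_img.
  split.
    by near: p; exact: nd.
  near: p; apply: filter_forall => j.
  have cf := continuous_chart_coef EF (w := w) (j := j) ip.
  by have /cvgrPdist_le := cf; exact.
have [r r0 rx] := nbhs_cball np.
near=> s => psi B spsi B0 HB1 HB2.
have sr : `|s| * `|w| <= r.
  rewrite (le_trans (_ : _ <= `|s| * (`|w| + 1)))//.
    by rewrite ler_wpM2l// lerDl.
  rewrite -ler_pdivlMr ?ltr_wpDl//; near: s; apply: (@nbhs0_le _ R).
  by rewrite divr_gt0// ltr_wpDl.
have cs (c : R) : `|c| <= `|s| -> cball p0 r (p0 + c *: w).
  move=> cs; rewrite /cball/= addrAC subrr add0r normrZ.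
  by rewrite (le_trans _ sr)// ler_wpM2r.
have [|c cs1] := @MVT0 R (fun c : R => psi (pnt x (p0 + c *: w)))
    (fun c : R => 'D_w ((psi \o pnt x) : 'rV[R]_D -> R^o) (p0 + c *: w)) s.
  move=> c /cs/rx[ic _]; apply/is_derive_line.
  have dd : derivable ((psi \o pnt x) : 'rV[R]_D -> R^o) (p0 + c *: w) w.
    by apply: diff_derivable; exact: smooth_differentiable.
  have /is_derive_line := DeriveDef dd erefl.
  congr (is_derive _ _ _ _); apply/funext => t /=.
  by congr (psi (pnt x _)); rewrite [t%:A]mulr1 scalerDl addrCA.
rewrite scale0r addr0 => ->.
rewrite mulrC -mulrBr normrM mulrC ler_wpM2r//.
have [ic [dc Hc]] := rx _ (cs c cs1).
rewrite !(derive_chart_frame EF)// -sumrB (le_trans (ler_norm_sum _ _ _))//.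
set z := pnt x (p0 + c *: w) in dc *; set z0 := pnt x p0 in dc *.
apply: (@le_trans _ _ (\sum_(j < D) (e' * B + `|chart_coef E x p0 w 0 j| * (D%:R * B * e')))).
  apply: ler_sum => j _.
  have -> : chart_coef E x (p0 + c *: w) w 0 j * vder (E j) psi z -
      chart_coef E x p0 w 0 j * vder (E j) psi z0 =
    (chart_coef E x (p0 + c *: w) w 0 j - chart_coef E x p0 w 0 j) * vder (E j) psi z
    + chart_coef E x p0 w 0 j * (vder (E j) psi z - vder (E j) psi z0) by ring.
  rewrite (le_trans (ler_normD _ _))// !normrM lerD//.
    by rewrite ler_pM// distrC.
  rewrite ler_wpM2l//.
  have sj : smooth (vder (E j) psi) by exact: (smooth_field_frame EF).
  apply: (le_trans (lipschitz_vder z0 z sj B0 (HB2 j))).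
  by rewrite ler_wpM2l// mulr_ge0.
rewrite big_split/= sumr_const card_ord -[X in X + _]mulr_natl -mulr_suml -/S.
have -> : D%:R * (e' * B) + S * (D%:R * B * e') = (e' * (D%:R + D%:R * S)) * B by ring.
rewrite ler_wpM2r// /e' mulrAC ler_pdivrMr// ler_wpM2l ?(ltW e0)//.
by rewrite /K lerDl.
Unshelve. all: by end_near. Qed.

End Equidiff.

Section Potential.
Context {R : realType} {D : nat} {M : manifold R D}.
Variables (g : metric M) (E : 'I_D -> M -> 'rV[R]_D).
Hypothesis EF : orthonormal_frame g E.
Hypothesis MC : connected [set: M].
Variables (m : R) (m0 : 0 < m) (U : R -> M -> R) (C : seq 'I_D -> R).
Hypothesis C0 : forall s, 0 <= C s.
Hypothesis sU : forall t, 0 <= t -> smooth (U t).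
Hypothesis cU : forall x, {within `[0, +oo[, continuous (U ^~ x)}.
Hypothesis bU : forall s t x, 0 <= t -> `|frame_der E s (U t) x| <= C s * expd m t.
Implicit Types (phi psi : M -> R) (x y z : M) (p v w : 'rV[R]_D).
Local Notation leb := (@lebesgue_measure R).

Let sE := smooth_field_frame EF.

(** One constant for the first and second frame derivatives of [frame_der E s (U t)], as
    [equidifferentiable] takes a single [B]. *)
Definition bnd s : R := \sum_i C (i :: s) + \sum_i \sum_j C [:: j, i & s].

Lemma bnd_ge0 s : 0 <= bnd s.
Proof.
by rewrite addr_ge0// sumr_ge0// => i _; exact: sumr_ge0.
Qed.

Lemma bnd1 s i z t : 0 <= t -> `|vder (E i) (frame_der E s (U t)) z| <= bnd s * expd m t.
Proof.
move=> t0; apply: le_trans (bU (i :: s) z t0) _.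
rewrite ler_wpM2r ?(ltW (expd_gt0 _ _))// /bnd.
apply: le_trans (@ler_sum_term _ _ (fun i => C (i :: s)) i (fun i => C0 _)) _.
by rewrite lerDl sumr_ge0// => k _; exact: sumr_ge0.
Qed.

Lemma bnd2 s i j z t : 0 <= t ->
  `|vder (E j) (vder (E i) (frame_der E s (U t))) z| <= bnd s * expd m t.
Proof.
move=> t0; apply: le_trans (bU [:: j, i & s] z t0) _.
rewrite ler_wpM2r ?(ltW (expd_gt0 _ _))// /bnd.
apply: (@le_trans _ _ (\sum_i \sum_j C [:: j, i & s])); last first.
  by rewrite lerDr sumr_ge0.
apply: le_trans (@ler_sum_term _ _ (fun i => \sum_j C [:: j, i & s]) i _); last first.
  by move=> k; exact: sumr_ge0.
exact: (@ler_sum_term _ _ (fun j => C [:: j, i & s]) j (fun i => C0 _)).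
Qed.

Definition Us s t x : R := frame_der E s (U t) x.

Lemma smooth_Us s t : 0 <= t -> smooth (Us s t).
Proof. by move=> t0; apply: smooth_frame_der => //; exact: sU. Qed.

Lemma expd_le1 t : 0 <= t -> expd m t <= 1.
Proof. by move=> t0; rewrite -expR0 ler_expR mulNr oppr_le0 mulr_ge0// ltW. Qed.

(** Continuity in [t] is assumed for [U] only. It passes to one more frame derivative through the
    difference quotient [q], which is continuous in [t] and whose step [h], by [equidifferentiable],
    makes it close to the derivative for all [t] at once. *)
Lemma continuous_Us s x : {within `[0, +oo[, continuous (fun t => Us s t x)}.
Proof.
elim: s x => [|i s IH] x; first exact: cU.
apply/subspace_continuousP => t t0.
set F := within _ _.
apply/cvgrPdist_lt => e e0; have e4 : 0 < e / 4 by rewrite divr_gt0.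
have B0 := bnd_ge0 s.
have d0 : 0 < e / 4 / (bnd s + 1) by rewrite divr_gt0// ltr_wpDl.
have /nbhs_ballP[r /= r0 Hr] := equidifferentiable EF MC (E i x) (img_center x) d0.
pose h := r / 2; have h0 : 0 < h by rewrite divr_gt0.
have hr : ball 0 r h.
  by rewrite /ball/= sub0r normrN gtr0_norm// /h ltr_pdivrMr// ltr_pMr// ltr1n.
pose y := pnt x (crd x x + h *: E i x).
pose q t := (Us s t y - Us s t x) / h.
have Hq t' : 0 <= t' -> `|q t' - Us (i :: s) t' x| <= e / 4.
  move=> t'0.
  have b1 j z : `|vder (E j) (Us s t') z| <= bnd s.
    by apply: le_trans (bnd1 s j z t'0) _; rewrite ler_piMr// expd_le1.
  have b2 j k z : `|vder (E k) (vder (E j) (Us s t')) z| <= bnd s.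
    by apply: le_trans (bnd2 s j k z t'0) _; rewrite ler_piMr// expd_le1.
  have := Hr h hr _ _ (smooth_Us s t'0) B0 b1 b2.
  rewrite pointK -/y (gtr0_norm h0) => H.
  have -> : q t' - Us (i :: s) t' x = (Us s t' y - Us s t' x - h * Us (i :: s) t' x) / h.
    by rewrite /q; field; rewrite gt_eqF.
  rewrite normrM normfV (gtr0_norm h0) ler_pdivrMr//.
  apply: le_trans H _; rewrite ler_pM2r// mulrAC ler_pdivrMr ?ltr_wpDl//.
  by rewrite ler_wpM2l ?(ltW e4)// lerDl.
have cq : q t' @[t' --> F] --> q t.
  have c1 : Us s t' y @[t' --> F] --> Us s t y := iffLR (subspace_continuousP _ _) (IH y) t t0.
  have c2 : Us s t' x @[t' --> F] --> Us s t x := iffLR (subspace_continuousP _ _) (IH x) t t0.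
  exact: cvgMr_tmp (cvgB c1 c2).
have nA : \forall t' \near F, 0 <= t'.
  apply: filterS (withinT _ _) => t' /=.
  by rewrite in_itv/= andbT.
near=> t'.
have t'0 : 0 <= t' by near: t'; exact: nA.
have t00 : 0 <= t by move: t0; rewrite /= in_itv/= andbT.
have H1 := Hq t t00; have H2 := Hq t' t'0.
have H3 : `|q t - q t'| < e / 4 by near: t'; move/cvgrPdist_lt : cq; apply.
have -> : Us (i :: s) t x - Us (i :: s) t' x =
  (Us (i :: s) t x - q t) + (q t - q t') + (q t' - Us (i :: s) t' x) by ring.
apply: le_lt_trans (ler_normD _ _) _.
have := ler_normD (Us (i :: s) t x - q t) (q t - q t').
move: H1; rewrite distrC; move: H2 H3.
set a := `|_|; set b := `|_|; set c := `|_|; set d := `|_|; lra.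
Unshelve. all: by end_near. Qed.

Lemma measurable_Us s x : measurable_fun (`[0, +oo[%classic : set R) (fun t => Us s t x).
Proof. by apply: subspace_continuous_measurable_fun => //; exact: continuous_Us. Qed.

Lemma integrable_Us s x : leb.-integrable `[0, +oo[ (EFin \o (fun t => Us s t x)).
Proof.
by apply: (integrable_decay m0 (C := C s)) => [|t t0]; [exact: measurable_Us|exact: bU].
Qed.

Definition Vs s x : R := \int[leb]_(t in `[0, +oo[) Us s t x.

Lemma Vs_le s x : `|Vs s x| <= C s / m.
Proof.
have := Rintegral_decay_le m0 (lexx 0) (measurable_Us s x) (fun t t0 => bU s x t0).
by rewrite [X in _ * X]/expd mulr0 expR0 mulr1.
Qed.

(** A linear estimate on finitely many values, with the decay factor, integrates to the same
    estimate for [Vs]. Both the Lipschitz bound and the derivative of [Vs] come from it. *)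
Lemma Vs_comb_le (I : Type) (r : seq I) (a : I -> R) (w : I -> seq 'I_D) (z : I -> M)
    (K : R) :
  (forall t, 0 <= t -> `|\sum_(i <- r) a i * Us (w i) t (z i)| <= K * expd m t) ->
  `|\sum_(i <- r) a i * Vs (w i) (z i)| <= K / m.
Proof.
move=> H.
have [iF <-] := @Rintegral_lincomb _ _ _ leb `[0, +oo[%classic I r a
  (fun i t => Us (w i) t (z i)) (measurable_itv _) (fun i => integrable_Us _ _).
have mf := iffLR (measurable_EFinP _ _) (measurable_int _ iF).
have := Rintegral_decay_le m0 (lexx 0) mf H.
by rewrite [X in _ * X]/expd mulr0 expR0 mulr1.
Qed.

Lemma Vs_lipschitz s y z : `|Vs s z - Vs s y| <= (D%:R * bnd s) / m * dist g y z.
Proof.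
have := @Vs_comb_le bool [:: true; false] (fun b => if b then 1 else -1) (fun=> s)
  (fun b => if b then z else y) (D%:R * bnd s * dist g y z).
rewrite !big_cons big_nil addr0 mul1r mulN1r.
have -> : D%:R * bnd s * dist g y z / m = D%:R * bnd s / m * dist g y z by ring.
apply=> t t0; rewrite !big_cons big_nil addr0 mul1r mulN1r.
apply: le_trans (lipschitz_vder EF MC y z (smooth_Us s t0) _ (fun i q => bnd1 s i q t0)) _.
  by rewrite mulr_ge0 ?bnd_ge0// ltW// expd_gt0.
by rewrite !mulrA [leLHS]mulrAC.
Qed.

Lemma continuous_Vs s : continuous (Vs s).
Proof.
move=> y; apply/cvgrPdist_lt => e e0.
pose K := D%:R * bnd s / m.
have K0 : 0 <= K by rewrite divr_ge0 ?(ltW m0)// mulr_ge0// bnd_ge0.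
have d0 : 0 < e / (K + 1) by rewrite divr_gt0// ltr_wpDl.
apply: filterS (dist_near EF MC y d0) => z; rewrite ltr_pdivlMr ?ltr_wpDl// => H.
rewrite distrC; apply: le_lt_trans (Vs_lipschitz s y z) _.
by apply: le_lt_trans H; rewrite mulrC ler_wpM2l ?(dist_ge0 EF MC)// lerDl.
Qed.

Lemma is_derive_Vs s x p w : img x p ->
  is_derive p w ((Vs s \o pnt x) : 'rV[R]_D -> R^o)
    (\sum_j chart_coef E x p w 0 j * Vs (j :: s) (pnt x p)).
Proof.
move=> ip; set l := \sum_j _.
have H : h^-1 *: ((((Vs s \o pnt x) : 'rV[R]_D -> R^o) \o shift p) (h *: w)
    - (Vs s \o pnt x) p) @[h --> 0^'] --> (l : R^o).
  apply/cvgrPdist_le => e e0.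
  pose e' := e * m / (bnd s + 1).
  have e'0 : 0 < e' by rewrite divr_gt0 ?mulr_gt0// ltr_wpDl// bnd_ge0.
  have Heq := equidifferentiable EF MC w ip e'0.
  near=> h.
  have h0 : h != 0 by near: h; exact: nbhs_dnbhs_neq.
  have Hh : `|Vs s (pnt x (p + h *: w)) - Vs s (pnt x p) - h * l| <= e' * bnd s * `|h| / m.
    (* The increment minus its linear part as one combination: [inl (Some true)] stands for the
       value at the displaced point, [inl (Some false)] for the value at the base point, and [inr j]
       for the frame derivatives. *)
    have := @Vs_comb_le (option bool + 'I_D)
      (inl (Some true) :: inl (Some false) :: [seq inr j | j <- index_enum 'I_D])
      (fun k => match k with inl (Some true) => 1 | inl _ => -1
         | inr j => - (h * chart_coef E x p w 0 j) end)
      (fun k => match k with inl _ => s | inr j => j :: s end)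
      (fun k => match k with inl (Some true) => pnt x (p + h *: w) | _ => pnt x p end)
      (e' * bnd s * `|h|).
    rewrite !big_cons big_map mul1r mulN1r addrA.
    have -> : \sum_j - (h * chart_coef E x p w 0 j) * Vs (j :: s) (pnt x p) = - (h * l).
      rewrite /l mulr_sumr -sumrN; apply: eq_bigr => j _.
      by rewrite mulNr mulrA.
    apply=> t t0.
    rewrite !big_cons big_map mul1r mulN1r addrA.
    have -> : \sum_j - (h * chart_coef E x p w 0 j) * Us (j :: s) t (pnt x p) =
        - (h * 'D_w ((Us s t \o pnt x) : 'rV[R]_D -> R^o) p).
      rewrite (derive_chart_frame EF) ?mulr_sumr -?sumrN//; last exact: smooth_Us.
      by apply: eq_bigr => j _; rewrite mulNr mulrA.
    have B0 : 0 <= bnd s * expd m t by rewrite mulr_ge0 ?bnd_ge0// ltW// expd_gt0.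
    have Hn : forall psi B, smooth psi -> 0 <= B ->
      (forall i z, `|vder (E i) psi z| <= B) ->
      (forall i j z, `|vder (E j) (vder (E i) psi) z| <= B) ->
      `|psi (pnt x (p + h *: w)) - psi (pnt x p)
        - h * 'D_w ((psi \o pnt x) : 'rV[R]_D -> R^o) p| <= e' * B * `|h|.
      by near: h; exact: nbhs_dnbhs.
    apply: le_trans (Hn _ _ (smooth_Us s t0) B0 (fun i q => bnd1 s i q t0) (fun i j z => bnd2 s i j z t0)) _.
    by rewrite !mulrA [leLHS]mulrAC.
  have -> : l - h^-1 *: ((((Vs s \o pnt x) : 'rV[R]_D -> R^o) \o shift p) (h *: w)
      - (Vs s \o pnt x) p) =
      - (h^-1 * (Vs s (pnt x (p + h *: w)) - Vs s (pnt x p) - h * l)).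
    by rewrite /GRing.scale/= [h *: w + p]addrC; field.
  rewrite normrN normrM normfV ler_pdivrMl ?normr_gt0//.
  apply: le_trans Hh _.
  have b0 := bnd_ge0 s; have b1 : 0 < bnd s + 1 by rewrite ltr_wpDl.
  have -> : e' * bnd s * `|h| / m = `|h| * (e * bnd s / (bnd s + 1)).
    by rewrite /e'; field; rewrite !gt_eqF.
  by rewrite ler_wpM2l// ler_pdivrMr// ler_wpM2l ?(ltW e0)// lerDl.
split; first by apply/cvg_ex; exists l.
by apply: cvg_lim H.
Unshelve. all: by end_near. Qed.

(** The derivatives of [Vs s] are combinations of the [Vs (j :: s)] with smooth coefficients, so the
    induction on [k] runs over all words [s]. *)
Lemma Ck_on_Vs k s x : Ck_on k (img x) ((Vs s \o pnt x) : 'rV[R]_D -> R^o).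
Proof.
elim: k s => [|k IH] s.
  split=> // p ip; apply: continuous_comp; first exact: continuous_point.
  exact: continuous_Vs.
split=> [p ip|w].
  by apply: continuous_comp; [exact: continuous_point|exact: continuous_Vs].
split; first by move=> p /(is_derive_Vs s w)[].
apply: (@Ck_on_eq _ _ _ _ _ ((fun p => \sum_j chart_coef E x p w 0 j *
   (Vs (j :: s) \o pnt x) p) : 'rV[R]_D -> R^o)); first exact: open_img.
  by move=> p /(is_derive_Vs s w)[_ ->].
apply: (@Ck_on_sum _ _ R^o); first exact: open_img.
by move=> j; apply: Ck_onM; [exact: open_img|exact: (Ck_on_chart_coef EF)|exact: IH].
Qed.

Lemma smooth_Vs s : smooth (Vs s).
Proof. by move=> x k; exact: Ck_on_Vs. Qed.

Lemma frame_der_Vs s : frame_der E s (Vs [::]) = Vs s.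
Proof.
elim: s => //= i s ->; apply/funext => x; rewrite /vder /dphi.
have [_ ->] := is_derive_Vs s (E i x) (img_center x).
rewrite (chart_coef_center EF) pointK (bigD1 i)//= mxE !eqxx mul1r big1 ?addr0// => j ji.
by rewrite mxE (negPf ji) andbF mul0r.
Qed.

(** The generator passes under the integral, where it becomes the time derivative of [U]; as [U]
    vanishes at infinity, only the value at time 0 remains. *)
Lemma generator_Vs (f : 'I_D -> M -> R) x :
  (forall t : R, 0 < t ->
     is_derive (t : R) (1 : R) (fun t => U t x) (generator E f (U t) x)) ->
  generator E f (Vs [::]) x = - U 0 x.
Proof.
move=> dU.
pose h t := generator E f (U t) x.
have hE t : h t = \sum_d (f d x * Us [:: d] t x + Us [:: d; d] t x) by [].
(* [Rintegral_derive_decay] takes one constant for the function and its derivative, so [K] dominates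
   both [U] and its image by the generator at [x]. *)
pose K := C [::] + \sum_d (`|f d x| * C [:: d] + C [:: d; d]).
have K1 : C [::] <= K.
  by rewrite /K lerDl sumr_ge0// => d _; rewrite addr_ge0// mulr_ge0.
have K0 : 0 <= K by exact: le_trans K1.
have ch : {within `[0, +oo[, continuous h}.
  apply/subspace_continuousP => t t0.
  set F := within _ _.
  have H d : f d x * Us [:: d] t' x + Us [:: d; d] t' x @[t' --> F] -->
      f d x * Us [:: d] t x + Us [:: d; d] t x.
    have c1 : Us [:: d] t' x @[t' --> F] --> Us [:: d] t x :=
      iffLR (subspace_continuousP _ _) (@continuous_Us [:: d] x) t t0.
    have c2 : Us [:: d; d] t' x @[t' --> F] --> Us [:: d; d] t x :=
      iffLR (subspace_continuousP _ _) (@continuous_Us [:: d; d] x) t t0.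
    by apply: cvgD c2; exact: cvgMl_tmp c1.
  have H' := @cvg_sumr R R F _ R _ (index_enum 'I_D) xpredT
    (fun d t => f d x * Us [:: d] t x + Us [:: d; d] t x) _ H.
  exact: H'.
have <- : \int[leb]_(t in `[0, +oo[) h t = - U 0 x.
  apply: (@Rintegral_derive_decay _ m m0 (fun t => U t x) h K) => //.
  - move=> t t0; rewrite hE (le_trans (ler_norm_sum _ _ _))//.
    rewrite /K mulrDl (le_trans _ (_ : (\sum_d (`|f d x| * C [:: d] + C [:: d; d])) * expd m t <= _))//.
      rewrite mulr_suml; apply: ler_sum => d _.
      rewrite (le_trans (ler_normD _ _))// mulrDl lerD//; last exact: bU.
      by rewrite normrM -mulrA ler_wpM2l//; exact: bU.
    by rewrite lerDr mulr_ge0// ltW// expd_gt0.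
  - move=> t t0; apply: le_trans (bU [::] x t0) _.
    by rewrite ler_wpM2r// ltW// expd_gt0.
rewrite /generator; rewrite -/(Vs [::]).
have lin (a : 'I_D -> R) (w : 'I_D -> seq 'I_D) := @Rintegral_lincomb _ _ _ leb
  `[0, +oo[%classic _ (index_enum 'I_D) a (fun d t => Us (w d) t x) (measurable_itv _)
  (fun d => integrable_Us _ _).
have [i1 e1] := lin (fun d => f d x) (fun d => [:: d]).
have [i2 e2] := lin (fun=> 1) (fun d => [:: d; d]).
have -> : h = (fun t => \sum_d f d x * Us [:: d] t x + \sum_d 1 * Us [:: d; d] t x).
  by apply/funext => t; rewrite hE big_split/=; congr (_ + _); apply: eq_bigr => d _; rewrite mul1r.
rewrite RintegralD// e1 e2 -big_split/=.
apply: eq_bigr => d _.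
have -> : vder (E d) (Vs [::]) = Vs [:: d] := frame_der_Vs [:: d].
have -> : vder (E d) (Vs [:: d]) = Vs [:: d; d].
  by rewrite -[RHS]frame_der_Vs -[X in vder _ X]frame_der_Vs.
by rewrite mul1r.
Qed.

End Potential.

Lemma is_derive_near_ge {R : realType} (F : R -> R) (l k : R) :
  is_derive (0 : R) (1 : R) F l -> k < l ->
  \forall s \near (0 : R), 0 <= s -> F 0 + k * s <= F s.
Proof.
move=> [dF <-] kl.
have cv : (h^-1 *: (F (h *: (1 : R) + 0) - F 0)) @[h --> (0 : R)^'] --> 'D_(1 : R) F 0.
  by move/cvg_ex : dF => [l' H]; rewrite /derive (cvg_lim _ H).
have {}cv : \forall s \near (0 : R), s != 0 -> k < s^-1 *: (F (s *: (1 : R) + 0) - F 0).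
  exact: cvgr_gt _ cv _ kl.
apply: filterS cv => s H s0.
have [->|sn0] := eqVneq s 0; first by rewrite mulr0 addr0.
have {}s0 : 0 < s by rewrite lt_neqAle eq_sym sn0.
move: (H sn0); rewrite addr0 /GRing.scale /= mulr1.
by rewrite mulrC ltr_pdivlMr// ltrBrDl => /ltW.
Qed.

Lemma vderZ {R : realType} {D : nat} {M : manifold R D} (V : M -> 'rV[R]_D) (a : R)
    (phi : M -> R) x : smooth phi -> vder V (fun z => a * phi z) x = a * vder V phi x.
Proof.
move=> sphi; rewrite /vder /dphi.
have df := @diff_derivable _ _ _ _ _ (V x) (smooth_differentiable sphi (img_center x)).
exact: (@deriveZ _ _ R^o _ a _ _ df).
Qed.

(** * Maximum principle: a potential with positive generator at infinity forces r to be bounded *)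

Section Reach.
Context {R : realType} {D : nat} {M : manifold R D}.
Variables (g : metric M) (E : 'I_D -> M -> 'rV[R]_D).
Hypothesis EF : orthonormal_frame g E.
Hypothesis MC : connected [set: M].
Hypothesis gC : metric_complete g.
Implicit Types (phi psi : M -> R) (x y z : M).

Local Notation dist := (dist g).

(** A straight step in the chart centered at [x]: it agrees with the flow of [sg E i] to first order
    only, which is all that is used. *)
Definition frame_shift x i (sg s : R) : M := pnt x (crd x x + s *: (sg *: E i x)).

Lemma frame_shift0 x i sg : frame_shift x i sg 0 = x.
Proof. by rewrite /frame_shift scale0r addr0 pointK. Qed.

Lemma is_derive_frame_shift phi x i sg : smooth phi ->
  is_derive (0 : R) (1 : R) (fun s => phi (frame_shift x i sg s)) (sg * vder (E i) phi x).
Proof.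
move=> sphi.
have df := smooth_differentiable sphi (img_center x).
have H : is_derive (crd x x) (sg *: E i x) ((phi \o pnt x) : 'rV[R]_D -> R^o)
    (sg * vder (E i) phi x).
  split; first exact: diff_derivable.
  by rewrite deriveE// linearZ/= -deriveE.
have /is_derive_line := H.
have -> : (fun h : R => (phi \o pnt x) (h *: (sg *: E i x) + crd x x)) =
  (fun s => phi (frame_shift x i sg s)) by apply/funext => s /=; rewrite /frame_shift addrC.
by [].
Qed.

(* Replaces the flow of the field [sg E i]: the extremal [t] for which some [y]
   satisfies the differential inequalities with room to spare cannot be
   smaller than [s], since a small chart step from [y] enlarges it. *)
Lemma reach phi x i (sg delta K : R) : smooth phi -> `|sg| = 1 -> 0 < delta -> 0 < K ->
  (forall z, `|vder (E i) (vder (E i) (vder (E i) phi)) z| < K) ->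
  delta <= vder (E i) (vder (E i) phi) x -> 0 <= sg * vder (E i) phi x ->
  let s := delta / (2 * K) in
  exists y, dist x y <= 4 * s /\ phi x + delta / 32 * s ^+ 2 <= phi y.
Proof.
move=> sphi sg1 d0 K0 bK dx ax s.
have s0 : 0 < s by rewrite divr_gt0// mulr_gt0.
have sgsg : sg * sg = 1 by rewrite -expr2 -real_normK ?num_real// sg1 expr1n.
pose b z := sg * vder (E i) phi z; pose c := vder (E i) (vder (E i) phi).
have sE := smooth_field_frame EF i.
have s1 : smooth (vder (E i) phi) by exact: sE.
have s2 : smooth c by exact: sE.
have sb : smooth b by apply: smoothM s1; exact: smooth_cst.
(* An integral curve would give [c >= delta - K * t >= delta / 2] up to time [s], hence
   [b >= delta / 2 * t] and [phi >= phi x + delta / 4 * t ^+ 2]. The strict bound by [K] and the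
   smaller constants in [P] leave a margin in every slope. Since [b] may vanish at time 0, the
   growth of [phi] needs the slack [eta], chosen so that [delta / 32 * s ^+ 2] is still gained at
   [t = s]. *)
pose eta := delta / 32 * s.
pose P (q : R * M) := [/\ dist x q.2 <= 4 * q.1, delta - K * q.1 <= c q.2,
  delta / 4 * q.1 <= b q.2 & phi x + delta / 16 * q.1 ^+ 2 - eta * q.1 <= phi q.2].
pose S := (`[0, s]%classic `*` dball g x (4 * s)) `&` [set q | P q].
have cS : compact S.
  apply: compact_closedI.
    by apply: compact_setX; [exact: segment_compact|exact: (dball_compact EF)].
  have cl (F G : R * M -> R) : continuous F -> continuous G -> closed [set q | F q <= G q].
    move=> cF cG; rewrite (_ : [set q | _] = (fun q => G q - F q) @^-1` [set t | 0 <= t]).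
      apply: closed_comp => [q _|]; last exact: closed_ge.
      by apply: cvgB; [exact: cG|exact: cF].
    by apply/seteqP; split => q /=; rewrite subr_ge0.
  have c1 : continuous (fst : R * M -> R) by move=> ?; exact: cvg_fst.
  have c2 (F : M -> R) : continuous F -> continuous (F \o (snd : R * M -> M)).
    by move=> cF q; apply: continuous_comp; [exact: cvg_snd|exact: cF].
  have cM (a : R) (F : R * M -> R) : continuous F -> continuous (fun q => a * F q).
    by move=> cF q; apply: cvgM; [exact: cvg_cst|exact: cF].
  have cD (F G : R * M -> R) : continuous F -> continuous G -> continuous (fun q => F q + G q).
    by move=> cF cG q; apply: cvgD; [exact: cF|exact: cG].
  have cN (F : R * M -> R) : continuous F -> continuous (fun q => - F q).
    by move=> cF q; apply: cvgN; exact: cF.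
  have cX (F : R * M -> R) : continuous F -> continuous (fun q => F q ^+ 2).
    by move=> cF q; rewrite /continuous_at; under eq_fun do rewrite expr2;
      rewrite expr2; apply: cvgM; exact: cF.
  have cc (a : R) : continuous (cst a : R * M -> R) by move=> q; exact: cvg_cst.
  have -> : [set q | P q] = [set q | dist x q.2 <= 4 * q.1] `&`
     [set q | delta - K * q.1 <= c q.2] `&` [set q | delta / 4 * q.1 <= b q.2] `&`
     [set q | phi x + delta / 16 * q.1 ^+ 2 - eta * q.1 <= phi q.2].
    apply/seteqP; split=> q; first by case.
    by move=> [[[]]]; split.
  apply: closedI; [apply: closedI; [apply: closedI|]|]; apply: cl.
  - by apply: c2; exact: (dist_continuous EF).
  - exact: cM.
  - by apply: cD; [exact: cc|apply: cN; exact: cM].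
  - by apply: c2; exact: continuous_smooth.
  - exact: cM.
  - by apply: c2; exact: continuous_smooth.
  - by apply: (cD); [apply: (cD); [exact: cc|apply: (cM); exact: cX]|apply: cN; exact: cM].
  - by apply: c2; exact: continuous_smooth.
have S0 : S !=set0.
  exists (0, x); split; first split=> /=.
  - by rewrite in_itv/= lexx ltW.
  - by rewrite /dball/= (distxx EF)// mulr_ge0// ltW.
  by split=> /=; rewrite ?(distxx EF)// ?mulr0// ?subr0// expr0n/= ?mulr0 ?addr0.
have [[t y] /set_mem[[/= + _] [/= h1 h2 h3 h4]] tmax] : exists2 q, q \in S & forall q', q' \in S -> q'.1 <= q.1.
  apply: (@compact_EVT_max _ _ fst S) => //.
  by apply: continuous_subspaceT => q; exact: cvg_fst.
rewrite in_itv/= => /andP[t0 ts].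
have Ks : K * s = delta / 2 by rewrite /s; field; rewrite gt_eqF.
have [ts'|st] := ltP t s; last first.
  have <- : t = s by apply/le_anti/andP.
  exists y; split=> //; apply: le_trans h4.
  have -> : t = s by apply/le_anti/andP.
  by rewrite /eta -addrA lerD2l; lra.
exfalso.
have cy : delta / 2 <= c y.
  apply: le_trans h2; rewrite lerBrDr -lerBrDl (_ : delta - delta / 2 = delta / 2); last by field.
  by rewrite -Ks ler_pM2l// ltW.
have D1 : \forall h \near (0 : R), dist y (frame_shift y i sg h) <= 4 * `|h| by exact: (dist_line EF).
have D2 : \forall h \near (0 : R), 0 <= h -> c y + (- K) * h <= c (frame_shift y i sg h).
  have := is_derive_near_ge (is_derive_frame_shift y i sg s2); rewrite frame_shift0; apply.
  suff /ltr_normlP[+ _] : `|sg * vder (E i) c y| < K by rewrite ltrNl.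
  by rewrite normrM sg1 mul1r; exact: bK.
have D3 : \forall h \near (0 : R), 0 <= h -> b y + (delta / 4) * h <= b (frame_shift y i sg h).
  have := is_derive_near_ge (is_derive_frame_shift y i sg sb); rewrite frame_shift0; apply.
  by rewrite vderZ// mulrA sgsg mul1r -/c; lra.
have eta0 : 0 < eta by rewrite mulr_gt0// divr_gt0.
have D4 : \forall h \near (0 : R), 0 <= h ->
    phi y + (delta / 8 * t - eta / 2) * h <= phi (frame_shift y i sg h).
  have := is_derive_near_ge (is_derive_frame_shift y i sg sphi); rewrite frame_shift0; apply.
  apply: lt_le_trans h3; have : 0 <= delta * t by rewrite mulr_ge0// ltW.
  by lra.
have D5 : \forall h \near (0 : R), `|h| <= s - t by apply: (@nbhs0_le _ R); rewrite subr_gt0.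
(* With [h <= s / 4] the quadratic term [delta / 16 * h ^+ 2] is absorbed by the remaining slack
   [eta / 2 * h]. *)
have D6 : \forall h \near (0 : R), `|h| <= s / 4 by apply: (@nbhs0_le _ R); rewrite divr_gt0.
have [r /= r0 Hr] := iffLR (@nbhs_ballP _ R^o 0 _) (filterI (filterI (filterI D1 D2) (filterI D3 D4)) (filterI D5 D6)).
pose h := r / 2; have h0 : 0 < h by rewrite divr_gt0.
have [|[[d1 d2] [d3 d4]] [d5 d6]] := Hr h.
  by rewrite /ball/= sub0r normrN gtr0_norm// /h; lra.
move: d1 d2 d3 d4 d5 d6; rewrite gtr0_norm// => d1 /(_ (ltW h0)) d2 /(_ (ltW h0)) d3 /(_ (ltW h0)) d4 d5 d6.
have : t + h <= t; last by rewrite gerDl leNgt h0.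
have d7 : dist x (frame_shift y i sg h) <= 4 * (t + h).
  by rewrite (le_trans (dist_tri EF MC _ y _))// mulrDr lerD.
have A1 : delta - K * (t + h) <= c (frame_shift y i sg h).
  by rewrite mulrDr opprD addrA; apply: le_trans d2; rewrite mulNr lerD2r.
have A2 : delta / 4 * (t + h) <= b (frame_shift y i sg h).
  by rewrite mulrDr; apply: le_trans d3; rewrite lerD2r.
have A3 : phi x + delta / 16 * (t + h) ^+ 2 - eta * (t + h) <= phi (frame_shift y i sg h).
  apply: le_trans d4.
  have hs : delta * h * h <= delta * h * (s / 4) by rewrite ler_pM2l// mulr_gt0.
  by move: h4 hs; rewrite /eta; clear; move: (phi x) (phi y) => u v; lra.
have th : t + h <= s by rewrite -lerBrDl.
have A4 : dist x (frame_shift y i sg h) <= 4 * s by apply: (le_trans d7); exact: ler_wpM2l.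
have A5 : `[0, s]%classic (t + h).
  by rewrite /= in_itv/= th addr_ge0 ?(ltW h0).
have Sh : S (t + h, frame_shift y i sg h) by exact: (conj (conj A5 A4) (And4 d7 A1 A2 A3)).
exact: (tmax _ (mem_set Sh)).
Qed.

End Reach.

Lemma ln_sub_le {R : realType} (a b : R) : 0 < a -> 0 < b -> ln b - ln a <= (b - a) / a.
Proof.
move=> a0 b0; rewrite -ln_div ?posrE//.
have : ln (1 + (b / a - 1)) <= b / a - 1.
  by apply: le_ln1Dx; rewrite ltrBrDl subrr divr_gt0.
by rewrite addrC subrK mulrBl divff// gt_eqF.
Qed.

Section Recurrence.
Context {R : realType} {D : nat} {M : manifold R D}.
Variables (g : metric M) (E : 'I_D -> M -> 'rV[R]_D).
Hypothesis D_gt0 : (0 < D)%N.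
Hypothesis EF : orthonormal_frame g E.
Hypothesis MC : connected [set: M].
Hypothesis gC : metric_complete g.
Implicit Types (x y z o : M).

Local Notation dist := (dist g).

Lemma ln_dist_le o x y : `|ln (1 + dist o y) - ln (1 + dist o x)| <= dist x y.
Proof.
have H z : 1 <= 1 + dist o z by rewrite lerDl (dist_ge0 EF).
have H0 z : 0 < 1 + dist o z by apply: lt_le_trans (H z).
have G a b : ln (1 + dist o b) - ln (1 + dist o a) <= dist a b.
  rewrite (le_trans (ln_sub_le (H0 _) (H0 _)))// ler_pdivrMr//.
  have : dist o b <= dist o a + dist a b by exact: (dist_tri EF).
  have := H a; have := dist_ge0 EF MC a b; have := dist_ge0 EF MC o a; nra.
by rewrite ler_norml G andbT lerNl opprB (dist_sym EF MC x y); exact: G.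
Qed.

(** The local Lipschitz constant of the penalty is of order [1 / (1 + r)], which balances the linear
    growth of the drift. The global bound [ln_dist_le] only serves for the point given by
    [reach]. *)
Lemma ln_dist_near_le o x y : dist x y <= 1 / 2 ->
  `|ln (1 + dist o y) - ln (1 + dist o x)| <= 2 * dist x y / (1 + dist o x).
Proof.
have H z : 1 <= 1 + dist o z by rewrite lerDl (dist_ge0 EF).
have H0 z : 0 < 1 + dist o z by apply: lt_le_trans (H z).
move=> xy; have d0 := dist_ge0 EF MC x y; have ox := dist_ge0 EF MC o x.
have oy := dist_ge0 EF MC o y.
have t1 : dist o y <= dist o x + dist x y by exact: (dist_tri EF).
have t2 : dist o x <= dist o y + dist x y by rewrite (dist_sym EF MC x y); exact: (dist_tri EF).
rewrite ler_norml; apply/andP; split.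
  rewrite lerNl opprB (le_trans (ln_sub_le (H0 _) (H0 _)))//.
  by rewrite ler_pdivrMr// mulrAC ler_pdivlMr//; nra.
by rewrite (le_trans (ln_sub_le (H0 _) (H0 _)))// ler_pM2r ?invr_gt0//; lra.
Qed.

Lemma generator_pos_bounded o (f : 'I_D -> M -> R) (V : M -> R) (Cf m R0 : R) :
  smooth V -> (forall s, exists C, forall z, `|frame_der E s V z| <= C) ->
  0 < Cf -> (forall d x, `|f d x| <= Cf * (1 + dist o x)) -> 0 < m -> 0 <= R0 ->
  (forall x, R0 < dist o x -> m <= generator E f V x) ->
  exists r, forall x, dist o x <= r.
Proof.
move=> sV bV Cf0 bf m0 R00 gV; apply: contrapT => unb.
have {}unb r : exists x, r < dist o x.
  by apply: contrapT => H; apply: unb; exists r => x; rewrite leNgt; apply/negP => ?; apply: H; exists x.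
have [B0 {}B0P] := bV [::]; pose B : R := `|B0| + 1.
have B_gt0 : 0 < B by rewrite ltr_wpDl.
have bB z : `|V z| < B by rewrite (le_lt_trans (B0P z))// (le_lt_trans (ler_norm _))// ltrDl.
have [K3 K3P] := choice (fun i : 'I_D => bV [:: i; i; i]).
pose K : R := 1 + \sum_i `|K3 i|.
have K0 : 0 < K by rewrite ltr_pwDl// sumr_ge0.
have bK i z : `|vder (E i) (vder (E i) (vder (E i) V)) z| < K.
  rewrite (le_lt_trans (K3P i z))// (le_lt_trans (ler_norm _))//.
  have := @ler_sum_term _ _ (fun i => `|K3 i|) i (fun i => normr_ge0 _).
  by move=> H; rewrite (le_lt_trans H)// ltrDr.
have D0 : 0 < (D%:R : R) by rewrite ltr0n.
(* The drift takes at most [m / 2] of the generator, so one of the [D] second derivatives is at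
   least this large. *)
pose delta := m / (2 * D%:R).
have delta0 : 0 < delta by rewrite divr_gt0// mulr_gt0.
pose s := delta / (2 * K); have s0 : 0 < s by rewrite divr_gt0// mulr_gt0.
(* The first bound contradicts [reach]: the penalty allows an increase of at most
   [eps * (4 * s) <= delta * s ^+ 2 / 64], while [reach] gains [delta * s ^+ 2 / 32]. The second
   bound makes the drift term at most [m / 2]. *)
pose eps := Num.min (delta * s / 256) (m / (16 * D%:R * Cf)).
have Q0 : 0 < 16 * D%:R * Cf by apply: mulr_gt0 => //; exact: mulr_gt0.
have eps0 : 0 < eps.
  rewrite /eps lt_min; apply/andP; split; apply: divr_gt0 => //.
  exact: mulr_gt0.
have eps1 : eps <= delta * s / 256 by rewrite ge_min lexx.
have eps2 : 8 * D%:R * Cf * eps <= m / 2.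
  have : eps <= m / (16 * D%:R * Cf) by rewrite ge_min lexx orbT.
  rewrite ler_pdivlMr//; lra.
pose L y := ln (1 + dist o y).
have H0 z : 0 < 1 + dist o z by rewrite ltr_pwDl// (dist_ge0 EF).
(* [L z] exceeds [L] on the ball of radius [R0] by more than [2 * B / eps]. On that ball the penalty
   thus outweighs the oscillation of [V], which is less than [2 * B], and the maximum of [W] lies
   outside. *)
have [z zL] := unb (expR (2 * B / eps + ln (1 + R0) + 1)).
have {zL} : 2 * B / eps + ln (1 + R0) + 1 < L z.
  by rewrite -ltr_expR lnK ?posrE// (lt_trans zL)// ltrDr.
set Lam := L z => LamP.
pose W y := V y - eps * `|L y - Lam|.
have WzV : W z = V z by rewrite /W subrr normr0 mulr0 subr0.
have be : eps * (2 * B / eps) = 2 * B by rewrite mulrC divfK// gt_eqF.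
have Wfar y : 2 * B / eps <= `|L y - Lam| -> W y < W z.
  move=> H; have : 2 * B <= eps * `|L y - Lam| by rewrite -be ler_pM2l.
  rewrite WzV /W; have /ltr_normlP[_ ] := bB y; have /ltr_normlP[+ _] := bB z.
  by lra.
(* Outside of [Kc] the penalty exceeds the oscillation of [V] again, so the maximum of [W] on this
   compact ball is global. *)
pose Kc := dball g o (expR (Lam + 2 * B / eps)).
have cL : continuous L.
  move=> y; apply: continuous_comp; last exact: continuous_ln.
  by apply: cvgD; [exact: cvg_cst|exact: (dist_continuous EF)].
have cW : continuous W.
  move=> y; apply: cvgB; first exact: continuous_smooth.
  apply: cvgM; first exact: cvg_cst.
  by apply: cvg_norm; apply: cvgB; [exact: cL|exact: cvg_cst].
have zK : Kc z.
  rewrite /Kc /dball/= (@le_trans _ _ (expR Lam))//.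
    by rewrite lnK ?posrE// lerDr.
  by rewrite ler_expR lerDl divr_ge0// ?mulr_ge0// ltW.
have cK : compact Kc by exact: (dball_compact EF).
have [x _ xmax] := compact_EVT_max (ex_intro _ z zK : Kc !=set0) cK (continuous_subspaceT cW).
have {xmax} Wmax y : W y <= W x.
  have [yK|/negP yK] := pselect (Kc y); first by apply: xmax; exact: mem_set.
  rewrite (@le_trans _ _ (W z))//; last by apply: xmax; exact: mem_set.
  apply: ltW; apply: Wfar; rewrite ler_normr; apply/orP; left.
  rewrite lerBrDl -ler_expR lnK ?posrE//; move: yK; rewrite /Kc/dball/= -ltNge => /ltW/le_trans; apply.
  by rewrite lerDr.
have xR : R0 < dist o x.
  rewrite ltNge; apply/negP => xR0; have := Wmax z; rewrite leNgt => /negP; apply.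
  apply: Wfar; rewrite distrC ler_normr; apply/orP; left.
  have : L x <= ln (1 + R0) by rewrite ler_ln ?posrE ?lerD2l// ltr_pwDl.
  by move: LamP; lra.
have VL y : V y - V x <= eps * `|L y - L x|.
  have := Wmax y; rewrite /W => H.
  have T : `|L y - Lam| <= `|L x - Lam| + `|L y - L x|.
    by rewrite (le_trans _ (ler_normD _ _))// (_ : L x - Lam + (L y - L x) = L y - Lam)//; ring.
  have : eps * `|L y - Lam| <= eps * (`|L x - Lam| + `|L y - L x|) by rewrite ler_pM2l.
  by lra.
(* The factor 8 is the product of 4, from [dist_line], and 2, from [ln_dist_near_le]. The distance
   need not be differentiable, so the bound is read on a small increment. *)
have grad i (sg : R) : `|sg| = 1 -> sg * vder (E i) V x <= 8 * eps / (1 + dist o x).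
  move=> sg1; set k : R := 8 * eps / _; rewrite leNgt; apply/negP => kl.
  have N0 : (k + sg * vder (E i) V x) / 2 < sg * vder (E i) V x by lra.
  have N1 := is_derive_near_ge (is_derive_frame_shift E x i sg sV) N0.
  have N2 := dist_line EF MC x i sg1.
  have N3 : \forall h \near (0 : R), `|h| <= 1 / 8 by apply: (@nbhs0_le _ R).
  have [r /= r0 Hr] := iffLR (@nbhs_ballP _ R^o 0 _) (filterI (filterI N1 N2) N3).
  pose h := r / 2; have h0 : 0 < h by rewrite divr_gt0.
  have [|[n1 n2] n3] := Hr h.
    by rewrite /ball/= sub0r normrN gtr0_norm// /h; lra.
  move: n1 n2 n3; rewrite gtr0_norm// => /(_ (ltW h0)) n1 n2 n3; move: n1.
  rewrite frame_shift0 -lerBrDl => n1.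
  have := le_trans n1 (VL _); have : dist x (frame_shift E x i sg h) <= 1 / 2 by apply: le_trans n2 _; lra.
  move=> n45 n5; have n4 := ln_dist_near_le o n45.
  have : `|L (frame_shift E x i sg h) - L x| <= 8 * h / (1 + dist o x).
    by apply: le_trans n4 _; rewrite ler_pM2r ?invr_gt0//; move: n2; rewrite -/(frame_shift E x i sg h); lra.
  rewrite -(ler_pM2l eps0) (_ : eps * (8 * h / (1 + dist o x)) = k * h); last by rewrite /k; ring.
  move=> n6; have := le_trans n5 n6; rewrite ler_pM2r// => n7; lra.
have gradn i : `|vder (E i) V x| <= 8 * eps / (1 + dist o x).
  rewrite ler_norml; have := grad i 1 (normr1 _); rewrite mul1r => ->.
  by have := grad i (-1) (normrN1 _); rewrite mulN1r andbT lerNl.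
have drift : \sum_d f d x * vder (E d) V x <= m / 2.
  apply: le_trans eps2; rewrite (@le_trans _ _ (\sum_(d < D) 8 * Cf * eps))//; last first.
    by rewrite sumr_const card_ord -[leLHS]mulr_natr le_eqVlt; apply/orP; left; apply/eqP; ring.
  apply: ler_sum => i _; rewrite (le_trans (ler_norm _))// normrM.
  rewrite (le_trans (ler_pM (normr_ge0 _) (normr_ge0 _) (bf i x) (gradn i)))//.
  by rewrite le_eqVlt; apply/orP; left; apply/eqP; field; rewrite gt_eqF// H0.
have [i di] : exists i, delta <= vder (E i) (vder (E i) V) x.
  apply: contrapT => H.
  have : \sum_(i < D) vder (E i) (vder (E i) V) x < \sum_(i < D) delta.
    apply: ltr_sum => [|i _]; first by apply/hasP; exists (Ordinal D_gt0); rewrite // mem_index_enum.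
    by rewrite ltNge; apply/negP => ?; apply: H; exists i.
  rewrite sumr_const card_ord -mulr_natr (_ : delta * D%:R = m / 2); last by rewrite /delta; field; rewrite gt_eqF.
  by have := gV _ xR; rewrite /generator big_split/=; lra.
pose sg : R := if 0 <= vder (E i) V x then 1 else -1.
have sg1 : `|sg| = 1 by rewrite /sg; case: ifP => _; rewrite ?normrN normr1.
have sgV : 0 <= sg * vder (E i) V x.
  rewrite /sg; case: ifPn => [|]; first by rewrite mul1r.
  by rewrite -ltNge mulN1r oppr_ge0 => /ltW.
have [y [xy Vy]] := reach EF MC gC sV sg1 delta0 K0 (bK i) di sgV.
have : delta / 32 * s ^+ 2 <= eps * (4 * s).
  rewrite (@le_trans _ _ (V y - V x))//; first by rewrite lerBrDl.
  by rewrite (le_trans (VL y))// ler_pM2l// (le_trans (ln_dist_le _ _ _)).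
have : eps * (4 * s) <= delta * s / 256 * (4 * s) by rewrite ler_pM2r// mulr_gt0.
have : 0 < delta * s * s by apply: mulr_gt0 => //; exact: mulr_gt0.
by rewrite expr2; lra.
Qed.

End Recurrence.

(** * Borel functions, the support of a probability measure and frame norms *)

Section BorelFun.
Context {R : realType} {D : nat} {M : manifold R D}.

Lemma open_Borel (A : set M) : open A -> measurable (A : set (Borel M)).
Proof. by move=> oA; apply: sub_sigma_algebra. Qed.

Lemma measurable_continuous (phi : M -> R) : continuous phi ->
  measurable_fun setT (phi : Borel M -> R).
Proof.
move=> cphi; apply: (measurability _ (RGenOInfty.measurableE R)).
move=> _ [_ [a ->] <-]; rewrite setTI; apply: open_Borel.
by move/continuousP : cphi; apply; exact: interval_open.
Qed.

Lemma measurable_smooth (phi : M -> R) : smooth phi ->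
  measurable_fun setT (phi : Borel M -> R).
Proof. by move/continuous_smooth; exact: measurable_continuous. Qed.

(** A density is only known to be nonnegative, so the bump of [dist_bounded] has to be centered at a
    point of the support to have a positive mean. If every point had a null neighborhood, the null
    sets of a countable basis would cover M. *)
Lemma ex_support_point (mu : probability (Borel M) R) :
  exists x : M, forall U : set M, nbhs x U -> open U -> (0 < mu U)%E.
Proof.
apply: contrapT => H.
have {}H (x : M) : exists U : set M, [/\ nbhs x U, open U & mu U = 0%E].
  apply: contrapT => nU; apply: H; exists x => U xU oU.
  by rewrite lt_neqAle measure_ge0 andbT; apply/eqP => U0; apply: nU; exists U.
have [B cB [oB bB]] := @second_countable_manifold _ _ M.
have /countable_injP[f fi] := cB.
(* Null basic sets listed along the injection [f]: [F k] is the one of code [k], or empty. *)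
pose F k : set (Borel M) := \bigcup_(b in [set b | [/\ B b, f b = k & mu b = 0%E]]) b.
have nF k : mu.-negligible (F k).
  have [[b [Bb fb b0]]|nb] := pselect (exists b, [/\ B b, f b = k & mu b = 0%E]).
    have -> : F k = b.
      apply/seteqP; split=> x; last by move=> bx; exists b.
      by move=> [b' [Bb' fb' _]]; rewrite (fi b' b) ?inE// fb fb'.
    by exists b; split=> //; apply: open_Borel; exact: oB.
  have -> : F k = set0 by apply/seteqP; split=> // x [b Bb _]; apply: nb; exists b.
  exact: negligible_set0.
have [N [mN N0 TN]] := negligible_bigcup nF.
have NT : N = setT.
  apply/seteqP; split=> // x _; apply: TN.
  have [U [xU oU U0]] := H x.
  have [b [Bb bx] bU] := bB _ _ xU.
  exists (f b) => //; exists b => //; split=> //.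
  apply/eqP; rewrite eq_le measure_ge0 andbT -U0.
  have mb : measurable (b : set (Borel M)) by apply: open_Borel; exact: oB.
  have mU : measurable (U : set (Borel M)) by exact: open_Borel.
  exact: (@le_measure _ _ _ mu b U (mem_set mb) (mem_set mU) bU).
have := @probability_setT _ _ _ mu; rewrite -NT N0 => /eqP.
by rewrite eq_sym onee_eq0.
Qed.

Lemma Rintegral_pos (mu : probability (Borel M) R) (phi : M -> R) x :
  (forall U : set M, nbhs x U -> open U -> (0 < mu U)%E) ->
  continuous phi -> (forall z, 0 <= phi z) -> 0 < phi x ->
  mu.-integrable setT (EFin \o phi) -> 0 < \int[mu]_z phi z.
Proof.
move=> xmu cphi phi0 phix iphi.
pose U := phi @^-1` [set t | phi x / 2 < t].
have oU : open U by move/continuousP : cphi; apply; exact: open_gt.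
have xU : U x by rewrite /U/= ltr_pdivrMr// mulr_natr mulr2n ltrDl.
have mphi : measurable_fun setT (EFin \o phi : Borel M -> \bar R).
  by apply/measurable_EFinP; exact: measurable_continuous.
rewrite /Rintegral fine_gt0//; apply/andP; split; last first.
  by have := integrable_fin_num measurableT iphi; rewrite fin_numE => /andP[_]; rewrite ltey.
apply: (@lt_le_trans _ _ ((phi x / 2)%:E * mu U)%E).
  by rewrite mule_gt0 ?lte_fin ?divr_gt0//; apply: xmu => //; exact: open_nbhs_nbhs.
rewrite -integral_cst//; last exact: open_Borel.
apply: (@le_trans _ _ (\int[mu]_(z in U) (phi z)%:E)%E).
  apply: ge0_le_integral => //; first exact: open_Borel.
  - by move=> z _; rewrite lee_fin divr_ge0// ltW.
  - exact: measurable_funTS.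
  - by move=> z Uz; rewrite lee_fin ltW.
apply: ge0_subset_integral => //; first exact: open_Borel.
by move=> z _; rewrite lee_fin.
Qed.

End BorelFun.

Section FrameSup.
Context {R : realType} {D : nat} {M : manifold R D}.
Variable (E : 'I_D -> M -> 'rV[R]_D).
Implicit Types (phi psi : M -> R) (s : seq 'I_D).

Definition frame_bounded psi := forall s, exists C, forall x, `|frame_der E s psi x| <= C.

Lemma frame_bounded_uniform psi k : frame_bounded psi ->
  exists2 C, 0 <= C & forall s x, (size s <= k)%N -> `|frame_der E s psi x| <= C.
Proof.
move=> bpsi; have [B BP] := choice bpsi.
exists (\sum_(j < k.+1) \sum_(s : j.-tuple 'I_D) `|B s|).
  by apply: sumr_ge0 => j _; apply: sumr_ge0.
move=> s x; rewrite -ltnS => sk.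
rewrite (le_trans (BP s x))// (le_trans (ler_norm _))//.
have H1 := @ler_sum_term _ _ (fun t : (Ordinal sk).-tuple 'I_D => `|B t|) (in_tuple s) (fun=> normr_ge0 _).
apply: le_trans H1 _.
apply: (@ler_sum_term _ _ (fun j : 'I_k.+1 => \sum_(t : j.-tuple 'I_D) `|B t|) (Ordinal sk)).
by move=> i; apply: sumr_ge0.
Qed.

Lemma frame_sup_le a b psi (C : R) :
  (forall s x, (a <= size s <= b)%N -> `|frame_der E s psi x| <= C) ->
  (frame_sup E a b psi <= C%:E)%E.
Proof. by move=> H; apply: ge_ereal_sup => _ [s [x [sab ->]]]; rewrite lee_fin; exact: H. Qed.

Lemma le_frame_sup a b psi s x : (a <= size s <= b)%N ->
  ((`|frame_der E s psi x|)%:E <= frame_sup E a b psi)%E.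
Proof. by move=> H; apply: ereal_sup_ubound; exists s, x. Qed.

End FrameSup.

(** * Decay of the semigroup, the potential of a bounded function and boundedness of r *)

Section Sde.
Context {R : realType} {D : nat} {M : manifold R D}.
Variables (g : metric M) (E : 'I_D -> M -> 'rV[R]_D) (o : M) (f : 'I_D -> M -> R).
Hypothesis EF : orthonormal_frame g E.
Hypothesis MC : connected [set: M].
Context (d : measure_display) (T : measurableType d) (P : probability T R).
Variable (X : M -> R -> T -> M).
Hypothesis XK : backward_kolmogorov P g E f o X.
Variable muinf : probability (Borel M) R.
Hypothesis gap : spectral_gap P g E o X muinf.
Implicit Types (phi psi : M -> R) (s : seq 'I_D).

Local Notation u := (semigroup P X).
Local Notation mean phi := (\int[muinf]_y phi y).
Let sE := smooth_field_frame EF.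

Lemma frame_bounded_CP phi : smooth phi -> frame_bounded E phi -> CP g E o phi.
Proof.
move=> sphi bphi; split=> // s; have [C CP] := bphi s; exists `|C|, 0%N => x.
rewrite (le_trans (CP x))// (le_trans (ler_norm _))// ler_peMr//.
by rewrite expr0 lerDl.
Qed.

Definition centered phi t x : R := u phi t x - mean phi.

Lemma smooth_centered phi t : CP g E o phi -> 0 <= t -> smooth (centered phi t).
Proof.
move=> cphi t0; have [_ su _ _ _] := XK cphi.
by apply: smoothD; [exact: su|exact: smooth_cst].
Qed.

Lemma continuous_centered phi x : CP g E o phi ->
  {within `[0, +oo[, continuous (centered phi ^~ x)}.
Proof.
move=> cphi; have [_ _ _ cu _] := XK cphi.
by move=> t; apply: cvgB; [exact: cu|exact: cvg_cst].
Qed.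

Lemma vder_centered phi t i : CP g E o phi -> 0 <= t ->
  vder (E i) (centered phi t) = vder (E i) (u phi t).
Proof.
move=> cphi t0; have [_ su _ _ _] := XK cphi.
apply/funext => x; have := vderD (E i) x (su t t0) (smooth_cst (- mean phi)).
by rewrite vder_cst addr0.
Qed.

Lemma is_derive_centered phi x (t : R) : CP g E o phi -> 0 < t ->
  is_derive (t : R) (1 : R) (fun t => centered phi t x) (generator E f (centered phi t) x).
Proof.
move=> cphi t0; have [_ _ _ _ du] := XK cphi.
have -> : generator E f (centered phi t) x = generator E f (u phi t) x - 0.
  by rewrite subr0; apply: eq_bigr => i _; rewrite vder_centered// ltW.
have du' : is_derive (t : R) (1 : R) (fun t => u phi t x) (generator E f (u phi t) x) by exact: du.
have dc : is_derive (t : R) (1 : R) (cst (mean phi) : R -> R) 0 by exact: is_derive_cst.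
exact: (is_deriveB du' dc).
Qed.

(** The polynomial in the gap depends on the order of derivation. Giving up half of the rate absorbs
    it, so that one [m] serves all functions and all words, only the constants varying. *)
Lemma centered_decay : exists2 m : R, 0 < m & forall phi, CP g E o phi -> frame_bounded E phi ->
  exists2 C : seq 'I_D -> R, (forall s, 0 <= C s) &
    forall s t x, 0 <= t -> `|frame_der E s (centered phi t) x| <= C s * expd m t.
Proof.
have [lambda l0 gapP] := gap.
exists (lambda / 2); first by rewrite divr_gt0.
move=> phi cphi bphi.
suff /choice[C CP] : forall s, exists C, 0 <= C /\
    forall t x, 0 <= t -> `|frame_der E s (centered phi t) x| <= C * expd (lambda / 2) t.
  by exists C => [s|s t x]; [have [] := CP s|have [_] := CP s; exact].
move=> s; have [Q Q0 HQ] := gapP (size s).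
have [C1 C10 C1P] := poly_exp_decay Q l0.
have [B B0 BP] := frame_bounded_uniform (size s) bphi.
exists (C1 * B); split; first exact: mulr_ge0.
move=> t x t0.
have := HQ t phi t0 cphi => H.
have le1 := @le_frame_sup _ _ _ E 0%N (size s) (centered phi t) s x (leqnn _).
have QE : 0 <= Q.[t] * expR (- lambda * t) by rewrite mulr_ge0 ?expR_ge0// ltW// Q0.
have le2 : ((Q.[t] * expR (- lambda * t))%:E * Ck_norm E (size s) phi <=
    (Q.[t] * expR (- lambda * t) * B)%:E)%E.
  rewrite [leRHS]EFinM; apply: lee_wpmul2l; first by rewrite lee_fin.
  by apply: frame_sup_le => s' y /andP[_]; exact: BP.
have := le_trans (le_trans le1 H) le2; rewrite lee_fin => /le_trans; apply.
by rewrite [leRHS]mulrAC ler_wpM2r// C1P.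
Qed.

Lemma ex_potential : exists2 m : R, 0 < m & forall phi, CP g E o phi -> frame_bounded E phi ->
  let V x := \int[lebesgue_measure]_(t in `[0, +oo[) centered phi t x in
  exists2 C : seq 'I_D -> R, (forall s, 0 <= C s) &
  [/\ forall s t x, 0 <= t -> `|frame_der E s (centered phi t) x| <= C s * expd m t,
      forall s x, {within `[0, +oo[, continuous (fun t => frame_der E s (centered phi t) x)},
      smooth V /\ frame_bounded E V,
      forall s x, frame_der E s V x =
        \int[lebesgue_measure]_(t in `[0, +oo[) frame_der E s (centered phi t) x &
      forall x, generator E f V x = mean phi - phi x].
Proof.
have [m m0 H] := centered_decay.
exists m => // phi cphi bphi V; have [C C0 bU] := H phi cphi bphi.
have sU t : 0 <= t -> smooth (centered phi t) by exact: smooth_centered.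
have cU x : {within `[0, +oo[, continuous (centered phi ^~ x)} by exact: continuous_centered.
have VE : V = Vs E (centered phi) [::] by [].
exists C => //; split=> //.
- by move=> s x; exact: (continuous_Us EF MC m0 C0 sU cU bU).
- split; first by rewrite VE; exact: (smooth_Vs EF MC m0 C0 sU cU bU).
  move=> s; exists (C s / m) => x; rewrite VE (frame_der_Vs EF MC m0 C0 sU cU bU).
  exact: (Vs_le EF MC m0 C0 sU cU bU).
- by move=> s x; rewrite VE (frame_der_Vs EF MC m0 C0 sU cU bU).
move=> x; rewrite VE (generator_Vs EF MC m0 C0 sU cU bU (fun t t0 => is_derive_centered x cphi t0)).
by have [_ _ u0 _ _] := XK cphi; rewrite /centered u0 opprB.
Qed.

Hypothesis D_gt0 : (0 < D)%N.
Hypothesis gC : metric_complete g.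
Hypothesis fX : XP g E o f.
Hypothesis CPmu : forall phi, CP g E o phi -> muinf.-integrable setT (EFin \o phi).

(** The components have bounded differentials, hence are Lipschitz for the distance. *)
Lemma drift_growth : exists2 Cf, 0 < Cf & forall i x, `|f i x| <= Cf * (1 + dist g o x).
Proof.
have H i : exists2 C, 0 <= C & forall x, `|f i x| <= C * (1 + dist g o x).
  have [[sf _] [C bC]] := fX i.
  exists (`|C| + `|f i o|); first exact: addr_ge0.
  move=> x.
  have L := @lipschitz_dist _ _ _ g E EF MC (f i) `|C| sf (normr_ge0 _) _ o x.
  have {}L : `|f i x - f i o| <= `|C| * dist g o x.
    by apply: L => z v; rewrite (le_trans (bC z v))// ler_wpM2r ?sqrtr_ge0// ler_norm.
  rewrite -(subrK (f i o) (f i x)) (le_trans (ler_normD _ _))//.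
  have d0 := dist_ge0 EF MC o x.
  rewrite (le_trans (lerD L (lexx _)))//.
  have := normr_ge0 C; have := mulr_ge0 (normr_ge0 (f i o)) d0; lra.
have [C CP] := choice (fun i => let: ex_intro2 C a b := H i in ex_intro _ C (conj a b)).
exists (1 + \sum_i C i); first by rewrite ltr_pwDl// sumr_ge0// => i _; have [] := CP i.
move=> i x; have [_ H1] := CP i; rewrite (le_trans (H1 x))// ler_wpM2r//.
  by rewrite addr_ge0// (dist_ge0 EF).
have := @ler_sum_term _ _ C i (fun i => (CP i).1); lra.
Qed.

Lemma dist_bounded : exists r, forall x, dist g o x <= r.
Proof.
have [x0 x0P] := ex_support_point muinf.
have [r r0 rx] := nbhs_cball (nbhs_img (img_center x0)).
set phi := chart_ext x0 (box_bump (crd x0 x0) r).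
have sphi : smooth phi by exact: smooth_box_bump.
have cK := chart_ball_compact rx; have clK := chart_ball_closed rx.
have outK z : ~ chart_ball x0 r z -> phi z = 0.
  by apply: chart_ext_out rx _ => p; exact: box_bump_out.
have bphi : frame_bounded E phi.
  by move=> s; have [C _ CP] := bounded_frame_der sE s cK clK sphi outK; exists C.
have cphi := frame_bounded_CP sphi bphi.
have phi0 z : 0 <= phi z.
  by rewrite /phi /chart_ext; case: ifP => // _; exact: box_bump_ge0.
have phix : 0 < phi x0 by rewrite /phi chart_extE; [exact: box_bump_center|exact: dom_center].
have mpos := Rintegral_pos x0P (continuous_smooth sphi) phi0 phix (CPmu cphi).
have [m m0 /(_ phi cphi bphi)[C _ [_ _ [sV bV] _ gV]]] := ex_potential.
have [Cf Cf0 fP] := drift_growth.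
have x0K : chart_ball x0 r x0.
  by exists (crd x0 x0); rewrite ?pointK// /cball/= subrr normr0 ltW.
have cd : continuous (dist g o) by exact: (dist_continuous EF MC).
(* The point of the chart ball farthest from [o]: beyond its distance the bump vanishes and the
   generator of V equals the positive mean. *)
have [c _ cmax] := compact_EVT_max (ex_intro _ x0 x0K : chart_ball x0 r !=set0) cK
  (continuous_subspaceT cd).
apply: (generator_pos_bounded D_gt0 EF MC gC (o := o) (f := f) sV bV Cf0 fP mpos (dist_ge0 EF MC o c)).
move=> x cx; rewrite gV outK ?subr0// => Kx.
by have := cmax x (mem_set Kx); rewrite leNgt cx.
Qed.

End Sde.

(** * The averaged Talay-Tubaro expansion and the error on compact M *)

Section Numerics.
Context {R : realType} {D : nat} {M : manifold R D}.
Variables (g : metric M) (E : 'I_D -> M -> 'rV[R]_D) (o : M).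
Hypothesis EF : orthonormal_frame g E.
Hypothesis MC : connected [set: M].
Hypothesis cM : compact [set: M].
Implicit Types (phi psi : M -> R) (s : seq 'I_D).
Let sE := smooth_field_frame EF.

Lemma frame_bounded_smooth phi : smooth phi -> frame_bounded E phi.
Proof.
move=> sphi s; have [C _ H] := bounded_frame_der sE s cM closedT sphi (fun z nz => False_ind _ (nz I)).
by exists C.
Qed.

Lemma CP_smooth phi : smooth phi -> CP g E o phi.
Proof. by move=> sphi; apply: frame_bounded_CP => //; exact: frame_bounded_smooth. Qed.

Lemma bounded_smooth phi : smooth phi -> exists2 C, 0 <= C & forall x, `|phi x| <= C.
Proof.
move=> sphi; have [C C0 H] := frame_bounded_uniform 0 (frame_bounded_smooth sphi).
by exists C => // x; exact: (H [::]).
Qed.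

Lemma integrable_smooth (mu : probability (Borel M) R) phi : smooth phi ->
  mu.-integrable setT (EFin \o phi).
Proof.
move=> sphi; have [C _ H] := bounded_smooth sphi.
exact: integrable_bounded (measurable_smooth sphi) H.
Qed.

Lemma smooth_diffop m (B : (M -> R) -> (M -> R)) phi : diffop E m B -> smooth phi ->
  smooth (B phi).
Proof.
move=> [b sb HB] sphi; rewrite (funext (HB phi sphi)).
apply: smooth_sum => k; apply: smooth_sum => s.
by apply: smoothM => //; exact: smooth_frame_der.
Qed.

Context (dS : measure_display) (S : measurableType dS) (N : probability S R).
Variables (Psi : R -> S -> M -> M) (A : nat -> (M -> R) -> (M -> R)).
Hypothesis Psi_meas : measurable_method Psi.
Hypothesis TT : talay_tubaro g E o N Psi A.
Variables (h1 : R) (nu : R -> probability (Borel M) R).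
Hypothesis h1_gt0 : 0 < h1.
Hypothesis nu_inv : forall h, 0 < h < h1 ->
  Defs.invariant (fun (x : M) (B : set (Borel M)) => N [set s | B (Psi h s x)]) (nu h).

Lemma smooth_A j phi : (1 <= j)%N -> smooth phi -> smooth (A j phi).
Proof. by move=> j1 sphi; apply: smooth_diffop sphi; apply TT.1. Qed.

(** In the expansion of order [j] of a constant the remainder vanishes, because the seminorm starts
    at order 1; the lower terms vanish by induction, which leaves [h ^+ j * A j (cst c) x = 0] for
    some positive [h]. This makes [u] and [u - m] interchangeable in the leading term. *)
Lemma talay_tubaro_cst j c x : (1 <= j)%N -> A j (cst c) x = 0.
Proof.
elim/ltn_ind: j => j IH j1.
have [C [kappa [C_gt0 /(_ (cst c) (CP_smooth (smooth_cst c)))[h0 h0_gt0 H]]]] := TT.2 j j1.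
pose h := h0 / 2.
have hh : 0 < h < h0 by rewrite divr_gt0//= ltr_pdivrMr// mulr_natr mulr2n ltrDl.
have [rem remE remB] := H h hh.
have sem : (Ck_seminorm E (2 * j + 2) (cst c) <= 0%:E)%E.
  by apply: frame_sup_le => -[|i s] y; rewrite // frame_der_cst normr0.
have rem0 : rem x = 0.
  apply/eqP; rewrite -normr_le0 -lee_fin (le_trans (remB x))//.
  by rewrite mule_ge0_le0// lee_fin mulr_ge0 ?(ltW C_gt0)// addr_ge0// exprn_ge0// (dist_ge0 EF).
have [_] := remE x; rewrite rem0 mulr0 addr0 big_nat_recr//=.
rewrite big_nat_cond big1 ?add0r => [|i /andP[/andP[i1 ij] _]]; last by rewrite (IH i)// mulr0.
have -> : \int[N]_s cst c (Psi h s x) = c.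
  have e : c * fine (N setT) = c by rewrite probability_setT mulr1.
  by rewrite Rintegral_cst.
move=> /= /eqP; rewrite -[X in X == _]addr0 (inj_eq (addrI _)) eq_sym mulf_eq0 expf_eq0 => /orP[/andP[_ /eqP h0']|/eqP//].
by case/andP: hh; rewrite h0' ltxx.
Qed.

(** Averaged against the invariant measure of the method, the zero order term of the expansion
    cancels with the left-hand side. The bound holds on the whole interval up to [h1], whatever the
    threshold of [phi], so that this interval is common to all functions. *)
Lemma talay_tubaro_mean q phi : (1 <= q)%N -> smooth phi -> exists2 C, 0 <= C &
  forall h, 0 < h < h1 ->
    `|\sum_(1 <= j < q.+1) h ^+ j * \int[nu h]_x A j phi x| <= C * h ^+ q.+1.
Proof.
move=> q1 sphi.
have [C [kappa [C_gt0 /(_ phi (CP_smooth sphi))[h0 h0_gt0 H]]]] := TT.2 q q1.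
have [B B0 BP] := frame_bounded_uniform (2 * q + 2) (frame_bounded_smooth sphi).
have [B1 B10 B1P] := bounded_smooth sphi.
have [r r0 rP] : exists2 r, 0 <= r & forall x, dist g o x <= r.
  have cd : continuous (dist g o) by exact: (dist_continuous EF MC).
  have [c _ cmax] := compact_EVT_max (ex_intro _ o I : [set: M] !=set0) cM (continuous_subspaceT cd).
  by exists (dist g o c) => [|x]; [exact: (dist_ge0 EF)|apply: cmax; exact: mem_set].
(* [A 0] is arbitrary; shifting its index to 1 makes all members of the family smooth without
   changing the sums, which start at 1. *)
pose A' j := A (maxn 1 j) phi.
have sA j : smooth (A' j) by apply: smooth_A => //; rewrite leq_max.
have A'E (F : (M -> R) -> R) h : \sum_(1 <= j < q.+1) h ^+ j * F (A j phi) = \sum_(1 <= j < q.+1) h ^+ j * F (A' j).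
  by apply: eq_big_nat => j /andP[j1 _]; rewrite /A' (maxn_idPr j1).
have [BA BAP] := choice (fun j => let: ex_intro2 C a b := bounded_smooth (sA j) in ex_intro _ C (conj a b)).
pose K := C * (1 + r ^+ kappa) * B.
have K0 : 0 <= K by rewrite !mulr_ge0 ?addr_ge0 ?exprn_ge0// ltW.
pose K1 := \sum_(1 <= j < q.+1) h1 ^+ j * BA j.
have K10 : 0 <= K1.
  by apply: sumr_ge0 => j _; rewrite mulr_ge0 ?exprn_ge0 ?(ltW h1_gt0)//; have [] := BAP j.
(* [K] serves below the threshold [h0] of [phi]. Above it the sum is at most [K1], and
   [h ^+ q.+1 / h0 ^+ q.+1] is at least 1. *)
exists (K + K1 / h0 ^+ q.+1); first by rewrite addr_ge0// divr_ge0// exprn_ge0// ltW.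
move=> h hh; have /andP[h_gt0 hh1] := hh; rewrite mulrDl.
rewrite (A'E (fun F => \int[nu h]_x F x)).
have hq0 : 0 <= h ^+ q.+1 by rewrite exprn_ge0// ltW.
have [hlt|hge] := ltP h h0; last first.
  have le1 : `|\sum_(1 <= j < q.+1) h ^+ j * \int[nu h]_x A' j x| <= K1.
    apply: le_trans (ler_norm_sum _ _ _) _; apply: ler_sum => j _.
    rewrite normrM ger0_norm ?exprn_ge0 ?(ltW h_gt0)//; apply: ler_pM => //.
    - by rewrite exprn_ge0// ltW.
    - by rewrite lerXn2r ?nnegrE ?ltW.
    - by apply: Rintegral_bounded (measurable_smooth (sA j)) _ => x; have [_] := BAP j; exact.
  have le2 : K1 <= K1 / h0 ^+ q.+1 * h ^+ q.+1.
    rewrite mulrAC -mulrA ler_peMr// ler_pdivlMr ?exprn_gt0// mul1r.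
    by apply: lerXn2r => //; rewrite nnegrE ltW.
  have le3 : 0 <= K * h ^+ q.+1 by exact: mulr_ge0.
  by rewrite (le_trans le1)// (le_trans le2)// lerDr.
have le0 : 0 <= K1 / h0 ^+ q.+1 * h ^+ q.+1.
  by rewrite mulr_ge0// divr_ge0// exprn_ge0// ltW.
apply: le_trans (_ : K * h ^+ q.+1 <= _); last by rewrite lerDl.
have [|rem remE remB] := H h; first by rewrite h_gt0.
have remK x : `|rem x| <= K.
  rewrite -lee_fin (le_trans (remB x))//.
  have sem : (Ck_seminorm E (2 * q + 2) phi <= B%:E)%E.
    by apply: frame_sup_le => s y /andP[_]; exact: BP.
  have k0 : 0 <= C * (1 + dist g o x ^+ kappa).
    by rewrite mulr_ge0 ?(ltW C_gt0)// addr_ge0// exprn_ge0// (dist_ge0 EF).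
  rewrite (@le_trans _ _ ((C * (1 + dist g o x ^+ kappa))%:E * B%:E)%E)//.
    by apply: lee_wpmul2l; rewrite ?lee_fin.
  rewrite -EFinM lee_fin /K ler_wpM2r// ler_wpM2l ?(ltW C_gt0)// lerD2l.
  by rewrite lerXn2r ?nnegrE ?(dist_ge0 EF).
have [iPsi PsiE] := @Rintegral_invariant R _ _ S (Borel M) N (nu h)
  (fun z => Psi h z.1 z.2) phi B1 (Psi_meas h_gt0) (nu_inv hh) (measurable_smooth sphi) B1P.
have [iS SE] := Rintegral_lincomb (index_iota 1 q.+1) (fun j => h ^+ j) measurableT (fun j => integrable_smooth (nu h) (sA j)).
pose I1 x := \int[N]_s phi (Psi h s x); pose S1 x := \sum_(1 <= j < q.+1) h ^+ j * A' j x.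
have iphi := integrable_smooth (nu h) sphi.
have i1 : (nu h).-integrable setT (EFin \o (fun x => I1 x - phi x)).
  rewrite (_ : EFin \o _ = ((EFin \o I1) \- (EFin \o phi))%E); first exact: integrableB.
  by apply/funext => x /=; rewrite EFinB.
have i2 : (nu h).-integrable setT (EFin \o (fun x => I1 x - phi x - S1 x)).
  rewrite (_ : EFin \o _ = ((EFin \o (fun x => (I1 x - phi x)%R)) \- (EFin \o S1))%E); first exact: integrableB.
  by apply/funext => x /=; rewrite EFinB.
have SE2 : \sum_(1 <= j < q.+1) h ^+ j * \int[nu h]_x A' j x = - \int[nu h]_x (I1 x - phi x - S1 x).
  rewrite RintegralB// RintegralB// -SE.
  by rewrite (_ : \int[nu h]_x I1 x = \int[nu h]_x phi x)// subrr sub0r opprK.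
rewrite SE2 normrN; apply: Rintegral_bounded.
  by apply/measurable_EFinP; exact: measurable_int i2.
move=> x; have [_ E1] := remE x.
rewrite /I1 E1 (A'E (fun F => F x)) -/(S1 x) (_ : _ - S1 x = h ^+ q.+1 * rem x); last by ring.
by rewrite normrM ger0_norm// mulrC ler_wpM2r.
Qed.

End Numerics.

(** * The error expansion by induction on the order *)

Section WeakExpansion.
Context {R : realType} {D : nat} {M : manifold R D}.
Variables (g : metric M) (E : 'I_D -> M -> 'rV[R]_D) (o : M) (f : 'I_D -> M -> R).
Hypothesis EF : orthonormal_frame g E.
Hypothesis MC : connected [set: M].
Hypothesis cM : compact [set: M].
Context (dS : measure_display) (S : measurableType dS) (N : probability S R).
Variables (Psi : R -> S -> M -> M) (A : nat -> (M -> R) -> (M -> R)).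
Hypothesis Psi_meas : measurable_method Psi.
Hypothesis TT : talay_tubaro g E o N Psi A.
Hypothesis A_consistent : consistent E f A.
Variables (h1 : R) (nu : R -> probability (Borel M) R).
Hypothesis h1_gt0 : 0 < h1.
Hypothesis nu_inv : forall h, 0 < h < h1 ->
  Defs.invariant (fun (x : M) (B : set (Borel M)) => N [set s | B (Psi h s x)]) (nu h).
Variables (muinf : probability (Borel M) R) (p : nat).
Hypothesis potential : forall phi, smooth phi -> exists2 V, smooth V &
  forall x, generator E f V x = \int[muinf]_y phi y - phi x.
Hypothesis A_mean0 : forall j phi, (2 <= j <= p)%N -> smooth phi ->
  \int[muinf]_x A j phi x = 0.
Implicit Types (phi psi V : M -> R).

Definition mean_error h phi := \int[nu h]_x phi x - \int[muinf]_x phi x.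

(** The term of order [h] in the averaged expansion of [V] is [- h * mean_error h phi]; isolating it
    and dividing by [h] costs one order in the remainder. *)
Lemma mean_error_step q phi V : (1 <= q)%N -> smooth phi -> smooth V ->
  (forall x, generator E f V x = \int[muinf]_y phi y - phi x) ->
  exists2 C, 0 <= C & forall h, 0 < h < h1 ->
    `|mean_error h phi - \sum_(2 <= j < q.+1) h ^+ j.-1 * \int[nu h]_x A j V x| <= C * h ^+ q.
Proof.
move=> q1 sphi sV gV; have [C C0 CP] := talay_tubaro_mean EF MC cM Psi_meas TT h1_gt0 nu_inv q1 sV.
exists C => // h hh; have h0 : 0 < h by case/andP: hh.
have A1 : \int[nu h]_x A 1%N V x = - mean_error h phi.
  have -> : A 1%N V = (fun x => cst (\int[muinf]_y phi y) x - phi x).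
    by apply/funext => x; rewrite A_consistent// gV.
  rewrite RintegralB//; [|exact: (integrable_smooth EF cM _ (smooth_cst _))|exact: (integrable_smooth EF cM)].
  have e : (\int[muinf]_y phi y) * fine ((nu h) setT) = \int[muinf]_y phi y.
    by rewrite probability_setT mulr1.
  by rewrite Rintegral_cst// /mean_error opprB; congr (_ - _); exact: e.
have := CP h hh; rewrite big_ltn// A1 expr1.
have -> : \sum_(2 <= j < q.+1) h ^+ j * \int[nu h]_x A j V x =
    h * \sum_(2 <= j < q.+1) h ^+ j.-1 * \int[nu h]_x A j V x.
  rewrite mulr_sumr; apply: eq_big_nat => j /andP[j2 _].
  by rewrite mulrA -exprS prednK// (leq_trans _ j2).
rewrite -mulrDr normrM gtr0_norm// exprS mulrCA ler_pM2l//.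
by rewrite addrC distrC.
Qed.

(** Changing the measure in the term of index [j] produces [h ^+ j.-1] times the error of [A j V],
    which is $O(h^n)$ by hypothesis; as [j] is at least 2, this is $O(h^{n+1})$. *)
Lemma mean_error_expand n phi V :
  (forall psi, smooth psi -> exists2 C, 0 <= C & forall h, 0 < h < h1 ->
     `|mean_error h psi| <= C * h ^+ n) ->
  smooth phi -> smooth V ->
  (forall x, generator E f V x = \int[muinf]_y phi y - phi x) ->
  exists2 C, 0 <= C & forall h, 0 < h < h1 ->
    `|mean_error h phi - \sum_(2 <= j < n.+2) h ^+ j.-1 * \int[muinf]_x A j V x|
      <= C * h ^+ n.+1.
Proof.
move=> IH sphi sV gV; have [C C0 CP] := mean_error_step (ltn0Sn n) sphi sV gV.
have sA j : smooth (A (maxn 1 j) V) by apply: (smooth_A EF TT) => //; rewrite leq_max.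
have [B BP] := choice (fun j => let: ex_intro2 C a b := IH _ (sA j) in ex_intro _ C (conj a b)).
(* The excess of [h ^+ j.-1 * h ^+ n] over the order [n.+1] is [h ^+ j.-2], bounded by the power of
   [h1]. *)
exists (C + \sum_(2 <= j < n.+2) B j * h1 ^+ j.-2) => [|h hh].
  rewrite addr_ge0// sumr_ge0// => j _; rewrite mulr_ge0 ?exprn_ge0 ?(ltW h1_gt0)//.
  by have [] := BP j.
have h0 : 0 < h by case/andP: hh.
set S1 := \sum_(2 <= j < n.+2) _ * _.
set S2 := \sum_(2 <= j < n.+2) h ^+ j.-1 * \int[nu h]_x A j V x.
rewrite (_ : _ - S1 = (mean_error h phi - S2) + (S2 - S1)); last by ring.
rewrite (le_trans (ler_normD _ _))// mulrDl lerD//; first exact: CP.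
rewrite /S2 /S1 -sumrB (le_trans (ler_norm_sum _ _ _))// mulr_suml.
rewrite [leLHS]big_nat_cond [leRHS]big_nat_cond; apply: ler_sum => j; rewrite andbT => /andP[j2 _].
have j1 : maxn 1 j = j by rewrite (maxn_idPr _)// (leq_trans _ j2).
have [Bj0 /(_ h hh)] := BP j; rewrite j1 => H.
rewrite -mulrBr normrM gtr0_norm ?exprn_gt0//.
apply: le_trans (_ : h ^+ j.-1 * (B j * h ^+ n) <= _).
  by rewrite ler_wpM2l// exprn_ge0// ltW.
have -> : h ^+ j.-1 = h ^+ j.-2 * h.
  by rewrite -exprSr; congr (_ ^+ _); case: j j2 {j1 Bj0 H} => [|[|]].
rewrite (_ : h ^+ j.-2 * h * (B j * h ^+ n) = B j * h ^+ j.-2 * h ^+ n.+1); last by rewrite exprS; ring.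
rewrite ler_wpM2r ?exprn_ge0 ?(ltW h0)// ler_wpM2l//.
by apply: lerXn2r; rewrite ?nnegrE ltW//; case/andP: hh.
Qed.

Lemma mean_error_order n phi : (n <= p)%N -> smooth phi -> exists2 C, 0 <= C &
  forall h, 0 < h < h1 -> `|mean_error h phi| <= C * h ^+ n.
Proof.
elim: n phi => [|n IH] phi np sphi.
  have [B B0 BP] := bounded_smooth EF cM sphi.
  exists (B + B); first exact: addr_ge0.
  move=> h _; rewrite expr0 mulr1 (le_trans (ler_normB _ _))//.
  by apply: lerD; apply: Rintegral_bounded (measurable_smooth sphi) BP.
have [V sV gV] := potential sphi.
have [C C0 CP] := mean_error_expand (fun psi => IH psi (ltnW np)) sphi sV gV.
exists C => // h hh; have := CP h hh.
rewrite big_nat_cond big1 ?subr0// => j; rewrite andbT => /andP[j2 jn].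
by rewrite A_mean0 ?mulr0// j2 (leq_trans _ np).
Qed.

Lemma mean_error_leading phi V : (1 <= p)%N -> smooth phi -> smooth V ->
  (forall x, generator E f V x = \int[muinf]_y phi y - phi x) ->
  exists2 C, 0 <= C & forall h, 0 < h < h1 ->
    `|mean_error h phi - h ^+ p * \int[muinf]_x A p.+1 V x| <= C * h ^+ p.+1.
Proof.
move=> p1 sphi sV gV.
have [C C0 CP] := mean_error_expand (fun psi => mean_error_order (leqnn p)) sphi sV gV.
exists C => // h hh; have := CP h hh.
rewrite big_nat_recr//= big_nat_cond big1 ?add0r// => j; rewrite andbT => /andP[j2 jp].
by rewrite A_mean0 ?mulr0// j2.
Qed.

End WeakExpansion.

(** * Exchange of the time integral with the mean *)

Section Swap.
Context {R : realType} {d : measure_display} {Y : measurableType d}.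
Local Notation leb := (@lebesgue_measure R).

(** Joint measurability of a function measurable in [y] and continuous in [t]: it is the limit of
    its values at the times rounded down to multiples of [1 / n.+1], and each such approximation is
    a countable gluing of measurable functions. *)
Lemma measurable_fun_caratheodory (G : R -> Y -> R) :
  (forall t, 0 <= t -> measurable_fun setT (G t)) ->
  (forall y, {within `[0, +oo[, continuous (G ^~ y)}) ->
  measurable_fun setT (fun z : R * Y => G (Num.max 0 z.1) z.2).
Proof.
move=> mG cG.
pose k n (t : R) := Num.truncn (n.+1%:R * Num.max 0 t).
have k0 n (t : R) : 0 <= n.+1%:R * Num.max 0 t by rewrite mulr_ge0// le_max lexx.
apply: (@measurable_fun_cvg _ _ _ _ (fun n z => G ((k n z.1)%:R / n.+1%:R) z.2)).
  move=> n _ B mB; rewrite setTI.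
  rewrite (_ : _ @^-1` B = \bigcup_j ((fst @^-1` [set t | k n t = j]) `&`
      (snd @^-1` (G (j%:R / n.+1%:R) @^-1` B)))); last first.
    apply/seteqP; split=> [z /= Bz|z [j _ /= [<-]]//].
    by exists (k n z.1).
  apply: bigcupT_measurable => j; apply: measurableI.
    rewrite -[X in measurable X]setTI; apply: measurable_fst => //.
    have -> : [set t | k n t = j] = (fun t : R => n.+1%:R * Num.max 0 t) @^-1` `[j%:R, j.+1%:R[.
      apply/seteqP; split=> t /=; rewrite in_itv/= -truncn_eq//.
        by move=> H; apply/eqP.
      by move=> /eqP.
    rewrite -[X in measurable X]setTI; apply: continuous_measurable_fun => // t.
    apply: cvgM; first exact: cvg_cst.
    by apply: continuous_max; [exact: cvg_cst|exact: cvg_id].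
  rewrite -[X in measurable X]setTI; apply: measurable_snd => //.
  by rewrite -[X in measurable X]setTI; apply: mG.
move=> [t y] _ /=; set s := Num.max 0 t.
have s0 : 0 <= s by rewrite le_max lexx.
have := iffLR (subspace_continuousP _ _) (cG y) s.
rewrite /= in_itv/= s0 => /(_ isT) cs.
apply/cvgrPdist_lt => e e0.
move/cvgrPdist_lt : cs => /(_ e e0)[r /= r0 Hr]; near=> n.
apply: Hr; last by rewrite /= in_itv/= andbT divr_ge0.
have /andP[h1 h2] := truncn_itv (k0 n t).
have hn : n.+1%:R^-1 < r by near: n; exact: (near_infty_natSinv_lt (PosNum r0)).
have n0 : 0 < n.+1%:R :> R by rewrite ltr0n.
have e1 : (k n t)%:R / n.+1%:R <= s by rewrite ler_pdivrMr// mulrC.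
have e2 : s < (k n t)%:R / n.+1%:R + n.+1%:R^-1.
  by rewrite -[X in _ + X]mul1r -mulrDl ltr_pdivlMr// mulrC natr1.
suff : `|s - (k n t)%:R / n.+1%:R| < r by [].
by rewrite ger0_norm ?subr_ge0// ltrBlDl (lt_trans e2)// ltrD2l.
Unshelve. all: by end_near.
Qed.

Variables (mu : probability Y R) (m : R) (G : R -> Y -> R) (K : R).
Hypothesis m0 : 0 < m.
Hypothesis mG : forall t, 0 <= t -> measurable_fun setT (G t).
Hypothesis cG : forall y, {within `[0, +oo[, continuous (G ^~ y)}.
Hypothesis bG : forall t y, 0 <= t -> `|G t y| <= K * expd m t.

Let I0 : set R := `[0, +oo[%classic.
(** The extension by 0 to negative times, in order to apply Fubini on the whole product; [Num.max 0]
    keeps the times at which [G] is evaluated in the range of the hypotheses. *)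
Let H (z : R * Y) : R := G (Num.max 0 z.1) z.2 * \1_I0 z.1.

Let HE t y : H (t, y) = G t y * \1_I0 t.
Proof.
rewrite /H/= indicE; case: (boolP (t \in I0)); last by rewrite !mulr0.
by rewrite inE /I0/= in_itv/= andbT => t0; rewrite max_r.
Qed.

Let H_le t y : `|H (t, y)| <= K * expd m t * \1_I0 t.
Proof.
rewrite HE indicE; case: (boolP (t \in I0)); last by rewrite !mulr0 normr0.
by rewrite inE /I0/= in_itv/= andbT !mulr1; exact: bG.
Qed.

Let mI0 : measurable I0.
Proof. exact: measurable_itv. Qed.

Let mH : measurable_fun setT H.
Proof.
apply: measurable_funM; first exact: measurable_fun_caratheodory.
have m1 : measurable_fun setT (\1_I0 : R -> R) by exact: measurable_indic.
exact: (measurableT_comp m1 measurable_fst).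
Qed.

Let mEH : measurable_fun setT (EFin \o H).
Proof. exact/measurable_EFinP. Qed.

Let integral_indic_mul (f : R -> R) :
  (\int[leb]_t (f t * \1_I0 t)%:E = \int[leb]_(t in I0) (f t)%:E)%E.
Proof.
rewrite [RHS]integral_mkcond; apply: eq_integral => t _.
by rewrite patchE indicE; case: ifPn => _; rewrite ?mulr1 ?mulr0.
 Qed.

Let mu_cst (c : \bar R) : (\int[mu]_y c = c)%E.
Proof.
have e : (c * mu setT = c)%E by rewrite probability_setT mule1.
by rewrite integral_cst.
Qed.

Let iH : (leb \x mu)%E.-integrable setT (EFin \o H).
Proof.
apply/integrable12ltyP => //.
apply: (@le_lt_trans _ _ (\int[leb]_t (K * expd m t * \1_I0 t)%:E)%E).
  apply: ge0_le_integral => //.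
  - by move=> t _; exact: integral_ge0.
  - have mA : measurable_fun setT (abse \o (EFin \o H)) by apply: measurableT_comp.
    exact: (measurable_fun_fubini_tonelli_F _ mA (fun z => abse_ge0 _)).
  - apply/measurable_EFinP; apply: measurable_funM; last exact: measurable_indic.
    apply: measurable_funM => //; apply: continuous_measurable_fun; exact: continuous_expd.
  move=> t _; rewrite -[leRHS]mu_cst; apply: ge0_le_integral => //.
  - by apply: measurableT_comp => //; apply: (measurableT_comp mEH); exact: pair1_measurable.
  - by move=> y _ /=; rewrite lee_fin; exact: H_le.
rewrite integral_indic_mul.
have : (\int[leb]_(t in I0) (K * expd m t)%:E)%E \is a fin_num.
  by apply: integrable_fin_num => //; exact: integrable_expd.
by rewrite fin_numE => /andP[_]; rewrite ltey.
Qed.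

Let iG t : 0 <= t -> mu.-integrable setT (EFin \o G t).
Proof. by move=> t0; apply: (integrable_bounded mu (mG t0)) => y; exact: bG. Qed.

Let FE t : fubini_F mu (EFin \o H) t = ((\int[mu]_y G t y) * \1_I0 t)%:E.
Proof.
rewrite /fubini_F /=; under eq_integral do rewrite HE.
rewrite indicE; case: (boolP (t \in I0)) => [|_]; last first.
  by under eq_integral do rewrite mulr0; rewrite mulr0 integral0.
rewrite inE /I0/= in_itv/= andbT => t0; rewrite mulr1.
under eq_integral do rewrite mulr1.
by rewrite /Rintegral fineK//; apply: integrable_fin_num => //; exact: iG.
Qed.

Lemma integrable_mean_decay :
  leb.-integrable `[0, +oo[ (EFin \o (fun t => \int[mu]_y G t y)).
Proof.
have iF : leb.-integrable I0 (fubini_F mu (EFin \o H)).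
  by apply: (integrableS measurableT) => //; exact: integrable_fubini_F iH.
apply: eq_integrable iF => // t It.
by rewrite FE indicE It mulr1.
Qed.

Lemma Rintegral_mean_decay :
  \int[leb]_(t in `[0, +oo[) \int[mu]_y G t y =
  \int[mu]_y \int[leb]_(t in `[0, +oo[) G t y.
Proof.
rewrite [LHS]/Rintegral -integral_indic_mul.
have -> : (\int[leb]_t ((\int[mu]_y G t y)%R * \1_I0 t)%:E = \int[leb]_t \int[mu]_y (EFin \o H) (t, y))%E.
  by apply: eq_integral => t _; rewrite -FE.
rewrite (Fubini iH) [RHS]/Rintegral; congr fine; apply: eq_integral => y _ /=.
under eq_integral do rewrite HE.
rewrite integral_indic_mul /Rintegral fineK//; apply: integrable_fin_num => //.
apply: (integrable_decay m0 (C := K)) => [|t t0]; last exact: bG.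
by apply: subspace_continuous_measurable_fun => //; exact: cG.
Qed.

End Swap.

(** * Differential operators under the time integral *)

Section DiffopIntegral.
Context {R : realType} {D : nat} {M : manifold R D}.
Variables (g : metric M) (E : 'I_D -> M -> 'rV[R]_D).
Hypothesis EF : orthonormal_frame g E.
Hypothesis MC : connected [set: M].
Hypothesis cM : compact [set: M].
Implicit Types (phi psi V : M -> R) (s : seq 'I_D).
Local Notation leb := (@lebesgue_measure R).
Let sE := smooth_field_frame EF.

Lemma diffopD n (B : (M -> R) -> (M -> R)) phi psi x : diffop E n B ->
  smooth phi -> smooth psi -> B (fun y => phi y + psi y) x = B phi x + B psi x.
Proof.
move=> [b _ HB] sphi spsi; rewrite !HB//; last exact: smoothD.
rewrite -big_split; apply: eq_bigr => k _; rewrite -big_split; apply: eq_bigr => s _ /=.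
by rewrite frame_derD// mulrDr.
Qed.

Variables (m : R) (U : R -> M -> R) (C : seq 'I_D -> R) (V : M -> R).
Hypothesis m0 : 0 < m.
Hypothesis C0 : forall s, 0 <= C s.
Hypothesis sU : forall t, 0 <= t -> smooth (U t).
Hypothesis cU : forall s x, {within `[0, +oo[, continuous (fun t => frame_der E s (U t) x)}.
Hypothesis bU : forall s t x, 0 <= t -> `|frame_der E s (U t) x| <= C s * expd m t.
Hypothesis sV : smooth V.
Hypothesis dV : forall s x, frame_der E s V x =
  \int[leb]_(t in `[0, +oo[) frame_der E s (U t) x.

(** An operator is a finite sum of frame derivatives with coefficients that are bounded on compact
    M. So [B (U t)] decays like [U], its mean commutes with the time integral, and [B V] is the
    integral of [B (U t)]. *)
Lemma integral_diffop n (B : (M -> R) -> (M -> R)) (mu : probability (Borel M) R) :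
  diffop E n B ->
  leb.-integrable `[0, +oo[ (EFin \o (fun t => \int[mu]_x B (U t) x)) /\
  \int[leb]_(t in `[0, +oo[) \int[mu]_x B (U t) x = \int[mu]_x B V x.
Proof.
move=> dB; have [b sb HB] := dB.
have [K KP] := choice (fun s => let: ex_intro2 C a b := bounded_smooth EF cM (sb s) in ex_intro _ C (conj a b)).
pose G t x := \sum_(k < n.+1) \sum_(s : k.-tuple 'I_D) b s x * frame_der E s (U t) x.
have GE t x : 0 <= t -> G t x = B (U t) x by move=> t0; rewrite HB//; exact: sU.
pose KK := \sum_(k < n.+1) \sum_(s : k.-tuple 'I_D) K s * C s.
have mG t : 0 <= t -> measurable_fun setT (G t : Borel M -> R).
  move=> t0; apply: measurable_smooth; apply: smooth_sum => k; apply: smooth_sum => s.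
  by apply: smoothM => //; apply: smooth_frame_der => //; exact: sU.
have cG x : {within `[0, +oo[, continuous (G ^~ x)}.
  move=> t; apply: (@cvg_sumr _ _ _ _ R^o) => k; apply: (@cvg_sumr _ _ _ _ R^o) => s.
  by apply: cvgM; [exact: cvg_cst|exact: cU].
have bG t x : 0 <= t -> `|G t x| <= KK * expd m t.
  move=> t0; rewrite (le_trans (ler_norm_sum _ _ _))// mulr_suml; apply: ler_sum => k _.
  rewrite (le_trans (ler_norm_sum _ _ _))// mulr_suml; apply: ler_sum => s _.
  by rewrite normrM -mulrA ler_pM//; [have [_] := KP s; exact|exact: bU].
have swap := @Rintegral_mean_decay _ _ (Borel M) mu m G KK m0 mG cG bG.
have int := @integrable_mean_decay _ _ (Borel M) mu m G KK m0 mG cG bG.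
have tP (t : R) : t \in (`[0, +oo[%classic : set R) -> 0 <= t.
  by rewrite inE /= in_itv/= andbT.
split.
  apply: eq_integrable int => // t /tP t0 /=; congr EFin.
  by apply: eq_Rintegral => x _; rewrite GE.
transitivity (\int[leb]_(t in `[0, +oo[) \int[mu]_y G t y).
  by apply: eq_Rintegral => t /tP t0; apply: eq_Rintegral => x _; rewrite GE.
rewrite swap; apply: eq_Rintegral => x _; rewrite HB//.
have iU s : leb.-integrable `[0, +oo[ (EFin \o (fun t => frame_der E s (U t) x)).
  apply: (integrable_decay m0 (C := C s)) => [|t t0]; last exact: bU.
  by apply: subspace_continuous_measurable_fun => //; exact: cU.
have inner (k : 'I_n.+1) := @Rintegral_lincomb _ _ _ leb `[0, +oo[%classic
  (k.-tuple 'I_D) (index_enum _) (fun s : k.-tuple 'I_D => b s x)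
  (fun (s : k.-tuple 'I_D) t => frame_der E s (U t) x) (measurable_itv _) (fun s : k.-tuple 'I_D => iU s).
have [_ outer] := @Rintegral_lincomb _ _ _ leb `[0, +oo[%classic 'I_n.+1 (index_enum _) (fun=> 1)
  (fun k t => \sum_(s : k.-tuple 'I_D) b s x * frame_der E s (U t) x) (measurable_itv _) (fun k => (inner k).1).
transitivity (\int[leb]_(t in `[0, +oo[) \sum_(k < n.+1) 1 * \sum_(s : k.-tuple 'I_D) b s x * frame_der E s (U t) x).
  by apply: eq_Rintegral => t _; apply: eq_bigr => k _; rewrite mul1r.
rewrite outer; apply: eq_bigr => k _; rewrite mul1r (inner k).2.
by apply: eq_bigr => s _; rewrite dV.
Qed.

End DiffopIntegral.

(** * The order of the method and the leading term of its error *)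

Theorem theorem2p16 (R : realType) (D : nat) (D_gt0 : (0 < D)%N)
  (* the Riemannian manifold, its volume, frame and base point *)
  (M : manifold R D) (M_connected : connected [set: M])
  (g : metric M) (g_complete : metric_complete g)
  (vol : {measure set (Borel M) -> \bar R}) (vol_g : riemannian_volume g vol)
  (E : 'I_D -> M -> 'rV[R]_D) (E_frame : orthonormal_frame g E) (o : M)
  (* the SDE, with its solutions X x issued from each x *)
  (f : 'I_D -> M -> R) (fE_wp : well_posed g E f o)
  (d : measure_display) (T : measurableType d) (P : probability T R)
  (Fil : R -> set (set T)) (Fil_filtration : filtration Fil)
  (W : 'I_D -> R -> T -> R) (W_bm : brownian_motion P Fil W)
  (X : M -> R -> T -> M)
  (X_sol : forall x, sde_solution P E f Fil W x (X x))
  (X_kolmogorov : backward_kolmogorov P g E f o X)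
  (* the invariant measure and the assumptions on the SDE *)
  (Ls : (M -> R) -> (M -> R)) (Ls_adj : adjoint E vol (generator E f) Ls)
  (rho : M -> R) (muinf : probability (Borel M) R)
  (muinf_unique : unique_invariant_measure P g E o X vol Ls rho muinf)
  (poisson : poisson_solvable g E o vol Ls muinf)
  (gap : spectral_gap P g E o X muinf)
  (* the numerical method *)
  (dS : measure_display) (S : measurableType dS) (N : probability S R)
  (Psi : R -> S -> M -> M) (Psi_meas : measurable_method Psi)
  (d' : measure_display) (T' : measurableType d') (P' : probability T' R)
  (xi : nat -> T' -> S) (xi_iid : iid N P' xi)
  (A : nat -> (M -> R) -> (M -> R)) (A_expansion : talay_tubaro g E o N Psi A)
  (A_consistent : consistent E f A)
  (Psi_ergodic : exists2 h1 : R, 0 < h1 & forall h, 0 < h < h1 ->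
     ergodic g E o N P' vol Psi xi h)
  (* As j is the adjoint of A j; As j rho vol is the measure (A j)^* muinf *)
  (As : nat -> (M -> R) -> (M -> R))
  (As_adj : forall j, (1 <= j)%N -> adjoint E vol (A j) (As j))
  (As_duality : forall j phi, (1 <= j)%N -> CP g E o phi ->
     [/\ muinf.-integrable setT (EFin \o A j phi),
         vol.-integrable setT (fun x => (phi x * As j rho x)%:E)
       & \int[vol]_x (phi x * As j rho x) = \int[muinf]_x A j phi x])
  (p : nat) (p_ge1 : (1 <= p)%N)
  (As_rho : forall j, (2 <= j <= p)%N -> forall x, As j rho x = 0) :
  invariant_order g E o P' muinf Psi xi p /\
  exists2 h0 : R, 0 < h0 & forall phi, CP g E o phi ->
    let u := semigroup P X phi in
    let w t := \int[vol]_x (u t x * As p.+1 rho x) in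
    [/\ forall t, 0 <= t ->
          vol.-integrable setT (fun x => (u t x * As p.+1 rho x)%:E),
        lebesgue_measure.-integrable `[0, +oo[ (EFin \o w)
      & exists2 C : R, 0 < C & forall h, 0 < h <= h0 ->
          exists2 e, invariant_error P' muinf Psi xi phi h e &
            `|e - h ^+ p * \int[lebesgue_measure]_(t in `[0, +oo[) w t|
              <= C * h ^+ p.+1].
Proof.
have [_ fX _] := fE_wp.
have [_ CPmu _ _ _] := muinf_unique.
have [r rP] := dist_bounded E_frame M_connected X_kolmogorov gap D_gt0 g_complete fX CPmu.
have cM : compact [set: M].
  (* As r is bounded, M is one of its own closed balls. *)
  have -> : [set: M] = dball g o r by apply/seteqP; split=> x // _; exact: rP.
  exact: (dball_compact E_frame).
have cpS phi : smooth phi -> CP g E o phi by exact: CP_smooth.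
have fbS phi : smooth phi -> frame_bounded E phi by exact: (frame_bounded_smooth E_frame).
have A_mean0 j phi : (2 <= j <= p)%N -> smooth phi -> \int[muinf]_x A j phi x = 0.
  move=> jp sphi; have j1 : (1 <= j)%N by case/andP: jp => /ltnW.
  have [_ _ <-] := As_duality j phi j1 (cpS _ sphi).
  by under eq_Rintegral do rewrite As_rho// mulr0; rewrite Rintegral_cst// mul0r.
have [h1 h1_gt0 erg] := Psi_ergodic.
have [nu nuP] : exists nu : R -> probability (Borel M) R, forall h, 0 < h < h1 ->
    Defs.invariant (fun (x : M) (B : set (Borel M)) => N [set s | B (Psi h s x)]) (nu h) /\
    forall phi, CP g E o phi -> forall x, {ae P', forall w,
      ergodic_average Psi xi phi h x w n @[n --> \oo] --> \int[nu h]_y phi y}.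
  suff /choice[nu nuP] : forall h, exists mu : probability (Borel M) R, 0 < h < h1 ->
    Defs.invariant (fun (x : M) (B : set (Borel M)) => N [set s | B (Psi h s x)]) mu /\
    forall phi, CP g E o phi -> forall x, {ae P', forall w,
      ergodic_average Psi xi phi h x w n @[n --> \oo] --> \int[mu]_y phi y}.
    by exists nu.
  (* The choice needs a measure for every [h]; outside of [(0, h1)] it is constrained by nothing,
     and [muinf] is taken. *)
  move=> h; have [hh|nh] := pselect (0 < h < h1); last by exists muinf.
  have [rhoh [muh [_ inv _ lim]]] := erg h hh; exists muh => _; split=> // phi /lim[_]; exact.
have nu_inv h (hh : 0 < h < h1) := (nuP h hh).1.
have errP h phi : 0 < h < h1 -> CP g E o phi ->
    invariant_error P' muinf Psi xi phi h (mean_error nu muinf h phi).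
  move=> hh cphi x; have := (nuP h hh).2 phi cphi x.
  by apply: filterS => w cv; apply: cvgB cv _; exact: cvg_cst.
have [m m0 pot] := ex_potential E_frame M_connected X_kolmogorov gap.
have potential phi : smooth phi -> exists2 V, smooth V &
    forall x, generator E f V x = \int[muinf]_y phi y - phi x.
  move=> sphi; have [C _ [_ _ [sV _] _ gV]] := pot phi (cpS _ sphi) (fbS _ sphi).
  by eexists; [exact: sV|exact: gV].
split.
  exists h1 => // phi cphi.
  have [C C0 CP'] := mean_error_order E_frame M_connected cM Psi_meas A_expansion
    A_consistent h1_gt0 nu_inv potential A_mean0 (leqnn p) cphi.1.
  exists (C + 1) => [|h hh]; first by rewrite ltr_wpDl.
  exists (mean_error nu muinf h phi); first exact: errP.
  rewrite (le_trans (CP' h hh))// ler_wpM2r ?lerDl//.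
  by rewrite exprn_ge0// ltW//; case/andP: hh.
(* The expansion is claimed up to and including [h0], while the method is only controlled for
   [h < h1]. *)
exists (h1 / 2); first by rewrite divr_gt0.
move=> phi cphi u w.
have [C C0 [bU cU [sV _] dV gV]] := pot phi cphi (fbS _ cphi.1).
set V := fun x => \int[lebesgue_measure]_(t in `[0, +oo[) centered P X muinf phi t x in sV dV gV.
have [_ su _ _ _] := X_kolmogorov phi cphi.
have sc t : 0 <= t -> smooth (centered P X muinf phi t) by move=> t0; apply: smooth_centered cphi t0; exact: X_kolmogorov.
have dA : diffop E (2 * p.+1) (A p.+1) by exact: A_expansion.1.
have [intA eqA] := integral_diffop E_frame cM m0 sc cU bU sV dV muinf dA.
(* The two functions differ by the constant mean of [phi], which [A p.+1] kills. The duality with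
   [As p.+1] is then used for [u], and the decay for the centered function. *)
have AE t : 0 <= t -> A p.+1 (u t) = A p.+1 (centered P X muinf phi t).
  move=> t0; apply/funext => x.
  have := diffopD E_frame x dA (sc t t0) (smooth_cst (\int[muinf]_y phi y)).
  rewrite (talay_tubaro_cst E_frame M_connected cM A_expansion)// addr0 => <-.
  by congr (A p.+1 _ x); apply/funext => y; rewrite /centered subrK.
have wE t : 0 <= t -> w t = \int[muinf]_x A p.+1 (centered P X muinf phi t) x.
  by move=> t0; have [_ _] := As_duality p.+1 (u t) isT (cpS _ (su t t0)); rewrite -AE.
have tP (t : R) : t \in (`[0, +oo[%classic : set R) -> 0 <= t.
  by rewrite inE /= in_itv/= andbT.
have [K K0 KP] := mean_error_leading E_frame M_connected cM Psi_meas A_expansion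
    A_consistent h1_gt0 nu_inv potential A_mean0 p_ge1 cphi.1 sV gV.
split.
- by move=> t t0; have [] := As_duality p.+1 (u t) isT (cpS _ (su t t0)).
- by apply: eq_integrable intA => // t /tP t0 /=; rewrite wE.
exists (K + 1) => [|h /andP[h0 hh]]; first by rewrite ltr_wpDl.
have {}hh : 0 < h < h1.
  by rewrite h0 (le_lt_trans hh)// ltr_pdivrMr// mulr_natr mulr2n ltrDl.
exists (mean_error nu muinf h phi); first exact: errP.
have -> : \int[lebesgue_measure]_(t in `[0, +oo[) w t = \int[muinf]_x A p.+1 V x.
  by rewrite -eqA; apply: eq_Rintegral => t /tP t0; rewrite wE.
by rewrite (le_trans (KP h hh))// ler_wpM2r ?lerDl// exprn_ge0// ltW.
Qed.
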